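(* Let $\Omega$ be an open subset of $\mathbb{R}^d$ of finite volume. Then, for any real $\tau\geq0$, $$T(\Omega,\tau)\leq T(B,\tau),$$ where $B\subset\mathbb{R}^d$ is a ball of the same volume as $\Omega$.
   Context: For $\tau\ge 0$ and an open set $\Omega\subset\mathbb{R}^d$ of finite volume, the torsion function of $\Omega$ is the unique $w\in H_0^2(\Omega)$ (closure of $C_c^\infty(\Omega)$ in $H^2(\Omega)$) solving $\Delta^2w-\tau\Delta w=1$ in $\Omega$ weakly, i.e. $\int_\Omega\Delta w\,\Delta v+\tau\int_\Omega\nabla w\cdot\nabla v=\int_\Omega v$ for all $v\in H_0^2(\Omega)$. The torsional rigidity is $T(\Omega,\tau)=\int_\Omega w$. *)

(* Defs.v *)
From HB Require Import structures.
From mathcomp Require Import all_boot all_order all_algebra.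
From mathcomp Require Import all_classical all_reals all_analysis.

Set Implicit Arguments.
Unset Strict Implicit.
Unset Printing Implicit Defensive.
Import Order.TTheory GRing.Theory Num.Theory.
Import numFieldNormedType.Exports.

Local Open Scope classical_set_scope.
Local Open Scope ring_scope.

(** [R^d] is ['rV[R]_d], with the library's topology (the sup norm induces the
    Euclidean topology). It gets the sigma-algebra generated by the
    coordinates, as the library does for [n.-tuple T]; this is the Borel
    sigma-algebra. *)
Section measurable_rV.
Context {R : realType} (d : nat).

Let coord : 'I_d -> 'rV[R]_d -> measurableTypeR R := fun i x => x 0 i.

Let rV_set0 : g_sigma_preimage coord set0.
Proof. exact: sigma_algebra0. Qed.

Let rV_setC A : g_sigma_preimage coord A -> g_sigma_preimage coord (~` A).
Proof. exact: sigma_algebraC. Qed.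

Let rV_bigcup (F : (set 'rV[R]_d)^nat) :
  (forall i, g_sigma_preimage coord (F i)) ->
  g_sigma_preimage coord (\bigcup_i (F i)).
Proof. exact: sigma_algebra_bigcup. Qed.

HB.instance Definition _ := @isMeasurable.Build default_measure_display
  'rV[R]_d (g_sigma_preimage coord) rV_set0 rV_setC rV_bigcup.

Lemma measurable_coord (i : 'I_d) :
  measurable_fun [set: 'rV[R]_d] (fun x => x 0 i : measurableTypeR R).
Proof.
move=> _ Y mY; rewrite setTI; apply: sub_sigma_algebra => /=.
rewrite -bigcup_seq/=; exists i => /=; first by rewrite mem_index_enum.
by exists Y => //; rewrite setTI.
Qed.

Lemma measurable_rVP d1 (T : measurableType d1) (f : T -> 'rV[R]_d) :
  (forall i, measurable_fun [set: T] (fun x => f x 0 i : measurableTypeR R)) ->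
  measurable_fun [set: T] f.
Proof.
move=> mf.
have : g_sigma_preimage (fun i => coord i \o f) `<=` measurable.
  apply: smallest_sub; first exact: sigma_algebra_measurable.
  rewrite -bigcup_seq/=; apply: bigcup_sub => i _ A [B mB <-].
  exact: mf.
rewrite g_sigma_preimage_comp => prefS _ A mA.
by apply: prefS; exists A.
Qed.

End measurable_rV.

Section lebesgue_measure_rV.
Context {R : realType}.

Definition cons_rV (d : nat) (p : measurableTypeR R * 'rV[R]_d) : 'rV[R]_d.+1 :=
  \row_i oapp (fun j => p.2 0 j) p.1 (unlift 0 i).

Let uncons_rV (d : nat) (x : 'rV[R]_d.+1) : measurableTypeR R * 'rV[R]_d :=
  (x 0 0, \row_j x 0 (lift 0 j)).

Lemma cons_rV0 d p : @cons_rV d p 0 0 = p.1.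
Proof. by rewrite mxE unlift_none. Qed.

Lemma cons_rVS d p j : @cons_rV d p 0 (lift 0 j) = p.2 0 j.
Proof. by rewrite mxE liftK. Qed.

Let cons_rVK d : cancel (@cons_rV d) (@uncons_rV d).
Proof.
move=> p; rewrite /uncons_rV cons_rV0 [RHS]surjective_pairing; congr pair.
by apply/rowP => j; rewrite mxE cons_rVS.
Qed.

Lemma measurable_cons_rV d : measurable_fun setT (@cons_rV d).
Proof.
apply: measurable_rVP => i; case: (unliftP 0 i) => [j|] ->.
- under eq_fun do rewrite cons_rVS.
  exact: (measurableT_comp (measurable_coord j) measurable_snd).
- under eq_fun do rewrite cons_rV0.
  exact: measurable_fst.
Qed.

Let measurable_uncons_rV d : measurable_fun setT (@uncons_rV d).
Proof.
apply: measurable_fun_pair => /=; first exact: measurable_coord.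
apply: measurable_rVP => j.
under eq_fun do rewrite mxE.
exact: measurable_coord.
Qed.

Section lebesgue_step.
Context (d : nat) (mu : {sigma_finite_measure set 'rV[R]_d -> \bar R}).

Definition lebesgue_step : set 'rV[R]_d.+1 -> \bar R :=
  pushforward (@lebesgue_measure R \x mu)%E (@cons_rV d).

HB.instance Definition _ :=
  isMeasurableFun.Build _ _ _ _ (@cons_rV d) (@measurable_cons_rV d).

Let lebesgue_step0 : lebesgue_step set0 = 0%E.
Proof. exact: measure0. Qed.

Let lebesgue_step_ge0 A : (0 <= lebesgue_step A)%E.
Proof. exact: measure_ge0. Qed.

Let lebesgue_step_sigma_additive : semi_sigma_additive lebesgue_step.
Proof. exact: measure_semi_sigma_additive. Qed.

HB.instance Definition _ := isMeasure.Build _ _ _ lebesgue_step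
  lebesgue_step0 lebesgue_step_ge0 lebesgue_step_sigma_additive.

Let lebesgue_step_sigma_finite : sigma_finite setT lebesgue_step.
Proof.
have /sigma_finiteP[F [TF ndF Foo]] := sigma_finiteT (@lebesgue_measure R).
have /sigma_finiteP[G [TG ndG Goo]] := sigma_finiteT mu.
exists (fun k => @uncons_rV d @^-1` (F k `*` G k)) => [|k].
  rewrite -preimage_bigcup (_ : \bigcup_k _ = setT) ?preimage_setT//.
  apply/seteqP; split => // -[x y] _.
  have [n _ Fnx] : (\bigcup_k F k) x by rewrite -TF.
  have [k _ Gky] : (\bigcup_k G k) y by rewrite -TG.
  exists (maxn n k) => //; split.
  - by move: x Fnx; exact/subsetPset/ndF/leq_maxl.
  - by move: y Gky; exact/subsetPset/ndG/leq_maxr.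
have [mF Fk] := Foo k; have [mG Gk] := Goo k; split.
  rewrite -[X in measurable X]setTI; apply: measurable_uncons_rV => //.
  exact: measurableX.
rewrite /lebesgue_step /pushforward -comp_preimage.
rewrite (_ : _ \o _ = id) ?preimage_id; last exact/funext/cons_rVK.
by rewrite product_measure1E// lte_mul_pinfty// ge0_fin_numE.
Qed.

HB.instance Definition _ := Measure_isSigmaFinite.Build _ _ _ lebesgue_step
  lebesgue_step_sigma_finite.

End lebesgue_step.

(** The [d]-fold product of the Lebesgue measure of the line, along the
    identification of [R * R^d] with [R^(d+1)]; unit mass at the point of
    [R^0]. *)
Fixpoint lebesgue_rV (d : nat) : {sigma_finite_measure set 'rV[R]_d -> \bar R} :=
  if d is d'.+1 then lebesgue_step (lebesgue_rV d') else \d_ (0 : 'rV[R]_0).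

End lebesgue_measure_rV.

Section clamped_plate.
Context {R : realType} {d : nat}.
Local Notation mu := (lebesgue_rV d).
Implicit Types (Omega : set 'rV[R]_d) (f g : 'rV[R]_d -> R).

Definition partial (i : 'I_d) f : 'rV[R]_d -> R :=
  fun x => 'D_(delta_mx 0 i) f x.

(** Differentiability of every iterated partial derivative is equivalent to
    [C^oo]: it makes all of them exist and be continuous. *)
Definition smooth f :=
  forall (s : seq 'I_d) (x : 'rV[R]_d), differentiable (foldr partial f s) x.

Definition test_function Omega f :=
  let supp := closure [set x | f x != 0] in
  [/\ smooth f, compact supp & supp `<=` Omega].

Definition square_integrable Omega f :=
  measurable_fun Omega f /\ (\int[mu]_(x in Omega) (f x ^+ 2)%:E < +oo)%E.

(** [g] is the distributional derivative of [f] in [Omega] along the [i]-th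
    coordinate. *)
Definition weak_partial Omega (i : 'I_d) f g :=
  forall phi, test_function Omega phi ->
    \int[mu]_(x in Omega) (f x * partial i phi x) =
    - \int[mu]_(x in Omega) (g x * phi x).

(** An element of [H^2] is handled as a function together with its first and
    second weak derivatives, which it determines almost everywhere. All these
    functions are total; only their values in [Omega] matter. *)
Record jet2 := Jet2 {
  jfun :> 'rV[R]_d -> R;
  grad : 'I_d -> 'rV[R]_d -> R;
  hess : 'I_d -> 'I_d -> 'rV[R]_d -> R }.

Definition jet_of f : jet2 :=
  Jet2 f (fun i => partial i f) (fun i j => partial j (partial i f)).

Definition jet_sub (u v : jet2) : jet2 :=
  Jet2 (fun x => u x - v x) (fun i x => grad u i x - grad v i x)
    (fun i j x => hess u i j x - hess v i j x).

Definition laplacian (u : jet2) : 'rV[R]_d -> R := fun x => \sum_i hess u i i x.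

Definition H2 Omega (u : jet2) :=
  [/\ square_integrable Omega u,
      forall i, square_integrable Omega (grad u i) /\
                weak_partial Omega i u (grad u i) &
      forall i j, square_integrable Omega (hess u i j) /\
                  weak_partial Omega j (grad u i) (hess u i j)].

Definition sqnorm_H2 Omega (u : jet2) : \bar R :=
  (\int[mu]_(x in Omega) (u x ^+ 2)%:E
   + \sum_i \int[mu]_(x in Omega) (grad u i x ^+ 2)%:E
   + \sum_i \sum_j \int[mu]_(x in Omega) (hess u i j x ^+ 2)%:E)%E.

(** The closure of [C_c^oo(Omega)] in [H^2(Omega)]. *)
Definition H20 Omega (u : jet2) :=
  H2 Omega u /\
  exists phi : nat -> 'rV[R]_d -> R,
    (forall n, test_function Omega (phi n)) /\
    sqnorm_H2 Omega (jet_sub u (jet_of (phi n))) @[n --> \oo] --> 0%E.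

Definition is_torsion_function Omega (tau : R) (w : 'rV[R]_d -> R) :=
  exists W : jet2, [/\ jfun W = w, H20 Omega W &
    forall V : jet2, H20 Omega V ->
      \int[mu]_(x in Omega) (laplacian W x * laplacian V x)
      + tau * \int[mu]_(x in Omega) (\sum_i grad W i x * grad V i x)
      = \int[mu]_(x in Omega) V x].

(** The torsion function exists and is unique almost everywhere in [Omega] when
    [Omega] is open of finite volume, [tau >= 0] and [d > 0]; the default value
    [0] of [xget] is then irrelevant. *)
Definition torsion_function Omega (tau : R) : 'rV[R]_d -> R :=
  xget (cst 0) (is_torsion_function Omega tau).

Definition torsional_rigidity Omega (tau : R) : R :=
  \int[mu]_(x in Omega) torsion_function Omega tau x.

(** The open ball for the Euclidean norm; the library's [ball] on ['rV[R]_d] is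
    the one of the sup norm. It is empty when [r <= 0]. *)
Definition euclidean_ball (c : 'rV[R]_d) (r : R) : set 'rV[R]_d :=
  [set x | Num.sqrt (\sum_i (x 0 i - c 0 i) ^+ 2) < r].

End clamped_plate.

(* Main.v *)
(** If [W] is the torsion function of [Omega] and [a] the bilinear form of the
    plate, then for every test function [phi]
    [T(Omega) = 2 \int phi - a(phi, phi) + a(W - phi, W - phi)], so it is enough
    to bound [2 \int phi - \int (Lap phi)^2 - tau \int |grad phi|^2] by [T(B)].

    Let [u] nearly minimise [\int |grad u|^2 / 2 - \int u], so that
    [-Lap u = 1] up to a small error, and split [u = G + tau Q], where [G] and
    [Q] are functions of [u] with [G' = 1 - tau q], [Q' = q] on the level
    [u = t]. Then [\int phi] is [- \int (G - mean G) Lap phi + tau \int grad Q . grad phi],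
    and Cauchy-Schwarz bounds the functional by the variance of [G] plus
    [tau \int |grad Q|^2]. Both are double or simple integrals over the levels
    of [u] of the distribution function [mu(t) = |{u > t}|]. Talenti's argument
    (isoperimetric inequality, coarea and Cauchy-Schwarz on the level sets)
    bounds [\int f(R(t)) mu(t) dt] by the same quantity for the ball, where
    [om R(t)^d = mu(t)]. With [q(t) = m(R(t)^2)], [m] being [- 2 d] times the
    derivative, with respect to the squared radius, of the torsion function of
    the ball, an identity of the radial profile turns the resulting bound into
    exactly [T(B)].

    Level sets are only used through the smooth step [theta dlt], so neither
    the coarea formula nor regularity of [u] is needed; the isoperimetric
    inequality comes from Brunn-Minkowski, itself proved in multiplicative form
    by induction on the dimension. *)
From HB Require Import structures.
From mathcomp Require Import all_boot all_order all_algebra.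
From mathcomp Require Import all_classical all_reals all_analysis.
From mathcomp Require Import measurable_realfun.
From mathcomp Require Import ring lra.
Require Import Defs.
Set Implicit Arguments.
Unset Strict Implicit.
Unset Printing Implicit Defensive.
Import Order.TTheory GRing.Theory Num.Theory.
Import numFieldNormedType.Exports.
Local Open Scope classical_set_scope.
Local Open Scope ring_scope.

(** * Lebesgue measure on R^d *)

(** The clamped problem has no maximum principle, and symmetrising an [H^2] function destroys its
    second derivatives. So [phi] is never rearranged: it is paired with functions of [u], which
    solves a second-order problem, and only the levels of [u] are compared with balls.

    The split is dictated by the ball. There, with [-Lap u = 1], the function [Q] is the torsion
    function [w] itself and [G = u - tau w]. Since [Lap w + G] is radial, regular and harmonic, it
    is constant, and as [Lap w] has mean zero, [Lap w = -(G - mean G)]. For [phi = w] every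
    Cauchy-Schwarz inequality is then an equality, so the bound can be sharp. On [Omega] the weight
    [q] is copied from the ball through the radius [R(t)].

    Near-minimisers exist without regularity of [Omega], but they have no sup bound uniform in the
    error. The levels are therefore cut at a height [T], each level costs a small error, and the
    part of the gradient carried by no level of [[0, T]] is estimated separately. All small
    quantities are finally powers of a single parameter. *)

Ltac nneg := repeat first [assumption | exact: ler01 | exact: ler0n | exact: sqr_ge0
  | by rewrite invr_ge0 ler0n | apply: addr_ge0 | apply: mulr_ge0].

Section continuous_real.
Context {R : realType} {T : topologicalType}.
Implicit Types f g : T -> R.

Lemma cont_cst (k : R) : continuous (fun _ : T => k).
Proof. by move=> x; exact: cvg_cst. Qed.

Lemma cont_add f g : continuous f -> continuous g -> continuous (fun x => f x + g x).
Proof. by move=> cf cg x; exact: cvgD (cf x) (cg x). Qed.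

Lemma cont_opp f : continuous f -> continuous (fun x => - f x).
Proof. by move=> cf x; exact: cvgN (cf x). Qed.

Lemma cont_sub f g : continuous f -> continuous g -> continuous (fun x => f x - g x).
Proof. by move=> cf cg; apply: cont_add => //; exact: cont_opp. Qed.

Lemma cont_mul f g : continuous f -> continuous g -> continuous (fun x => f x * g x).
Proof. by move=> cf cg x; exact: cvgM (cf x) (cg x). Qed.

Lemma cont_exp f n : continuous f -> continuous (fun x => f x ^+ n).
Proof.
move=> cf; elim: n => [|n IH]; first by under eq_fun do rewrite expr0; exact: cont_cst.
by under eq_fun do rewrite exprS; exact: cont_mul.
Qed.

Lemma cont_comp (g : R -> R) f : continuous g -> continuous f -> continuous (fun x => g (f x)).
Proof. by move=> cg cf x; apply: continuous_comp; [exact: cf|exact: cg]. Qed.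

Lemma cont_sum I (r : seq I) (F : I -> T -> R) :
  (forall i, continuous (F i)) -> continuous (fun x => \sum_(i <- r) F i x).
Proof. by move=> cF; apply: continuous_big => //; exact: add_continuous. Qed.

End continuous_real.

Section lebesgue_rV_theory.
Context {R : realType}.
Implicit Type d : nat.
Local Notation leb := (@lebesgue_measure R).

Lemma lebesgue_rVS d (A : set 'rV[R]_d.+1) :
  lebesgue_rV d.+1 A =
  (\int[leb]_x lebesgue_rV d [set y | A (cons_rV (x, y))])%E.
Proof.
rewrite /= /lebesgue_step /pushforward /product_measure1 /=.
apply: eq_integral => x _ /=; congr (lebesgue_rV d _).
by apply/seteqP; split => y /=; rewrite /xsection /= inE.
Qed.

Lemma measurable_slice_rV d (A : set 'rV[R]_d.+1) x : measurable A ->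
  measurable [set y : 'rV[R]_d | A (cons_rV (x, y))].
Proof.
move=> mA; rewrite -[X in measurable X]setTI.
have : measurable_fun setT (fun y : 'rV[R]_d => cons_rV (x, y)).
  apply: (measurableT_comp (measurable_cons_rV (d := d))).
  exact: measurable_fun_pair.
by move=> /(_ measurableT _ mA).
Qed.

Lemma measurable_slice_measure d (A : set 'rV[R]_d.+1) : measurable A ->
  measurable_fun setT
    (fun x : measurableTypeR R => lebesgue_rV d [set y | A (cons_rV (x, y))] : \bar R).
Proof.
move=> mA.
have mB : measurable (@cons_rV R d @^-1` A).
  by rewrite -[X in measurable X]setTI; exact: measurable_cons_rV.
have := measurable_fun_xsection (lebesgue_rV d) mB.
apply: eq_measurable_fun => x _ /=; congr (lebesgue_rV d _).
by apply/seteqP; split => y /=; rewrite /xsection /= inE.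
Qed.

Lemma measurable_affine (k c : R) :
  measurable_fun setT (fun x : measurableTypeR R => k * x + c : measurableTypeR R).
Proof. by apply: measurable_funD => //; exact: measurable_funM. Qed.

(** Uniqueness of the Lebesgue measure: [k] times the pushforward under the affine map agrees with
    it on half-open intervals. *)
Lemma lebesgue_measure_affine (k c : R) (A : set (measurableTypeR R)) :
  0 < k -> measurable A ->
  (leb ((fun x => k * x + c)%R @^-1` A) = (k^-1)%:E * leb A)%E.
Proof.
move=> k0 mA.
pose phi : measurableTypeR R -> measurableTypeR R := (fun x => k * x + c)%R.
have mphi : measurable_fun setT phi by exact: measurable_affine.
pose m1 : {measure set (measurableTypeR R) -> \bar R} :=
  measure_function_pushforward__canonical__measure_function_Measure leb mphi.
pose mu' : {measure set (measurableTypeR R) -> \bar R} :=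
  mscale (NngNum (ltW k0)) m1.
have H : leb A = mu' A.
  apply: lebesgue_measure_unique => // _ [[a b] _ <-].
  transitivity (k%:E * leb (phi @^-1` [set` `]a, b]]))%E; last by [].
  have -> : phi @^-1` [set` `]a, b]] = [set` `]((a - c) / k)%R, ((b - c) / k)%R]].
    apply/seteqP; split => x; rewrite /phi /= !in_itv/= ltr_pdivrMr// ler_pdivlMr// ltrBlDr lerBrDr mulrC //.
  rewrite !lebesgue_measure_itv/= !lte_fin ltr_pM2r ?invr_gt0// ltrD2r.
  case: ifP => // _; last by rewrite mule0.
  by rewrite -!EFinB -EFinM; congr EFin; field; rewrite gt_eqF.
rewrite H /mu' /mscale/= muleA -EFinM mulVf ?gt_eqF// mul1e.
by [].
Qed.

Lemma ge0_integral_affine (k c : R) (f : measurableTypeR R -> \bar R) :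
  0 < k -> measurable_fun setT f -> (forall x, 0 <= f x)%E ->
  (\int[leb]_x f (k * x + c)%R = (k^-1)%:E * \int[leb]_x f x)%E.
Proof.
move=> k0 mf f0.
pose phi : measurableTypeR R -> measurableTypeR R := (fun x => k * x + c)%R.
have mphi : measurable_fun setT phi by exact: measurable_affine.
have k0' : 0 <= k^-1 by rewrite invr_ge0 ltW.
transitivity (\int[pushforward leb phi]_x f x)%E.
  by rewrite ge0_integral_pushforward.
rewrite (eq_measure_integral (mscale (NngNum k0') leb)).
  by rewrite ge0_integral_mscale//=.
move=> A mA _ /=; rewrite /mscale /= /pushforward.
exact: lebesgue_measure_affine.
Qed.

Lemma row_cons_affine d (k : R) (c : 'rV[R]_d.+1) x (y : 'rV[R]_d) :
  k *: cons_rV (x, y) + c =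
  cons_rV (k * x + c 0 0, k *: y + \row_j c 0 (lift 0 j)).
Proof.
apply/rowP => i; rewrite !mxE; case: unliftP => [j|] -> /=.
  by rewrite !mxE.
by [].
Qed.

Lemma measurable_affine_rV d (k : R) (c : 'rV[R]_d) :
  measurable_fun setT (fun x : 'rV[R]_d => k *: x + c).
Proof.
apply: measurable_rVP => i; under eq_fun do rewrite !mxE.
apply: measurable_funD => //; apply: measurable_funM => //.
exact: measurable_coord.
Qed.

(** Induction on the dimension: every slice scales by [k ^- d], and the change of variable in the
    first coordinate contributes the remaining factor. *)
Lemma lebesgue_rV_affine d (k : R) (c : 'rV[R]_d) (A : set 'rV[R]_d) :
  0 < k -> measurable A ->
  (lebesgue_rV d [set x | A (k *: x + c)%R] = (k ^- d)%:E * lebesgue_rV d A)%E.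
Proof.
move=> k0; elim: d c A => [|d IH] c A mA.
  rewrite expr0 invr1 mul1e /=; congr (dirac _ _).
  by apply/seteqP; split => x /=; rewrite (_ : k *: x + c = x)//; apply/rowP => -[].
rewrite !lebesgue_rVS.
transitivity (\int[leb]_x ((k ^- d)%:E *
    (fun x => lebesgue_rV d [set y | A (cons_rV (x, y))]) (k * x + c 0 0)%R))%E.
  apply: eq_integral => x _; rewrite -(IH (\row_j c 0 (lift 0 j))); last first.
    exact: measurable_slice_rV.
  by congr (lebesgue_rV d _); apply/seteqP; split => y /=; rewrite row_cons_affine.
have mF := measurable_slice_measure mA.
rewrite ge0_integralZl//; last 2 first.
- exact: (measurableT_comp mF (measurable_affine _ _)).
- by rewrite lee_fin invr_ge0 exprn_ge0 // ltW.
rewrite (@ge0_integral_affine k (c 0 0) (fun x => lebesgue_rV d [set y | A (cons_rV (x, y))]))//.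
by rewrite muleA -EFinM exprS invfM mulrC.
Qed.

(** This makes the integral of a difference quotient vanish, the source of integration by parts.
    Positive and negative parts are translated separately, so measurability suffices. *)
Lemma integral_translate_rV d (c : 'rV[R]_d) (f : 'rV[R]_d -> \bar R) :
  measurable_fun setT f ->
  (\int[lebesgue_rV d]_x f (x + c)%R = \int[lebesgue_rV d]_x f x)%E.
Proof.
move=> mf; pose phi (x : 'rV[R]_d) := (1 *: x + c)%R.
have mphi : measurable_fun setT phi by exact: measurable_affine_rV.
have H (g : 'rV[R]_d -> \bar R) : measurable_fun setT g -> (forall x, 0 <= g x)%E ->
   (\int[lebesgue_rV d]_x g (x + c)%R = \int[lebesgue_rV d]_x g x)%E.
  move=> mg g0; transitivity (\int[lebesgue_rV d]_x (g \o phi) x)%E.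
    by apply: eq_integral => x _; rewrite /phi /= scale1r.
  rewrite -(ge0_integral_pushforward mphi (lebesgue_rV d) measurableT)//.
  apply: eq_measure_integral => A mA _.
  have := lebesgue_rV_affine c (@ltr01 R) mA.
  by rewrite expr1n invr1 mul1e => H'; exact: H'.
rewrite integralE [RHS]integralE; congr (_ - _)%E.
  rewrite -(H (f^\+)%E (measurable_funepos mf) (funepos_ge0 f)).
  by apply: eq_integral => x _; rewrite !funeposE.
rewrite -(H (f^\-)%E (measurable_funeneg mf) (funeneg_ge0 f)).
by apply: eq_integral => x _; rewrite !funenegE.
Qed.

(** The sigma-algebra is generated by the coordinates, so an open set has to be written as a
    countable union of cubes, with rational centres and half-sides [n.+1%:R^-1]. *)
Lemma open_measurable_rV d (A : set 'rV[R]_d) : open A -> measurable A.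
Proof.
move=> oA.
pose B (q : 'rV[rat]_d) (n : nat) : set 'rV[R]_d :=
  [set x | forall i, `|x 0 i - ratr (q 0 i)| < n.+1%:R^-1].
have mB q n : measurable (B q n).
  have -> : B q n = \bigcap_(i in [set: 'I_d])
      ((fun x : 'rV[R]_d => x 0 i : measurableTypeR R) @^-1` ball (ratr (q 0 i) : R) n.+1%:R^-1).
    apply/seteqP; split => x /= H.
      by move=> i _ /=; rewrite /ball /= distrC; exact: H.
    by move=> i; have := H i I; rewrite /= /ball /= distrC.
  apply: fin_bigcap_measurable => // i _; rewrite -[X in measurable X]setTI.
  by apply: measurable_coord => //; exact: measurable_ball.
have -> : A = \bigcup_(p in [set p : 'rV[rat]_d * nat | B p.1 p.2 `<=` A]) B p.1 p.2.
  apply/seteqP; split => [x Ax|x [p /= pA]]; last exact: pA.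
  have /nbhs_ballP[e /= e0 eA] : nbhs x A by apply: open_nbhs_nbhs; split.
  have [n ne] : exists n : nat, n.+1%:R^-1 < e / 2.
    have e20 : 0 < e / 2 by rewrite divr_gt0.
    have := near_infty_natSinv_lt (PosNum e20) => -[N _ HN].
    by exists N; exact: (HN N (leqnn N)).
  have Hq i : exists q : rat, `|x 0 i - ratr q| < n.+1%:R^-1.
    have /(@rat_in_itvoo R) [q] : x 0 i - n.+1%:R^-1 < x 0 i + n.+1%:R^-1.
      by rewrite ltrBlDr -addrA ltrDl addr_gt0// invr_gt0.
    rewrite in_itv/= => /andP[q1 q2]; exists q.
    by rewrite ltr_distlC q1 q2.
  have [q Pq] := choice Hq.
  exists (\row_i q i, n) => /=; last by move=> i; rewrite mxE.
  move=> y Hy; apply: eA; split => // i j; rewrite ord1.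
  rewrite /ball /=; have := Hy j; have := Pq j; rewrite mxE.
  move: (n.+1%:R^-1) (ratr (q j)) ne => u v ne; rewrite !ltr_norml => /andP[a1 a2] /andP[b1 b2]; apply/andP; split; lra.
rewrite bigcup_mkcond; apply: countable_bigcupT_measurable.
  exact: countableP.
by move=> p; case: ifP => // _; exact: mB.
Qed.

Lemma continuous_measurable_rV d (f : 'rV[R]_d -> R) :
  continuous f -> measurable_fun setT (f : 'rV[R]_d -> measurableTypeR R).
Proof.
move=> cf; apply: (measurability _ (RGenOpens.measurableE R)).
move=> _ [_ [a [b ->] <-]]; rewrite setTI.
by apply: open_measurable_rV; move/continuousP : cf; apply; exact: interval_open.
Qed.

Lemma lebesgue_rV_box d (a : R) : 0 <= a ->
  lebesgue_rV d [set x : 'rV[R]_d | forall i, `|x 0 i| <= a] = ((2 * a) ^+ d)%:E.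
Proof.
move=> a0; elim: d => [|d IH].
  by rewrite /= diracE mem_set//= => -[].
rewrite lebesgue_rVS.
transitivity (\int[leb]_(x in [set` `[(- a)%R, a]]) ((2 * a) ^+ d)%:E)%E.
  rewrite [RHS]integral_mkcond; apply: eq_integral => x _; rewrite patchE.
  case: ifPn => [|] /=.
    rewrite inE/= in_itv/= => xa; rewrite -IH; congr (lebesgue_rV d _).
    apply/seteqP; split => y /= H i.
      by have := H (lift 0 i); rewrite cons_rVS.
    case: (unliftP 0 i) => [j|] ->; first by rewrite cons_rVS; exact: H.
    by rewrite cons_rV0 /= ler_norml.
  rewrite notin_setE/= in_itv/= => xa; rewrite (_ : [set _ | _] = set0) ?measure0//.
  apply/seteqP; split => // y /= /(_ 0); rewrite cons_rV0 /= ler_norml.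
  exact: xa.
rewrite integral_cst//= lebesgue_measure_itv/= lte_fin.
case: ifPn => [_|]; first by rewrite -EFinB -EFinM exprSr; congr EFin; ring.
rewrite -leNgt => aN; have -> : a = 0 by apply/eqP; lra.
by rewrite mule0 mulr0 exprS mul0r.
Qed.

Lemma measurable_box d (a : R) :
  measurable [set x : 'rV[R]_d | forall i, `|x 0 i| <= a].
Proof.
have -> : [set x : 'rV[R]_d | forall i, `|x 0 i| <= a] = \bigcap_(i in [set: 'I_d])
      ((fun x : 'rV[R]_d => x 0 i : measurableTypeR R) @^-1` `[- a, a]).
  apply/seteqP; split => x /= H.
    by move=> i _ /=; rewrite in_itv/= -ler_norml; exact: H.
  by move=> i; have := H i I; rewrite /= in_itv/= -ler_norml.
apply: fin_bigcap_measurable => // i _; rewrite -[X in measurable X]setTI.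
by apply: measurable_coord => //; exact: measurable_itv.
Qed.

Lemma bounded_lebesgue_rV d (A : set 'rV[R]_d) (a : R) : measurable A ->
  (forall x, A x -> forall i, `|x 0 i| <= a) -> (lebesgue_rV d A < +oo)%E.
Proof.
move=> mA Aa.
have a0 : 0 <= Num.max 0 a by rewrite le_max lexx.
apply: (@le_lt_trans _ _ (lebesgue_rV d [set x : 'rV[R]_d | forall i, `|x 0 i| <= Num.max 0 a])).
  apply: le_measure => //; rewrite ?inE//; first exact: measurable_box.
  by move=> x Ax /= i; rewrite le_max (Aa x Ax) orbT.
by rewrite lebesgue_rV_box// ltry.
Qed.

Definition unit_ball_volume d : R :=
  fine (lebesgue_rV d (euclidean_ball (0 : 'rV[R]_d) 1)).

Lemma continuous_coord d (i : 'I_d) : continuous (fun x : 'rV[R]_d => x 0 i).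
Proof. exact: coord_continuous. Qed.

Lemma continuous_sqdist d (c : 'rV[R]_d) :
  continuous (fun x : 'rV[R]_d => \sum_i (x 0 i - c 0 i) ^+ 2).
Proof.
apply: cont_sum => i; apply: cont_exp; apply: cont_sub; last exact: cont_cst.
exact: continuous_coord.
Qed.

(** Squaring alone would lose the sign of [rho]; the conjunct [0 < rho] keeps balls of nonpositive
    radius empty. *)
Lemma euclidean_ballE d (c : 'rV[R]_d) rho :
  euclidean_ball c rho =
  [set x : 'rV[R]_d | 0 < rho /\ \sum_i (x 0 i - c 0 i) ^+ 2 < rho ^+ 2].
Proof.
have S0 (x : 'rV[R]_d) : 0 <= \sum_i (x 0 i - c 0 i) ^+ 2.
  by apply: sumr_ge0 => i _; exact: sqr_ge0.
rewrite /euclidean_ball; apply/seteqP; split => x /=.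
  move=> H; have r0 : 0 < rho by apply: le_lt_trans H; exact: sqrtr_ge0.
  split => //; move: H; rewrite -(ltr_pXn2r (n := 2)) ?nnegrE ?sqrtr_ge0 ?ltW//.
  by rewrite sqr_sqrtr.
move=> [r0]; rewrite -[X in X < _](sqr_sqrtr (S0 x)).
by rewrite ltr_pXn2r// ?nnegrE ?sqrtr_ge0 ?ltW.
Qed.

Lemma open_euclidean_ball d (c : 'rV[R]_d) rho : open (euclidean_ball c rho).
Proof.
rewrite euclidean_ballE.
have [r0|r0] := pselect (0 < rho); last first.
  by rewrite (_ : [set _ | _] = set0); [exact: open0|apply/seteqP; split => // x []].
have -> : [set x : 'rV[R]_d | 0 < rho /\ \sum_i (x 0 i - c 0 i) ^+ 2 < rho ^+ 2] =
  (fun x : 'rV[R]_d => \sum_i (x 0 i - c 0 i) ^+ 2) @^-1` [set y | y < rho ^+ 2].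
  by apply/seteqP; split => [x []|x] //=.
have /continuousP := @continuous_sqdist d c; apply; exact: open_lt.
Qed.

Lemma measurable_euclidean_ball d (c : 'rV[R]_d) rho :
  measurable (euclidean_ball c rho).
Proof. by apply: open_measurable_rV; exact: open_euclidean_ball. Qed.

Lemma euclidean_ball_bounded d (c : 'rV[R]_d) rho x : euclidean_ball c rho x ->
  forall i, `|x 0 i - c 0 i| <= rho.
Proof.
rewrite euclidean_ballE => -[r0 H] i.
rewrite -(ler_pXn2r (n := 2)) ?nnegrE ?(ltW r0)// real_normK ?num_real//.
apply: le_trans (ltW H); rewrite (bigD1 i)//= lerDl.
by apply: sumr_ge0 => j _; exact: sqr_ge0.
Qed.

Lemma lebesgue_euclidean_ball_lty d (c : 'rV[R]_d) rho :
  (lebesgue_rV d (euclidean_ball c rho) < +oo)%E.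
Proof.
apply: (@bounded_lebesgue_rV _ _ (rho + \sum_i `|c 0 i|)).
  exact: measurable_euclidean_ball.
move=> x /euclidean_ball_bounded Hx i.
rewrite -[x 0 i](subrK (c 0 i)) (le_trans (ler_normD _ _))// lerD//.
by rewrite (bigD1 i)//= lerDl sumr_ge0.
Qed.

Lemma unit_ball_volume_gt0 d : 0 < unit_ball_volume d.
Proof.
rewrite /unit_ball_volume -lte_fin fineK; last first.
  by rewrite ge0_fin_numE// lebesgue_euclidean_ball_lty.
(* The cube of half-side [a] lies in the unit ball: a sum of [d] squares is at most [d * a < 1],
   also for [d = 0]. *)
set a : R := d.+1%:R^-1.
have a0 : 0 < a by rewrite invr_gt0.
apply: (@lt_le_trans _ _ (lebesgue_rV d [set x : 'rV[R]_d | forall i, `|x 0 i| <= a])).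
  by rewrite lebesgue_rV_box ?ltW// lte_fin exprn_gt0// mulr_gt0.
apply: le_measure; rewrite ?inE; [exact: measurable_box|exact: measurable_euclidean_ball|].
move=> x /= Hx; rewrite euclidean_ballE /=; split => //; rewrite expr1n.
apply: (@le_lt_trans _ _ (\sum_(i < d) a)).
  apply: ler_sum => i _; rewrite mxE subr0 -real_normK ?num_real//.
  have a1 : a <= 1 by rewrite invf_le1 ?ler1n.
  rewrite expr2 (le_trans _ (_ : a * 1 <= _)) ?mulr1//.
  by rewrite -[leRHS]mulr1 ler_pM// (le_trans (Hx i)).
by rewrite sumr_const card_ord -[X in X < _]mulr_natr mulrC ltr_pdivrMr ?mul1r ?ltr_nat.
Qed.

Lemma lebesgue_euclidean_ball d (c : 'rV[R]_d) rho : 0 <= rho -> (0 < d)%N ->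
  lebesgue_rV d (euclidean_ball c rho) = (unit_ball_volume d * rho ^+ d)%:E.
Proof.
rewrite le_eqVlt => /predU1P[<-|r0] d0.
  rewrite expr0n gtn_eqF// mulr0 euclidean_ballE (_ : [set _ | _] = set0) ?measure0//.
  by apply/seteqP; split => // x []; rewrite ltxx.
have H := lebesgue_rV_affine c r0 (measurable_euclidean_ball c rho).
have -> : (unit_ball_volume d * rho ^+ d)%:E =
   ((rho ^+ d)%:E * lebesgue_rV d (euclidean_ball (0 : 'rV[R]_d) 1))%E.
  rewrite mulrC EFinM /unit_ball_volume fineK//.
  by rewrite ge0_fin_numE// lebesgue_euclidean_ball_lty.
have -> : euclidean_ball (0 : 'rV[R]_d) 1 = [set x | euclidean_ball c rho (rho *: x + c)].
  rewrite !euclidean_ballE; apply/seteqP; split => x /= [_ Hx]; split => //.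
    under eq_bigr do rewrite !mxE addrK exprMn.
    rewrite -mulr_sumr gtr_pMr ?exprn_gt0//; move: Hx; rewrite expr1n.
    by under eq_bigr do rewrite mxE subr0.
  move: Hx; under eq_bigr do rewrite !mxE addrK exprMn.
  rewrite -mulr_sumr gtr_pMr ?exprn_gt0// expr1n => Hx.
  by under eq_bigr do rewrite mxE subr0.
by rewrite H muleA -EFinM mulfV ?mul1e// expf_neq0// gt_eqF.
Qed.

End lebesgue_rV_theory.

(** * Bounded measurable functions *)

Section bounded_measurable.
Context d (T : measurableType d) (R : realType).
Implicit Types f g : T -> R.

(** Bounded everywhere, not only on the domain: the class is an algebra stable under composition
    with continuous functions, and its members are integrable on every set of finite measure, which
    settles integrability syntactically. *)
Definition bm f := measurable_fun setT f /\ exists M : R, forall x, `|f x| <= M.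

Lemma bm_meas f : bm f -> measurable_fun setT f. Proof. by case. Qed.

Lemma bm_bound f : bm f -> exists2 M : R, 0 <= M & forall x, `|f x| <= M.
Proof.
move=> [_ [M HM]]; exists (Num.max 0 M); first by rewrite le_max lexx.
by move=> x; rewrite le_max HM orbT.
Qed.

Lemma bm_cst k : bm (fun=> k).
Proof. by split; [exact: measurable_cst|exists `|k|]. Qed.

Lemma bm_add f g : bm f -> bm g -> bm (fun x => f x + g x).
Proof.
move=> [mf [M HM]] [mg [N HN]]; split; first exact: measurable_funD.
by exists (M + N) => x; rewrite (le_trans (ler_normD _ _))// lerD.
Qed.

Lemma bm_opp f : bm f -> bm (fun x => - f x).
Proof.
move=> [mf [M HM]]; split; first exact: (measurableT_comp (@oppr_measurable R setT)).
by exists M => x; rewrite normrN.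
Qed.

Lemma bm_sub f g : bm f -> bm g -> bm (fun x => f x - g x).
Proof. by move=> bf bg; apply: bm_add => //; exact: bm_opp. Qed.

Lemma bm_mul f g : bm f -> bm g -> bm (fun x => f x * g x).
Proof.
move=> [mf [M HM]] [mg [N HN]]; split; first exact: measurable_funM.
by exists (M * N) => x; rewrite normrM ler_pM.
Qed.

Lemma bm_scale k f : bm f -> bm (fun x => k * f x).
Proof. by move=> bf; apply: bm_mul => //; exact: bm_cst. Qed.

Lemma bm_exp f n : bm f -> bm (fun x => f x ^+ n).
Proof.
move=> bf; elim: n => [|n IH]; first by under eq_fun do rewrite expr0; exact: bm_cst.
by under eq_fun do rewrite exprS; exact: bm_mul.
Qed.

Lemma bm_sum I (r : seq I) (F : I -> T -> R) :
  (forall i, bm (F i)) -> bm (fun x => \sum_(i <- r) F i x).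
Proof.
move=> bF; elim: r => [|i r IH].
  by under eq_fun do rewrite big_nil; exact: bm_cst.
by under eq_fun do rewrite big_cons; exact: bm_add.
Qed.

Lemma bm_comp (g : R -> R) f : continuous g -> bm f -> bm (fun x => g (f x)).
Proof.
move=> cg bf; have [M M0 HM] := bm_bound bf; case: (bf) => mf _; split.
  by apply: (measurableT_comp _ mf); exact: continuous_measurable_fun.
have /compact_bounded[N [_ HN]] : compact (g @` `[- M, M]).
  by apply: continuous_compact; [exact: continuous_subspaceT|exact: segment_compact].
exists (`|N| + 1) => x; apply: HN; first by rewrite ltr_pwDr// ler_norm.
by exists (f x) => //=; rewrite in_itv/= -ler_norml.
Qed.

Lemma eq_bm f g : f =1 g -> bm f -> bm g.
Proof. by move=> /funext ->. Qed.

Lemma bm_norm f : bm f -> bm (fun x => `|f x|).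
Proof. by apply: bm_comp => x; exact: norm_continuous. Qed.

End bounded_measurable.

Ltac bm_tac := repeat first [assumption | exact: bm_cst | apply: bm_exp | apply: bm_sub
  | apply: bm_add | apply: bm_opp | apply: bm_mul | apply: bm_norm | apply: bm_sum => ?].

Section bounded_measurable_integral.
Context d (T : measurableType d) (R : realType).
Implicit Types f g : T -> R.

Section finite_domain.
Context (mu : {measure set T -> \bar R}) (D : set T).
Hypotheses (mD : measurable D) (fD : (mu D < +oo)%E).

Lemma bm_integrable f : bm f -> mu.-integrable D (EFin \o f).
Proof.
move=> bf; have [M M0 HM] := bm_bound bf.
apply: measurable_bounded_integrable => //.
  by apply: (@measurable_funS _ _ _ _ setT) => //; exact: bm_meas.
exists M; split; first exact: num_real.
by move=> y My x _ /=; apply: le_trans (HM x) (ltW My).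
Qed.

Lemma Int_add f g : bm f -> bm g ->
  \int[mu]_(x in D) (f x + g x) = \int[mu]_(x in D) f x + \int[mu]_(x in D) g x.
Proof. by move=> bf bg; rewrite RintegralD//; exact: bm_integrable. Qed.

Lemma Int_sub f g : bm f -> bm g ->
  \int[mu]_(x in D) (f x - g x) = \int[mu]_(x in D) f x - \int[mu]_(x in D) g x.
Proof. by move=> bf bg; rewrite RintegralB//; exact: bm_integrable. Qed.

Lemma Int_scale k f : bm f ->
  \int[mu]_(x in D) (k * f x) = k * \int[mu]_(x in D) f x.
Proof. by move=> bf; rewrite RintegralZl//; exact: bm_integrable. Qed.

Lemma Int_sum I (r : seq I) (F : I -> T -> R) : (forall i, bm (F i)) ->
  \int[mu]_(x in D) (\sum_(i <- r) F i x) = \sum_(i <- r) \int[mu]_(x in D) F i x.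
Proof.
move=> bF; elim: r => [|i r IH].
  under eq_Rintegral do rewrite big_nil.
  by rewrite big_nil Rintegral_cst// mul0r.
under eq_Rintegral do rewrite big_cons.
by rewrite big_cons -IH Int_add//; exact: bm_sum.
Qed.

Lemma le_Int f g : bm f -> bm g -> (forall x, D x -> f x <= g x) ->
  \int[mu]_(x in D) f x <= \int[mu]_(x in D) g x.
Proof. by move=> bf bg; apply: le_Rintegral => //; exact: bm_integrable. Qed.

Lemma Int_bound M f : bm f -> (forall x, D x -> `|f x| <= M) ->
  `|\int[mu]_(x in D) f x| <= M * fine (mu D).
Proof.
move=> bf HM; apply: (le_trans (le_normr_Rintegral mD (bm_integrable bf))).
rewrite -Rintegral_cst//; apply: le_Int => //; [exact: bm_norm|exact: bm_cst].
Qed.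

End finite_domain.

(** Used to trade a domain of finite measure for a box around the support, or a level interval for a
    shorter one. *)
Lemma eq_Int_support (mu : {measure set T -> \bar R}) (A B : set T) f :
  (forall x, ~ (A x /\ B x) -> f x = 0) ->
  \int[mu]_(x in A) f x = \int[mu]_(x in B) f x.
Proof.
move=> f0; rewrite Rintegral_mkcond [RHS]Rintegral_mkcond.
apply: eq_Rintegral => x _; rewrite !patchE.
case: ifPn; rewrite ?inE ?notin_setE => xA; case: ifPn; rewrite ?inE ?notin_setE => xB //.
  by apply: f0 => -[].
by apply/esym; apply: f0 => -[].
Qed.

End bounded_measurable_integral.

Section fubini_finite.
Context d1 d2 (T1 : measurableType d1) (T2 : measurableType d2) (R : realType).
Context (m1 : {sigma_finite_measure set T1 -> \bar R}).
Context (m2 : {sigma_finite_measure set T2 -> \bar R}).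
Context (A : set T1) (B : set T2).
Hypotheses (mA : measurable A) (mB : measurable B).
Hypotheses (fA : (m1 A < +oo)%E) (fB : (m2 B < +oo)%E).

Lemma bm_fubini (f : T1 * T2 -> R) : bm f ->
  \int[m1]_(x in A) (\int[m2]_(y in B) f (x, y)) =
  \int[m2]_(y in B) (\int[m1]_(x in A) f (x, y)).
Proof.
move=> bf; have [M M0 HM] := bm_bound bf.
pose g (z : T1 * T2) : R := \1_(A `*` B) z * f z.
have mAB : measurable (A `*` B) by exact: measurableX.
have mg : measurable_fun setT g.
  by apply: measurable_funM; [exact: measurable_indic|exact: bm_meas].
have ig : (m1 \x m2)%E.-integrable setT (EFin \o g).
  apply: (@le_integrable _ _ _ _ _ measurableT _ (fun z => (M * \1_(A `*` B) z)%:E)).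
  - exact/measurable_EFinP.
  - move=> z _ /=; rewrite lee_fin normrM [leRHS]ger0_norm ?mulr_ge0//.
    by rewrite mulrC (ger0_norm (_ : 0 <= \1_(A `*` B) z))// ler_wpM2r.
  - under eq_fun do rewrite EFinM.
    apply: integrableZl => //; apply/integrableP; split.
      by apply/measurable_EFinP; exact: measurable_indic.
    under eq_integral do rewrite gee0_abs ?lee_fin//.
    rewrite integral_indic// setIT; have E := product_measure1E m1 m2 mA mB.
    apply: (@le_lt_trans _ _ (m1 A * m2 B)%E); first by rewrite -E.
    rewrite lte_mul_pinfty//.
    by rewrite ge0_fin_numE.
have := @Fubini _ _ _ _ _ m1 m2 (EFin \o g) ig.
have fx x : A x -> \int[m2]_(y in B) f (x, y) = fine (\int[m2]_y (g (x, y))%:E)%E.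
  move=> Ax; rewrite /Rintegral integral_mkcond; congr fine.
  apply: eq_integral => y _; rewrite patchE /g indicE.
  case: ifPn => [|]; rewrite ?inE ?notin_setE => By.
    by rewrite mem_set ?mul1r.
  by rewrite memNset ?mul0r//=; move=> [].
have fy y : B y -> \int[m1]_(x in A) f (x, y) = fine (\int[m1]_x (g (x, y))%:E)%E.
  move=> By; rewrite /Rintegral integral_mkcond; congr fine.
  apply: eq_integral => x _; rewrite patchE /g indicE.
  case: ifPn => [|]; rewrite ?inE ?notin_setE => Ax.
    by rewrite mem_set ?mul1r.
  by rewrite memNset ?mul0r//=; move=> [].
have gx x : (\int[m2]_y (g (x, y))%:E)%E = (((fun x => \int[m2]_(y in B) f (x, y)) \_ A) x)%:E.
  rewrite patchE; case: ifPn; rewrite ?inE ?notin_setE => Ax.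
    rewrite fx// fineK//.
    have bgx : bm (fun y => f (x, y)).
      split; last by exists M => y; exact: HM.
      by apply: (measurableT_comp (bm_meas bf)); exact: measurable_fun_pair.
    have -> : (\int[m2]_y (g (x, y))%:E)%E = (\int[m2]_(y in B) (f (x, y))%:E)%E.
      rewrite [RHS]integral_mkcond; apply: eq_integral => y _; rewrite patchE /g indicE.
      case: ifPn => [|]; rewrite ?inE ?notin_setE => By.
        by rewrite mem_set ?mul1r.
      by rewrite memNset ?mul0r//=; move=> [].
    by apply: integrable_fin_num => //; exact: (bm_integrable mB fB bgx).
  by apply: integral0_eq => y _; rewrite /g indicE memNset ?mul0r//; move=> [].
have gy y : (\int[m1]_x (g (x, y))%:E)%E = (((fun y => \int[m1]_(x in A) f (x, y)) \_ B) y)%:E.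
  rewrite patchE; case: ifPn; rewrite ?inE ?notin_setE => By.
    rewrite fy// fineK//.
    have bgy : bm (fun x => f (x, y)).
      split; last by exists M => x; exact: HM.
      by apply: (measurableT_comp (bm_meas bf)); exact: measurable_fun_pair.
    have -> : (\int[m1]_x (g (x, y))%:E)%E = (\int[m1]_(x in A) (f (x, y))%:E)%E.
      rewrite [RHS]integral_mkcond; apply: eq_integral => x _; rewrite patchE /g indicE.
      case: ifPn => [|]; rewrite ?inE ?notin_setE => Ax.
        by rewrite mem_set ?mul1r.
      by rewrite memNset ?mul0r//=; move=> [].
    by apply: integrable_fin_num => //; exact: (bm_integrable mA fA bgy).
  by apply: integral0_eq => x _; rewrite /g indicE memNset ?mul0r//; move=> [].
move=> H; rewrite Rintegral_mkcond [RHS]Rintegral_mkcond /Rintegral; congr fine.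
under eq_integral do rewrite -gx.
by under [RHS]eq_integral do rewrite -gy.
Qed.

Lemma bm_int_param (f : T1 * T2 -> R) : bm f ->
  bm (fun y => \int[m1]_(x in A) f (x, y)).
Proof.
move=> bf; have [M M0 HM] := bm_bound bf.
pose g (z : T1 * T2) : R := \1_A z.1 * f z.
have mg : measurable_fun setT g.
  apply: measurable_funM; last exact: bm_meas.
  by apply: (measurableT_comp _ measurable_fst); exact: measurable_indic.
have bfy y : bm (fun x => f (x, y)).
  split; last by exists M => x; exact: HM.
  by apply: (measurableT_comp (bm_meas bf)); exact: measurable_fun_pair.
split; last by exists (M * fine (m1 A)) => y; apply: Int_bound.
(* Measurability of a partial integral is a Tonelli statement about nonnegative integrands, so the
   two parts are treated separately. *)
have H y : \int[m1]_(x in A) f (x, y) =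
  fine ((\int[m1]_x ((fun z => (g z)%:E) ^\+ (x, y)) - \int[m1]_x ((fun z => (g z)%:E)^\- (x, y))))%E.
  rewrite /Rintegral integral_mkcond; congr fine.
  rewrite integralE; congr (_ - _)%E; apply: eq_integral => x _.
    rewrite !funeposE patchE /g indicE /=.
    by case: ifPn => _; rewrite ?mul1r ?mul0r.
  rewrite !funenegE patchE /g indicE /=.
  by case: ifPn => _; rewrite ?mul1r ?mul0r.
under eq_fun do rewrite H.
apply: (measurableT_comp (@fine_measurable R setT measurableT)).
have mge : measurable_fun setT (fun z => (g z)%:E) by exact/measurable_EFinP.
apply: emeasurable_funB.
  apply: (measurable_fun_fubini_tonelli_G (fun z => ((fun z => (g z)%:E) ^\+ z)%E)).
    exact: measurable_funepos.
  by move=> z; exact: funepos_ge0.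
apply: (measurable_fun_fubini_tonelli_G (fun z => ((fun z => (g z)%:E) ^\- z)%E)).
  exact: measurable_funeneg.
by move=> z; exact: funeneg_ge0.
Qed.

End fubini_finite.

(** * Differential calculus for compactly supported functions *)

Section calculus_rV.
Context {R : realType} (d : nat).
Local Notation E := 'rV[R]_d.
Implicit Types (u v : E -> R) (x y : E) (Om K : set E).

Lemma is_derive_line u x y (s : R) : (forall z, differentiable u z) ->
  is_derive s (1 : R) (fun s : R => u (x + s *: y)) ('d u (x + s *: y) y).
Proof.
move=> du.
have dv : derivable u (x + s *: y) y by exact: diff_derivable.
have -> : 'd u (x + s *: y) y = 'D_y u (x + s *: y) by rewrite deriveE.
have E0 : (fun h : R => h^-1 *: (((fun s0 : R => u (x + s0 *: y)) \o shift s) (h *: 1) - u (x + s *: y)))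
        = (fun h : R => h^-1 *: ((u \o shift (x + s *: y)) (h *: y) - u (x + s *: y))).
  apply/funext => h /=; congr (_ *: (u _ - _)).
  by rewrite [h *: 1]mulr1 scalerDl addrCA addrC -addrA addrC -addrA.
apply: DeriveDef; first by rewrite /derivable E0.
by rewrite /derive E0.
Qed.

Definition has_deriv (h h' : R -> R) := forall s : R, is_derive s (1 : R) h (h' s).

Lemma row_sum_delta (y : E) : y = \sum_i y 0 i *: delta_mx 0 i.
Proof. exact: row_sum_delta. Qed.

Lemma diff_partial u x (y : E) : differentiable u x ->
  'd u x y = \sum_i y 0 i * partial i u x.
Proof.
move=> du; rewrite {1}(row_sum_delta y) linear_sum; apply: eq_bigr => i _.
by rewrite linearZ /partial deriveE.
Qed.

Lemma MVT_rV u x y : (forall z, differentiable u z) ->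
  exists2 s : R, 0 < s < 1 &
    u (x + y) - u x = \sum_i y 0 i * partial i u (x + s *: y).
Proof.
move=> du; pose g (s : R) := u (x + s *: y).
have dg (s : R) : is_derive s (1 : R) g ('d u (x + s *: y) y) by exact: is_derive_line.
have [|s s01 E] := @MVT _ g (fun s => 'd u (x + s *: y) y) 0 1 ltr01 (fun s _ => dg s).
  apply: continuous_subspaceT => s; apply: differentiable_continuous.
  by apply/derivable1_diffP; exact: ex_derive.
exists s; first by move: s01; rewrite in_itv.
by move: E; rewrite /g scale1r scale0r addr0 subr0 mulr1 diff_partial.
Qed.

Lemma partial_cst i (k : R) x : partial i (fun=> k : R) x = 0.
Proof. by rewrite /partial derive_cst. Qed.

Lemma partial_add i u v x : differentiable u x -> differentiable v x ->
  partial i (fun z => u z + v z) x = partial i u x + partial i v x.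
Proof. by move=> du dv; rewrite /partial -deriveD//; exact: diff_derivable. Qed.

Lemma partial_scale i (k : R) u x : differentiable u x ->
  partial i (fun z => k * u z) x = k * partial i u x.
Proof. by move=> du; rewrite /partial -[RHS]deriveZ//; exact: diff_derivable. Qed.

Lemma partial_mul i u v x : differentiable u x -> differentiable v x ->
  partial i (fun z => u z * v z) x = u x * partial i v x + v x * partial i u x.
Proof. by move=> du dv; rewrite /partial -[RHS]deriveM//; exact: diff_derivable. Qed.

Lemma differentiable_add u v x : differentiable u x -> differentiable v x ->
  differentiable (fun z => u z + v z) x.
Proof. exact: differentiableD. Qed.

Lemma differentiable_mul u v x : differentiable u x -> differentiable v x ->
  differentiable (fun z => u z * v z) x.
Proof. exact: differentiableM. Qed.

Lemma differentiable_const (k : R) x : differentiable (fun _ : E => k : R) x.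
Proof. exact: differentiable_cst. Qed.

Lemma differentiable_scale (k : R) u x : differentiable u x ->
  differentiable (fun z => k * u z) x.
Proof. exact: differentiableZ. Qed.

Lemma differentiable_comp1 (h : R -> R) u x : differentiable u x ->
  derivable h (u x) 1 -> differentiable (fun z => h (u z)) x.
Proof. by move=> du /derivable1_diffP dh; exact: differentiable_comp. Qed.

Lemma partial_comp i (h : R -> R) u x : differentiable u x ->
  derivable h (u x) 1 -> partial i (fun z => h (u z)) x = derive1 h (u x) * partial i u x.
Proof.
move=> du dh; have dh' : differentiable h (u x) by apply/derivable1_diffP.
rewrite /partial deriveE; last exact: differentiable_comp.
rewrite (@diff_comp _ _ _ _ u h x)//= deriv1E//= deriveE//.
by rewrite /GRing.scale/= mulrC.
Qed.

Lemma differentiable_cont u : (forall x, differentiable u x) -> continuous u.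
Proof. by move=> du x; exact: differentiable_continuous. Qed.

Lemma near0_partial i u x : (\forall z \near x, u z = 0) -> partial i u x = 0.
Proof.
move=> u0; rewrite /partial (near_eq_derive (g := cst 0)) ?derive_cst//.
Qed.

(** The support is recorded as some compact set outside which [u] vanishes, rather than as a
    closure: sums, products and derivatives then inherit it at once. *)
Definition C1c Om u := [/\ forall x, differentiable u x,
  forall i, continuous (partial i u) &
  exists2 K, compact K & K `<=` Om /\ forall x, ~ K x -> u x = 0].

Lemma compact_rV_closed K : compact K -> closed K.
Proof. by apply: compact_closed; exact: norm_hausdorff. Qed.

Lemma partial_supp i u K : compact K -> (forall x, ~ K x -> u x = 0) ->
  forall x, ~ K x -> partial i u x = 0.
Proof.
move=> cK u0 x Kx; apply: near0_partial.
have oK : open (~` K) by rewrite openC; exact: compact_rV_closed.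
have : nbhs x (~` K) by apply: open_nbhs_nbhs; split.
by apply: filterS => z; exact: u0.
Qed.

Lemma cont_supp_bm u K : compact K -> continuous u ->
  (forall x, ~ K x -> u x = 0) -> bm u.
Proof.
move=> cK cu u0; split; first exact: continuous_measurable_rV.
have /compact_bounded[N [_ HN]] : compact (u @` K).
  by apply: continuous_compact => //; exact: continuous_subspaceT.
exists (`|N| + 1) => x; have [Kx|Kx] := pselect (K x); last by rewrite u0// normr0.
by apply: HN; [rewrite ltr_pwDr// ler_norm|exists x].
Qed.

Lemma compact_rV_bounded K : compact K ->
  exists2 M : R, 0 <= M & forall x, K x -> forall i, `|x 0 i| <= M.
Proof.
move=> /compact_bounded[N [_ HN]]; exists (`|N| + 1) => // x Kx i.
have : `|x| <= `|N| + 1 by apply: HN => //; rewrite ltr_pwDr// ler_norm.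
apply: le_trans; rewrite [leRHS]/Num.Def.normr /= mx_normrE; apply/bigmax_geP; right => /=.
by exists (0, i).
Qed.

Lemma C1c_diff Om u : C1c Om u -> forall x, differentiable u x.
Proof. by case. Qed.

Lemma C1c_cont Om u : C1c Om u -> continuous u.
Proof. by move=> [du _ _]; exact: differentiable_cont. Qed.

Lemma C1c_bm Om u : C1c Om u -> bm u.
Proof.
by move=> Cu; have := C1c_cont Cu; case: Cu => _ _ [K cK [_ u0]] ?; exact: cont_supp_bm u0.
Qed.

Lemma C1c_partial_bm Om u i : C1c Om u -> bm (partial i u).
Proof.
by case=> du cu [K cK [_ u0]]; apply: (cont_supp_bm cK) => //; exact: partial_supp.
Qed.

Lemma C1c_out Om u x : C1c Om u -> ~ Om x -> u x = 0.
Proof. by case=> _ _ [K cK [KO u0]] Ox; apply: u0 => /KO. Qed.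

Lemma C1c_partial_out Om u i x : C1c Om u -> ~ Om x -> partial i u x = 0.
Proof. by case=> _ _ [K cK [KO u0]] Ox; apply: (partial_supp _ cK u0) => /KO. Qed.

Lemma C1c0 Om : C1c Om (fun=> 0).
Proof.
split=> [x|i|]; first exact: differentiable_const.
  by rewrite (_ : partial i _ = fun=> 0); [exact: cont_cst|apply/funext => x; exact: partial_cst].
by exists set0; [exact: compact0|split].
Qed.

Lemma C1c_add Om u v : C1c Om u -> C1c Om v -> C1c Om (fun x => u x + v x).
Proof.
move=> [du cu [K cK [KO u0]]] [dv cv [L cL [LO v0]]]; split=> [x|i|].
- exact: differentiable_add.
- rewrite (_ : partial i _ = fun x => partial i u x + partial i v x).
    exact: cont_add.
  by apply/funext => x; exact: partial_add.
- exists (K `|` L); first exact: compactU.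
  split=> [x [/KO|/LO]//|x KL]; rewrite u0 ?v0 ?addr0// => Hx; apply: KL; [by right|by left].
Qed.

Lemma C1c_mul Om u v : C1c Om u -> (forall x, differentiable v x) ->
  (forall i, continuous (partial i v)) -> C1c Om (fun x => v x * u x).
Proof.
move=> [du cu [K cK [KO u0]]] dv cv; split=> [x|i|].
- exact: differentiable_mul.
- rewrite (_ : partial i _ = fun x => v x * partial i u x + u x * partial i v x).
    by apply: cont_add; apply: cont_mul => //; exact: differentiable_cont.
  by apply/funext => x; exact: partial_mul.
- by exists K => //; split => // x Kx; rewrite u0// mulr0.
Qed.

Lemma C1c_scale Om k u : C1c Om u -> C1c Om (fun x => k * u x).
Proof.
move=> Cu; apply: (C1c_mul Cu) => [x|i]; first exact: differentiable_const.
by rewrite (_ : partial i _ = fun=> 0); [exact: cont_cst|apply/funext => x; exact: partial_cst].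
Qed.

Lemma C1c_comp Om (h h' : R -> R) u : C1c Om u ->
  has_deriv h h' -> continuous h' -> h 0 = 0 ->
  C1c Om (fun x => h (u x)) /\
  forall i x, partial i (fun x => h (u x)) x = h' (u x) * partial i u x.
Proof.
move=> [du cu [K cK [KO u0]]] dh ch h0.
have P i x : partial i (fun x => h (u x)) x = h' (u x) * partial i u x.
  rewrite partial_comp//; last by exact: ex_derive.
  by rewrite derive1E (@derive_val _ _ _ _ _ _ _ (dh (u x))).
split => //; split => [x|i|].
- by apply: differentiable_comp1 => //; exact: ex_derive.
- rewrite (_ : partial i _ = fun x => h' (u x) * partial i u x); last exact/funext/P.
  by apply: cont_mul => //; apply: cont_comp => //; exact: differentiable_cont.
- by exists K => //; split => // x Kx; rewrite u0.
Qed.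

Local Notation mu := (lebesgue_rV d).

Lemma partial_cvg u x i (h : R^nat) : differentiable u x ->
  (forall n, h n != 0) -> h n @[n --> \oo] --> 0 ->
  (h n)^-1 * (u (x + h n *: delta_mx 0 i) - u x) @[n --> \oo] --> partial i u x.
Proof.
move=> du h0 hc.
have dv : derivable u x (delta_mx 0 i) by exact: diff_derivable.
have /cvgr_dnbhsP/(_ h) : (fun h : R => h^-1 *: ((u \o shift x) (h *: delta_mx 0 i) - u x)) @ 0^' --> partial i u x.
  exact: dv.
move=> /(_ (conj h0 hc)); apply: cvg_trans; apply: near_eq_cvg.
by apply: nearW => n /=; rewrite [h n *: _ + _]addrC.
Qed.

(** The difference quotients have integral zero by translation invariance. By the mean value theorem
    they are dominated by a multiple of the indicator of a box, so dominated convergence passes to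
    the derivative. *)
Lemma Int_partial0 Om u i : measurable Om -> C1c Om u ->
  \int[mu]_(x in Om) partial i u x = 0.
Proof.
move=> mOm Cu; have pOm := @C1c_partial_out Om u i ^~ Cu.
rewrite (@eq_Int_support _ _ _ _ Om setT); last first.
  by move=> x H; apply: pOm => Ox; apply: H.
have [M M0 HM] := bm_bound (C1c_partial_bm i Cu).
have bu := C1c_bm Cu.
case: (Cu) => du cu [K cK [KO u0]].
have [N N0 HN] := compact_rV_bounded cK.
(* The increments [h n] are at most 1, so the enlargement by 1 contains all translated supports. *)
pose B := [set x : E | forall i, `|x 0 i| <= N + 1].
have mB : measurable B by exact: measurable_box.
have fB : (mu B < +oo)%E by apply: (bounded_lebesgue_rV mB (a := N + 1)).
pose h (n : nat) : R := n.+1%:R^-1.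
have h0 n : h n != 0 by rewrite invr_eq0 pnatr_eq0.
have hc : h n @[n --> \oo] --> 0 by exact: cvg_harmonic.
pose f_ n x := (h n)^-1 * (u (x + h n *: delta_mx 0 i) - u x).
have but n : bm (fun x => u (x + h n *: delta_mx 0 i)).
  have [mu' [L HL]] := bu; split; last by exists L => x; exact: HL.
  have := measurable_affine_rV 1 (h n *: delta_mx 0 i : E).
  under eq_fun do rewrite scale1r.
  exact: (measurableT_comp mu').
have bf n : bm (f_ n) by rewrite /f_; bm_tac.
have fc x : (f_ n x)%:E @[n --> \oo] --> (partial i u x)%:E.
  by apply: cvg_EFin; [exact: nearW|exact: partial_cvg].
have bound n x : `|f_ n x| <= M * \1_B x.
  have [s s01 E] := MVT_rV x (h n *: delta_mx 0 i) du.
  have hE : f_ n x = partial i u (x + s *: (h n *: delta_mx 0 i)).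
    rewrite /f_ E (bigD1 i)//= big1 ?addr0; last first.
      by move=> j ji; rewrite !mxE /= (negbTE ji) mulr0 mul0r.
    by rewrite !mxE !eqxx /= mulr1 mulKf.
  rewrite indicE; have [xB|xB] := boolP (x \in B); first by rewrite hE mulr1 HM.
  rewrite mulr0 normr_le0; move: xB; rewrite notin_setE /B /= => xB.
  have h1 : `|h n| <= 1 by rewrite ger0_norm ?invr_ge0// invf_le1 ?ler1n.
  rewrite /f_ !u0 ?subrr ?mulr0//.
    by move=> Kx; apply: xB => j; rewrite (le_trans (HN _ Kx j))// lerDl.
  move=> Kx; apply: xB => j; have := HN _ Kx j; rewrite !mxE => H.
  move: H; set t := h n * _ => H; have -> : x 0 j = (x 0 j + t) - t by rewrite addrK.
  rewrite (le_trans (ler_normB _ _))// lerD// /t normrM.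
  by case: (_ && _); rewrite ?normr0 ?mulr0// normr1 mulr1.
have ig : mu.-integrable setT (fun x => (M * \1_B x)%:E).
  under eq_fun do rewrite EFinM.
  apply: integrableZl => //; apply/integrableP; split.
    by apply/measurable_EFinP; exact: measurable_indic.
  under eq_integral do rewrite gee0_abs ?lee_fin//.
  by rewrite integral_indic// setIT.
have [_ _] := @dominated_convergence _ _ _ mu setT measurableT
  (fun n x => (f_ n x)%:E) (fun x => (partial i u x)%:E)
  (fun x => (M * \1_B x)%:E)
  (fun n => (@measurable_EFinP _ _ _ _ _).2 (bm_meas (bf n)))
  ((@measurable_EFinP _ _ _ _ _).2 (bm_meas (C1c_partial_bm i Cu)))
  (aeW _ (fun x _ => fc x)) ig (aeW _ (fun x n _ => bound n x)).
have iu : mu.-integrable setT (EFin \o u).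
  have [L L0 HL] := bm_bound bu.
  apply: (@le_integrable _ _ _ _ _ measurableT _ (fun z => (L * \1_B z)%:E)).
  - by apply/measurable_EFinP; exact: bm_meas.
  - move=> x _ /=; rewrite lee_fin [leRHS]ger0_norm ?mulr_ge0// indicE.
    have [xB|] := boolP (x \in B); first by rewrite mulr1.
    rewrite notin_setE /B /= => xB; rewrite u0 ?normr0 ?mulr0// => Kx.
    by apply: xB => j; rewrite (le_trans (HN _ Kx j))// lerDl.
  - under eq_fun do rewrite EFinM.
    apply: integrableZl => //; apply/integrableP; split.
      by apply/measurable_EFinP; exact: measurable_indic.
    under eq_integral do rewrite gee0_abs ?lee_fin//.
    by rewrite integral_indic// setIT.
have iut n : mu.-integrable setT (fun x => (u (x + h n *: delta_mx 0 i))%:E).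
  apply/integrableP; split; first by apply/measurable_EFinP; exact: bm_meas (but n).
  rewrite (integral_translate_rV (h n *: delta_mx 0 i) (f := fun x => (`|(u x)%:E|)%E)).
    by case/integrableP: iu.
  by apply: measurableT_comp => //; apply/measurable_EFinP; exact: bm_meas.
have Z n : (\int[mu]_x (f_ n x)%:E)%E = 0%E.
  rewrite /f_; under eq_integral do rewrite EFinM EFinB.
  rewrite integralZl//; last by apply: integrableB.
  rewrite integralB//.
  rewrite (integral_translate_rV (h n *: delta_mx 0 i) (f := fun x => (u x)%:E)); last first.
    by apply/measurable_EFinP; exact: bm_meas.
  by rewrite subee ?mule0//; apply: integrable_fin_num.
move=> H; rewrite /Rintegral.
have -> : (\int[mu]_x (partial i u x)%:E)%E = 0%E; last by [].
have H0 : (fun n => \int[mu]_x (f_ n x)%:E)%E @ \oo --> (0 : \bar R)%E.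
  by under eq_fun do rewrite Z; exact: cvg_cst.
exact: (cvg_unique (@ereal_hausdorff R) H H0).
Qed.

(** Only [u] is compactly supported: on a ball, [v] will be the radial profile or one of its
    derivatives, whatever its boundary values. *)
Lemma Int_by_parts Om u v i : measurable Om -> (mu Om < +oo)%E -> C1c Om u ->
  (forall x, differentiable v x) -> (forall i, continuous (partial i v)) ->
  \int[mu]_(x in Om) (v x * partial i u x) = - \int[mu]_(x in Om) (partial i v x * u x).
Proof.
move=> mOm fOm Cu dv cv; have Cuv := C1c_mul Cu dv cv.
have H := Int_partial0 i mOm Cuv.
case: (Cu) => du cu [K cK [KO u0]].
have Kp := partial_supp i cK u0.
have b1 : bm (fun x => v x * partial i u x).
  apply: (cont_supp_bm cK) => [|x /Kp ->]; last by rewrite mulr0.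
  by apply: cont_mul => //; exact: differentiable_cont.
have b2 : bm (fun x => partial i v x * u x).
  apply: (cont_supp_bm cK) => [|x /u0 ->]; last by rewrite mulr0.
  by apply: cont_mul => //; exact: differentiable_cont.
apply/eqP; rewrite -addr_eq0 -Int_add//; apply/eqP; rewrite -[RHS]H.
by apply: eq_Rintegral => x _; rewrite partial_mul// [u x * _]mulrC.
Qed.

End calculus_rV.

(** * The Brunn-Minkowski inequality *)

Section brunn_minkowski.
Context {R : realType}.
Local Notation leb := (@lebesgue_measure R).
Implicit Types (A B C : set (measurableTypeR R)).

Lemma leb_itv_le (a b : R) : a <= b -> leb `]a, b] = (b - a)%:E.
Proof.
move=> ab; rewrite lebesgue_measure_itv/= lte_fin; case: ifPn => [_|]; first by rewrite EFinB.
by rewrite -leNgt => ba; have -> : a = b by [apply/le_anti/andP]; rewrite subrr.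
Qed.

Lemma measurable_shift A (a : R) : measurable A ->
  measurable [set x : measurableTypeR R | A (x + a)].
Proof.
move=> mA; rewrite -[X in measurable X]setTI.
have := measurable_affine 1 a; under eq_fun do rewrite mul1r.
by move=> /(_ measurableT _ mA).
Qed.

Lemma leb_shift A (a : R) : measurable A ->
  leb [set x : measurableTypeR R | A (x + a)] = leb A.
Proof.
move=> mA; have := @lebesgue_measure_affine _ 1 a A ltr01 mA.
by rewrite invr1 mul1e => <-; congr (leb _); apply/seteqP; split => x /=; rewrite mul1r.
Qed.

(* Cut [A] just below its supremum and [B] just above its infimum: translates
   of the two remaining pieces lie in [C] on either side of a point. *)
Lemma brunn_minkowski1 A B C (N : R) : measurable A -> measurable B -> measurable C ->
  A !=set0 -> B !=set0 ->
  (forall x, A x -> `|x| <= N) -> (forall x, B x -> `|x| <= N) ->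
  (forall x y, A x -> B y -> C (x + y)) -> (leb A + leb B <= leb C)%E.
Proof.
move=> mA mB mC A0 B0 AN BN ABC; apply/lee_addgt0Pr => e e0.
have sA : has_sup A by split => //; exists N => x /AN; rewrite ler_norml => /andP[].
have iB : has_inf B by split => //; exists (- N) => x /BN; rewrite ler_norml => /andP[].
have e20 : 0 < e / 2 by rewrite divr_gt0.
have [a Aa ha] := sup_adherent e20 sA.
have [b Bb hb] := inf_adherent e20 iB.
pose A1 := A `&` `]-oo, a]; pose B1 := B `&` `]b, +oo[.
have mA1 : measurable A1 by apply: measurableI.
have mB1 : measurable B1 by apply: measurableI.
have hA : (leb A <= leb A1 + (e / 2)%:E)%E.
  apply: (@le_trans _ _ (leb (A1 `|` `]a, sup A]))).
    apply: le_measure; rewrite ?inE//; first exact: measurableU.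
    move=> x Ax /=; rewrite !in_itv/=; have [xa|xa] := leP x a; [by left; split|right].
    by have /ubP := sup_upper_bound sA; apply.
  rewrite (le_trans (measureU2 _ mA1 _))//.
  have sa : a <= sup A by have /ubP := sup_upper_bound sA; apply.
  rewrite leeD2l//; apply: (@le_trans _ _ (sup A - a)%:E); first by rewrite -(leb_itv_le sa).
  by rewrite lee_fin lerBlDr -lerBlDl ltW.
have hB : (leb B <= leb B1 + (e / 2)%:E)%E.
  apply: (@le_trans _ _ (leb (B1 `|` `[inf B, b]))).
    apply: le_measure; rewrite ?inE//; first exact: measurableU.
    move=> x Bx; have [xb|xb] := ltP b x; first by left; split => //=; rewrite in_itv/= xb.
    by right; rewrite /= in_itv/= xb andbT; have := ge_inf iB.2; apply.
  rewrite (le_trans (measureU2 _ mB1 _))//.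
  have ib : inf B <= b by have := ge_inf iB.2; apply.
  rewrite leeD2l//; apply: (@le_trans _ _ (leb `[inf B, b])) => //.
  rewrite lebesgue_measure_itv/= lte_fin; case: ifPn => _; last by rewrite lee_fin ltW.
  by rewrite -EFinB lee_fin lerBlDr addrC ltW.
pose A2 := [set x : measurableTypeR R | A1 (x + - b)].
pose B2 := [set x : measurableTypeR R | B1 (x + - a)].
have mA2 : measurable A2 by exact: measurable_shift.
have mB2 : measurable B2 by exact: measurable_shift.
have H : (leb A1 + leb B1 <= leb C)%E.
  rewrite -(leb_shift (- b) mA1) -(leb_shift (- a) mB1) -/A2 -/B2.
  rewrite -measureU//; last first.
    apply/seteqP; split => // x [[_ /=]] + [_ /=].
    rewrite !in_itv/= andbT => h1 h2.
    have h3 : x - a <= b by rewrite lerBlDr addrC -lerBlDr.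
    by have := lt_le_trans h2 h3; rewrite ltxx.
  apply: le_measure; rewrite ?inE//; first exact: measurableU.
  move=> x [[Ax _]|[Bx _]]; first by rewrite -(subrK b x); exact: ABC.
  by rewrite -(subrK a x) addrC; exact: ABC.
have -> : e%:E = ((e / 2)%:E + (e / 2)%:E)%E by rewrite -EFinD -splitr.
apply: le_trans (leeD hA hB) _; rewrite addeACA leeD2r//.
Qed.

Lemma measurable_predP d (T : measurableType d) (P : T -> bool) :
  measurable_fun setT P -> measurable [set x | P x].
Proof. by move=> mP; have := mP measurableT [set true] I; rewrite setTI. Qed.

(** * Layer cake and the one-dimensional Prekopa-Leindler inequality *)

Section layer_cake.
Variables (f : measurableTypeR R -> \bar R) (c : R).
Hypotheses (mf : measurable_fun setT f).

(** Levels are measured as fractions [s] of a height [c], so that functions of different sizes can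
    be compared at the same [s]. *)
Let W := [set z : measurableTypeR R * measurableTypeR R |
  (0 < z.1 < 1) && ((z.1 * c)%:E < f z.2)%E].

Let mW : measurable W.
Proof.
apply: measurable_predP; apply: measurable_and; first apply: measurable_and.
- exact: measurable_fun_ltr.
- exact: measurable_fun_ltr.
- apply: measurable_fun_lte; last exact: (measurableT_comp mf).
  by apply/measurable_EFinP; apply: measurable_funM.
Qed.

Let WE s : leb (xsection W s) =
  (((fun s => leb [set x | ((s * c)%:E < f x)%E]) \_ [set` `]0%R, 1%R[]) s)%E.
Proof.
rewrite patchE; case: ifPn; rewrite ?inE ?notin_setE /= in_itv/= => s01.
  by congr (leb _); apply/seteqP; split => x /=; rewrite /xsection /= inE /W /= s01.
rewrite (_ : xsection W s = set0) ?measure0//; apply/seteqP; split => // x.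
by rewrite /xsection /= inE /W /= => /andP[].
Qed.

Lemma measurable_level :
  measurable_fun ([set` `](0 : R), (1 : R)[] : set (measurableTypeR R))
  (fun s : measurableTypeR R => leb [set x | ((s * c)%:E < f x)%E]).
Proof.
apply/(measurable_restrictT _ _).2 => //.
have := measurable_fun_xsection (leb : {sigma_finite_measure set _ -> \bar R}) mW.
by apply: eq_measurable_fun => s _; rewrite -WE.
Qed.

Lemma layer_cake_fubini :
  (\int[leb]_(s in [set` `]0%R, 1%R[]) leb [set x | ((s * c)%:E < f x)%E] =
   \int[leb]_x leb [set s : R | (0 < s < 1)%R && ((s * c)%:E < f x)%E])%E.
Proof.
transitivity (\int[leb]_s \int[leb]_x (\1_W (s, x))%:E)%E.
  rewrite integral_mkcond; apply: eq_integral => s _; rewrite -WE.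
  rewrite -[xsection W s]setIT -integral_indic//; last exact: measurable_xsection.
  apply: eq_integral => x _; congr EFin; rewrite !indicE; congr (_%:R); congr nat_of_bool.
  by apply/idP/idP; rewrite ?inE /xsection /= ?inE.
rewrite (fubini_tonelli (fun z => (\1_W z)%:E))//; last first.
  by apply/measurable_EFinP; exact: measurable_indic.
apply: eq_integral => x _.
transitivity (leb (ysection W x)).
  rewrite -[ysection W x]setIT -integral_indic//; last exact: measurable_ysection.
  apply: eq_integral => s _; congr EFin; rewrite !indicE; congr (_%:R); congr nat_of_bool.
  by apply/idP/idP; rewrite ?inE /ysection /= ?inE.
by congr (leb _); apply/seteqP; split => s; rewrite /ysection /= inE.
Qed.

Lemma measurable_slice_level x :
  measurable [set s : measurableTypeR R | (0 < s < 1) && ((s * c)%:E < f x)%E].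
Proof.
rewrite (_ : [set _ | _] = ysection W x); first exact: measurable_ysection.
by apply/seteqP; split => s; rewrite /ysection /= inE.
Qed.

Lemma measurable_slice_level_measure : measurable_fun setT
  (fun x : measurableTypeR R => leb [set s : R | (0 < s < 1)%R && ((s * c)%:E < f x)%E]).
Proof.
have := measurable_fun_ysection (leb : {sigma_finite_measure set _ -> \bar R}) mW.
apply: eq_measurable_fun => x _ /=.
by congr (leb _); apply/seteqP; split => s; rewrite /ysection /= inE.
Qed.

End layer_cake.

(** Only an inequality, because the part of [f] above the height [c] is not counted; [layer_cake_le]
    is the converse when [f <= c]. *)
Lemma layer_cake_ge (f : measurableTypeR R -> \bar R) (c : R) : 0 < c ->
  measurable_fun setT f -> (forall x, 0 <= f x)%E ->
  (\int[leb]_(s in [set` `]0%R, 1%R[]) leb [set x | ((s * c)%:E < f x)%E]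
    <= (c^-1)%:E * \int[leb]_x f x)%E.
Proof.
move=> c0 mf f0; rewrite layer_cake_fubini// -ge0_integralZl//; last first.
  by rewrite lee_fin invr_ge0 ltW.
apply: ge0_le_integral => //.
- exact: measurable_slice_level_measure.
- exact: measurable_funeM.
move=> x _; have := f0 x; case Ef: (f x) => [r| |] // r0.
  apply: (@le_trans _ _ (leb [set` `]0%R, (r / c)%R]])).
    apply: le_measure; rewrite ?inE//.
      by have := measurable_slice_level c mf x; rewrite Ef.
    move=> s /=; rewrite lte_fin in_itv/= => /andP[/andP[-> _]] /=.
    by rewrite ler_pdivlMr// => /ltW.
  have r0' : 0 <= r by rewrite -lee_fin.
  by rewrite leb_itv_le ?divr_ge0 ?(ltW c0)// subr0 -EFinM mulrC.
by rewrite mulry gtr0_sg ?invr_gt0// mul1e leey.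
Qed.

Lemma layer_cake_le (f : measurableTypeR R -> R) (c : R) : 0 < c ->
  measurable_fun setT f -> (forall x, 0 <= f x <= c) ->
  ((c^-1)%:E * \int[leb]_x (f x)%:E <=
   \int[leb]_(s in [set` `]0%R, 1%R[]) leb [set x | ((s * c)%:E < (f x)%:E)%E])%E.
Proof.
move=> c0 mf f0; have mf' : measurable_fun setT (EFin \o f) by exact/measurable_EFinP.
rewrite (layer_cake_fubini c mf') -ge0_integralZl//; last 2 first.
- by move=> x _; rewrite lee_fin; case/andP: (f0 x).
- by rewrite lee_fin invr_ge0 ltW.
apply: ge0_le_integral => //.
- by move=> x _; rewrite -EFinM lee_fin mulr_ge0// ?invr_ge0 ?(ltW c0)//; case/andP: (f0 x).
- by under eq_fun do rewrite -EFinM; apply/measurable_EFinP; apply: measurable_funM.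
- exact: (measurable_slice_level_measure c mf').
move=> x _; rewrite -EFinM.
apply: (@le_trans _ _ (leb [set` `]0%R, (f x / c)%R[])).
  rewrite lebesgue_measure_itv/= lte_fin mulrC; case: ifPn; first by rewrite sube0.
  by rewrite -leNgt lee_fin.
apply: le_measure; rewrite ?inE//; first exact: (measurable_slice_level c mf').
move=> s; rewrite /= in_itv/= lte_fin => /andP[-> sc] /=.
rewrite -ltr_pdivlMr// sc andbT (lt_le_trans sc)// ler_pdivrMr// mul1r.
by case/andP: (f0 x).
Qed.

(** Young's inequality with the conjugate exponents [(1 - l)^-1] and [l^-1]. *)
Lemma weighted_AMGM (X Y l : R) : 0 < l < 1 -> 0 <= X -> 0 <= Y ->
  (X / (1 - l)) `^ (1 - l) * (Y / l) `^ l <= X + Y.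
Proof.
move=> /andP[l0 l1] X0 Y0; have l1' : 0 < 1 - l by rewrite subr_gt0.
have := @conjugate_powR R ((X / (1 - l)) `^ (1 - l)) ((Y / l) `^ l) (1 - l)^-1 l^-1.
rewrite !powR_ge0 !invr_gt0 l0 l1' !invrK subrK => /(_ isT isT isT isT erefl).
have hX : 0 <= X / (1 - l) by rewrite divr_ge0// ltW.
have hY : 0 <= Y / l by rewrite divr_ge0// ltW.
by rewrite -!powRrM !mulfV ?gt_eqF// !powRr1// !divfK ?gt_eqF.
Qed.

(** Measure levels of [F] and [G] relative to their suprema [a] and [b], and those of [H] relative
    to the weighted geometric mean [c] of [a] and [b]. At each [s] the superlevel set of [H]
    contains the sum of the other two, so the additive one-dimensional inequality applies;
    integrating in [s] and weighted AM-GM give the multiplicative form. [H] is extended-valued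
    because it will be the measure of slices that may be infinite. *)
Lemma prekopa_leindler1 (F G : measurableTypeR R -> R) (H : measurableTypeR R -> \bar R) (l M N : R) :
  0 < l < 1 -> measurable_fun setT F -> measurable_fun setT G -> measurable_fun setT H ->
  (forall x, 0 <= F x <= M) -> (forall x, 0 <= G x <= M) -> (forall x, 0 <= H x)%E ->
  (forall x, F x != 0 -> `|x| <= N) -> (forall x, G x != 0 -> `|x| <= N) ->
  (forall x y, ((F x) `^ (1 - l) * (G y) `^ l)%:E <= H (x + y)%R)%E ->
  (((\int[leb]_x F x / (1 - l)) `^ (1 - l) * (\int[leb]_x G x / l) `^ l)%:E <=
   \int[leb]_x H x)%E.
Proof.
move=> l01 mF mG mH FM GM H0 FN GN FGH; have /andP[l0 l1] := l01.
have l1' : 0 < 1 - l by rewrite subr_gt0.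
have Hi : (0 <= \int[leb]_x H x)%E by apply: integral_ge0.
have [F0|/existsNP[x0 /eqP Fx0]] := pselect (forall x, F x = 0).
  have -> : \int[leb]_x F x = 0 by under eq_Rintegral do rewrite F0; rewrite Rintegral_cst// mul0r.
  by rewrite mul0r powR0 ?gt_eqF// mul0r.
have [G0|/existsNP[y0 /eqP Gy0]] := pselect (forall x, G x = 0).
  have -> : \int[leb]_x G x = 0 by under eq_Rintegral do rewrite G0; rewrite Rintegral_cst// mul0r.
  by rewrite mul0r (powR0 (x := l)) ?gt_eqF// mulr0.
have sF : has_sup (range F).
  by split; [exists (F x0); exists x0|exists M => _ [x _ <-]; case/andP: (FM x)].
have sG : has_sup (range G).
  by split; [exists (G y0); exists y0|exists M => _ [x _ <-]; case/andP: (GM x)].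
set a := sup (range F); set b := sup (range G).
have Fa x : F x <= a by have /ubP := sup_upper_bound sF; apply; exists x.
have Gb x : G x <= b by have /ubP := sup_upper_bound sG; apply; exists x.
have a0 : 0 < a by apply: lt_le_trans (Fa x0); rewrite lt_neqAle eq_sym Fx0; case/andP: (FM x0).
have b0 : 0 < b by apply: lt_le_trans (Gb y0); rewrite lt_neqAle eq_sym Gy0; case/andP: (GM y0).
pose c := a `^ (1 - l) * b `^ l.
have c0 : 0 < c by rewrite mulr_gt0// powR_gt0.
have key : ((a^-1)%:E * \int[leb]_x (F x)%:E + (b^-1)%:E * \int[leb]_x (G x)%:E <=
   (c^-1)%:E * \int[leb]_x H x)%E.
  apply: le_trans (layer_cake_ge c0 mH H0).
  apply: (le_trans (leeD (layer_cake_le a0 mF _) (layer_cake_le b0 mG _))).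
  - by move=> x; case/andP: (FM x) => -> _; exact: Fa.
  - by move=> x; case/andP: (GM x) => -> _; exact: Gb.
  rewrite -ge0_integralD//; last 2 first.
  - by apply: (@measurable_level (EFin \o F)); exact/measurable_EFinP.
  - by apply: (@measurable_level (EFin \o G)); exact/measurable_EFinP.
  apply: ge0_le_integral => //.
  - by move=> s _; rewrite adde_ge0.
  - apply: emeasurable_funD.
      by apply: (@measurable_level (EFin \o F)); exact/measurable_EFinP.
    by apply: (@measurable_level (EFin \o G)); exact/measurable_EFinP.
  - exact: measurable_level.
  move=> s /=; rewrite in_itv/= => /andP[s0 s1].
  have lev (f : measurableTypeR R -> R) k : measurable_fun setT f ->
     measurable [set x | (k%:E < (f x)%:E)%E].
    move=> mf; have := mf measurableT `]k, +oo[%classic (measurable_itv _).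
    by rewrite setTI; rewrite (_ : _ @^-1` _ = [set x | (k%:E < (f x)%:E)%E])//; apply/seteqP; split => x /=; rewrite in_itv/= andbT lte_fin.
  apply: (@brunn_minkowski1 _ _ _ N).
  - exact: lev.
  - exact: lev.
  - have := emeasurable_fun_o_infty measurableT mH (s * c)%:E.
    by rewrite setTI.
  (* Nonempty because [s < 1] keeps the level below the supremum; the additive inequality fails for
     an empty summand. *)
  - have [|_ [x _ <-] Hx] := @sup_adherent _ _ ((1 - s) * a) _ sF; first by rewrite mulr_gt0// subr_gt0.
    by exists x => /=; rewrite lte_fin; move: Hx; rewrite -/a mulrBl mul1r opprB addrC subrK.
  - have [|_ [x _ <-] Hx] := @sup_adherent _ _ ((1 - s) * b) _ sG; first by rewrite mulr_gt0// subr_gt0.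
    by exists x => /=; rewrite lte_fin; move: Hx; rewrite -/b mulrBl mul1r opprB addrC subrK.
  - by move=> x /=; rewrite lte_fin => Hx; apply: FN; rewrite gt_eqF// (lt_trans _ Hx)// mulr_gt0.
  - by move=> x /=; rewrite lte_fin => Hx; apply: GN; rewrite gt_eqF// (lt_trans _ Hx)// mulr_gt0.
  move=> x y /=; rewrite !lte_fin => Hx Hy; apply: lt_le_trans (FGH x y); rewrite lte_fin.
  have -> : s * c = (s * a) `^ (1 - l) * (s * b) `^ l.
    rewrite !powRM ?ltW// /c mulrACA -powRD ?subrK ?powRr1 ?(ltW s0)//.
    by apply/implyP => _; rewrite gt_eqF.
  have sa0 : 0 < s * a by rewrite mulr_gt0.
  have sb0 : 0 < s * b by rewrite mulr_gt0.
  apply: ltr_pM; rewrite ?powR_ge0//.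
    by apply: gt0_ltr_powR => //; rewrite nnegrE ltW// (lt_trans sa0).
  by apply: gt0_ltr_powR => //; rewrite nnegrE ltW// (lt_trans sb0).
have bF (f : measurableTypeR R -> R) : (forall x, 0 <= f x <= M) -> measurable_fun setT f ->
    (forall x, f x != 0 -> `|x| <= N) -> (\int[leb]_x (f x)%:E = (\int[leb]_x f x)%:E)%E.
  move=> fM mf fN; rewrite /Rintegral fineK//.
  rewrite ge0_fin_numE; last by apply: integral_ge0 => x _; rewrite lee_fin; case/andP: (fM x).
  apply: (@le_lt_trans _ _ (\int[leb]_(x in [set` `[(- N)%R, N%R]]) M%:E)%E).
    rewrite [leRHS]integral_mkcond; apply: ge0_le_integral => //.
    - by move=> x _; rewrite lee_fin; case/andP: (fM x).
    - exact/measurable_EFinP.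
    - by apply/(measurable_restrictT _ _).1.
    move=> x _; rewrite patchE; case: ifPn => [_|]; first by rewrite lee_fin; case/andP: (fM x).
    rewrite notin_setE /= in_itv/= -ler_norml => xN; rewrite lee_fin.
    by have [->//|fx] := eqVneq (f x) 0; case: xN; exact: fN.
  by rewrite integral_cst//= lebesgue_measure_itv/= lte_fin; case: ifPn => _; rewrite ?mule0 ?ltry// -EFinB -EFinM ltry.
move: key; rewrite !bF// -!EFinM -EFinD => key.
have {}key : ((c * (a^-1 * \int[leb]_x F x + b^-1 * \int[leb]_x G x))%:E <= \int[leb]_x H x)%E.
  have := lee_wpmul2l (_ : (0 <= c%:E)%E) key; rewrite muleA -!EFinM mulfV ?gt_eqF// mul1e; apply.
  by rewrite lee_fin ltW.
apply: le_trans key; rewrite lee_fin.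
have IF : 0 <= \int[leb]_x F x by apply: Rintegral_ge0 => x _; case/andP: (FM x).
have IG : 0 <= \int[leb]_x G x by apply: Rintegral_ge0 => x _; case/andP: (GM x).
have ha : 0 <= a^-1 * \int[leb]_x F x by rewrite mulr_ge0// invr_ge0 ltW.
have hb : 0 <= b^-1 * \int[leb]_x G x by rewrite mulr_ge0// invr_ge0 ltW.
apply: le_trans (ler_wpM2l (ltW c0) (weighted_AMGM l01 ha hb)).
have a0' := ltW a0; have b0' := ltW b0; have l0' := ltW l0; have l1'' := ltW l1'.
have ha' := divr_ge0 ha l1''; have hb' := divr_ge0 hb l0'.
rewrite /c mulrACA -!powRM//.
by rewrite !mulrA !mulfV ?gt_eqF// !mul1r.
Qed.

(* The multiplicative inequality applied to [A / (1 - l)] and [B / l], with the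
   dilations factored out so that the induction on [d] needs no rescaling. *)
Lemma brunn_minkowski_mul d (A B C : set 'rV[R]_d) (l N : R) : 0 < l < 1 ->
  measurable A -> measurable B -> measurable C ->
  (forall x, A x -> forall i, `|x 0 i| <= N) -> (forall x, B x -> forall i, `|x 0 i| <= N) ->
  (forall x y, A x -> B y -> C (x + y)) ->
  (((fine (lebesgue_rV d A) / (1 - l) ^+ d) `^ (1 - l) *
    (fine (lebesgue_rV d B) / l ^+ d) `^ l)%:E <= lebesgue_rV d C)%E.
Proof.
move=> l01; have /andP[l0 l1] := l01; have l1' : 0 < 1 - l by rewrite subr_gt0.
elim: d A B C => [|d IH] A B C mA mB mC AN BN ABC.
  rewrite /= !expr0 !divr1 !diracE /= ?indicE.
  have E (x : 'rV[R]_0) : x = 0 by apply/rowP => -[].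
  have [A0|A0] := boolP (0 \in A); last by rewrite /= (powR0 (x := 1 - l)) ?mul0r ?gt_eqF// lee_fin ler0n.
  have [B0|B0] := boolP (0 \in B); last by rewrite /= (powR0 (x := l)) ?mulr0 ?gt_eqF// lee_fin ler0n.
  rewrite mem_set /= ?powR1 ?mul1r//; move: A0 B0; rewrite !inE => A0 B0.
  by rewrite -(addr0 0); exact: ABC.
pose sl (X : set 'rV[R]_d.+1) (x : measurableTypeR R) := [set y | X (cons_rV (x, y))].
have msl (X : set 'rV[R]_d.+1) x : measurable X -> measurable (sl X x) by exact: measurable_slice_rV.
have slN (X : set 'rV[R]_d.+1) x : (forall x, X x -> forall i, `|x 0 i| <= N) ->
    forall y, sl X x y -> forall i, `|y 0 i| <= N.
  by move=> XN y /XN Xy i; have := Xy (lift 0 i); rewrite cons_rVS.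
have slN0 (X : set 'rV[R]_d.+1) x : (forall x, X x -> forall i, `|x 0 i| <= N) ->
    fine (lebesgue_rV d (sl X x)) != 0 -> `|x| <= N.
  move=> XN; have [[y Xy] _|X0] := pselect (sl X x !=set0).
    by have := XN _ Xy 0; rewrite cons_rV0.
  by rewrite (_ : sl X x = set0) ?measure0 ?eqxx//; apply/seteqP; split => // y Xy; case: X0; exists y.
have slM (X : set 'rV[R]_d.+1) x : measurable X -> (forall x, X x -> forall i, `|x 0 i| <= N) ->
    0 <= fine (lebesgue_rV d (sl X x)) <= (2 * Num.max 0 N) ^+ d.
  move=> mX XN; rewrite fine_ge0//=.
  have N0 : 0 <= Num.max 0 N by rewrite le_max lexx.
  rewrite -lee_fin fineK; last first.
    by rewrite ge0_fin_numE// (bounded_lebesgue_rV (msl _ _ mX) (slN _ _ XN)).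
  rewrite -lebesgue_rV_box//; apply: le_measure; rewrite ?inE; [exact: msl|exact: measurable_box|].
  by move=> y /(slN _ _ XN) yN i /=; rewrite le_max yN orbT.
have slE (X : set 'rV[R]_d.+1) : measurable X -> (forall x, X x -> forall i, `|x 0 i| <= N) ->
    fine (lebesgue_rV d.+1 X) = \int[leb]_x fine (lebesgue_rV d (sl X x)).
  move=> mX XN; rewrite lebesgue_rVS /Rintegral; congr fine; apply: eq_integral => x _.
  by rewrite fineK// ge0_fin_numE// (bounded_lebesgue_rV (msl _ _ mX) (slN _ _ XN)).
have mF (X : set 'rV[R]_d.+1) : measurable X -> measurable_fun setT (fun x : measurableTypeR R => fine (lebesgue_rV d (sl X x))).
  move=> mX; apply: (measurableT_comp (@fine_measurable R setT measurableT)).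
  exact: measurable_slice_measure.
pose F x := fine (lebesgue_rV d (sl A x)) / (1 - l) ^+ d.
pose G x := fine (lebesgue_rV d (sl B x)) / l ^+ d.
pose M := (2 * Num.max 0 N) ^+ d.
have p1 : 0 < (1 - l) ^+ d by rewrite exprn_gt0.
have p2 : 0 < l ^+ d by rewrite exprn_gt0.
have M0 : 0 <= M by rewrite exprn_ge0// mulr_ge0// le_max lexx.
have key := @prekopa_leindler1 F G (fun x => lebesgue_rV d (sl C x)) l
  (M / (1 - l) ^+ d + M / l ^+ d) N l01.
have int_div (f : measurableTypeR R -> R) k : measurable_fun setT f ->
    (forall x, 0 <= f x <= M) -> (forall x, f x != 0 -> `|x| <= N) ->
    \int[leb]_x (f x / k) = (\int[leb]_x f x) / k.
  move=> mf fM fN.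
  have E g : (forall x, f x = 0 -> g x = 0) -> \int[leb]_x g x = \int[leb]_(x in `[- N, N]) g x.
    move=> g0; apply: eq_Int_support => x H; apply: g0; apply/eqP.
    apply: contra_notT H => fx; split => //=; rewrite in_itv/= -ler_norml; exact: fN.
  rewrite (E (fun x => f x / k)) ?(E f)//; last by move=> x ->; rewrite mul0r.
  have bf : bm f.
    by split => //; exists M => x; have /andP[h1 h2] := fM x; rewrite ger0_norm.
  under eq_Rintegral do rewrite mulrC.
  have mI : measurable (`[- N, N]%classic : set (measurableTypeR R)) by exact: measurable_itv.
  have fI : (leb (`[(- N)%R, N]%classic : set (measurableTypeR R)) < +oo)%E.
    by rewrite lebesgue_measure_itv/=; case: ifPn => _; rewrite ltry.
  by have -> := Int_scale mI fI k^-1 bf; rewrite mulrC.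
rewrite (lebesgue_rVS C).
have -> : fine (lebesgue_rV d.+1 A) / (1 - l) ^+ d.+1 = \int[leb]_x F x / (1 - l).
  rewrite slE// /F int_div//; [|exact: mF|by move=> x; exact: slM|by move=> x; exact: slN0].
  by rewrite exprS invfM mulrCA mulrC.
have -> : fine (lebesgue_rV d.+1 B) / l ^+ d.+1 = \int[leb]_x G x / l.
  rewrite slE// /G int_div//; [|exact: mF|by move=> x; exact: slM|by move=> x; exact: slN0].
  by rewrite exprS invfM mulrCA mulrC.
apply: key => //.
- by apply: measurable_funM => //; exact: mF.
- by apply: measurable_funM => //; exact: mF.
- exact: measurable_slice_measure.
- move=> x; have /andP[h1 h2] := slM _ x mA AN; rewrite divr_ge0 ?(ltW p1)//=.
  by rewrite ler_wpDr ?divr_ge0 ?(ltW p2)// ler_wpM2r// invr_ge0 ltW.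
- move=> x; have /andP[h1 h2] := slM _ x mB BN; rewrite divr_ge0 ?(ltW p2)//=.
  by rewrite ler_wpDl ?divr_ge0 ?(ltW p1)// ler_wpM2r// invr_ge0 ltW.
- move=> x Fx; apply: slN0 AN _; apply: contraNN Fx => /eqP E.
  by rewrite /F E mul0r.
- move=> x Gx; apply: slN0 BN _; apply: contraNN Gx => /eqP E.
  by rewrite /G E mul0r.
move=> x y; apply: IH; [exact: msl|exact: msl|exact: msl|exact: slN|exact: slN|].
move=> a b Aa Bb; rewrite /sl /=.
rewrite (_ : cons_rV (x + y, a + b) = cons_rV (x, a) + cons_rV (y, b)); first exact: ABC.
by apply/rowP => i; rewrite !mxE; case: unliftP => [j|] /=; rewrite ?mxE.
Qed.

(** For the weight [l = eps / (rho + eps)] both factors of the multiplicative inequality have the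
    same base, the volume of a ball of radius [rho + eps], so the geometric mean collapses to the
    additive form. *)
Lemma brunn_minkowski_ball d (A C : set 'rV[R]_d) (rho eps N : R) : (0 < d)%N ->
  0 < rho -> 0 < eps -> measurable A -> measurable C ->
  (forall x, A x -> forall i, `|x 0 i| <= N) ->
  lebesgue_rV d A = (unit_ball_volume d * rho ^+ d)%:E ->
  (forall x y, A x -> euclidean_ball 0 eps y -> C (x + y)) ->
  ((unit_ball_volume d * (rho + eps) ^+ d)%:E <= lebesgue_rV d C)%E.
Proof.
move=> d0 rho0 e0 mA mC AN EA ABC; set om := unit_ball_volume d.
have om0 : 0 < om := unit_ball_volume_gt0 d.
have re0 : 0 < rho + eps by rewrite addr_gt0.
have l01 : 0 < eps / (rho + eps) < 1.
  by rewrite divr_gt0//= ltr_pdivrMr// mul1r ltrDr.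
have := @brunn_minkowski_mul d A (euclidean_ball 0 eps) C (eps / (rho + eps)) (Num.max N eps) l01 mA.
move=> /(_ (measurable_euclidean_ball _ _) mC _ _ ABC).
rewrite EA lebesgue_euclidean_ball ?(ltW e0)//= -/om.
have -> : 1 - eps / (rho + eps) = rho / (rho + eps) by field; rewrite gt_eqF.
have E k : 0 < k -> om * k ^+ d / (k / (rho + eps)) ^+ d = om * (rho + eps) ^+ d.
  by move=> k0; rewrite expr_div_n; field; rewrite !expf_neq0 ?gt_eqF.
rewrite !E// -powRD; last by apply/implyP => _; rewrite gt_eqF// mulr_gt0// exprn_gt0.
rewrite -mulrDl divff ?gt_eqF// powRr1 ?mulr_ge0 ?(ltW om0) ?exprn_ge0 ?(ltW re0)//.
apply; first by move=> x /AN xN i; rewrite le_max xN.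
move=> x /euclidean_ball_bounded xN i; have := xN i.
by rewrite !mxE subr0 le_max => ->; rewrite orbT.
Qed.

End brunn_minkowski.

(** * The isoperimetric inequality for smoothed level sets *)

Section quadratic_derivative.
Context {R : realType}.
Implicit Types (f g : R -> R).

Definition qderiv f g (C : R) := forall a h, `|f (a + h) - f a - g a * h| <= C * h ^+ 2.

Lemma qderiv_has_deriv f g C : qderiv f g C -> has_deriv f g.
Proof.
move=> fg a.
have E : (fun h : R => h^-1 *: ((f \o shift a) (h *: (1 : R)) - f a)) @ 0^' --> g a.
  apply/cvgrPdist_le => e e0.
  have C0 : 0 < `|C| + 1 by rewrite ltr_wpDl.
  near=> h.
  have h0 : h != 0 by near: h; exact: nbhs_dnbhs_neq.
  rewrite distrC /= [h *: (1 : R)]mulr1 [h + a]addrC.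
  have -> : h^-1 *: (f (a + h) - f a) - g a = h^-1 * (f (a + h) - f a - g a * h).
    by rewrite /GRing.scale/=; field.
  rewrite normrM normfV mulrC ler_pdivrMr ?normr_gt0//.
  apply: le_trans (fg a h) _; rewrite -real_normK ?num_real// expr2 mulrA.
  rewrite ler_wpM2r//; apply: (@le_trans _ _ ((`|C| + 1) * `|h|)).
    by rewrite ler_wpM2r// (le_trans (ler_norm _))// lerDl.
  rewrite mulrC -ler_pdivlMr//.
  near: h; apply: dnbhs0_le; exact: divr_gt0.
apply: DeriveDef; first by apply/cvg_ex; exists (g a).
by apply: cvg_lim.
Unshelve. all: end_near. Qed.

(** Add the expansions from [a] to [a + h] and back: the values of [f] cancel and the difference of
    [g] remains. *)
Lemma qderiv_lip f g C : qderiv f g C -> forall a h, `|g (a + h) - g a| <= 2 * C * `|h|.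
Proof.
move=> fg a h; have [->|h0] := eqVneq h 0; first by rewrite addr0 subrr normr0 mulr0.
rewrite -(ler_pM2r (_ : 0 < `|h|)) ?normr_gt0// -normrM.
have -> : (g (a + h) - g a) * h = (f (a + h) - f a - g a * h)
    + (f (a + h + - h) - f (a + h) - g (a + h) * - h) by rewrite addrK; ring.
apply: le_trans (ler_normD _ _) _; apply: le_trans (lerD (fg _ _) (fg _ _)) _.
by rewrite sqrrN -!mulrA -expr2 real_normK ?num_real//; lra.
Qed.

Lemma qderiv_cont f g C : qderiv f g C -> continuous g.
Proof.
move=> fg a; apply/cvgrPdist_le => e e0.
have C0 : 0 < 2 * `|C| + 1 by rewrite ltr_wpDl// mulr_ge0.
near=> b.
have -> : b = a + (b - a) by ring.
rewrite distrC; apply: le_trans (qderiv_lip fg _ _) _.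
apply: (@le_trans _ _ ((2 * `|C| + 1) * `|b - a|)).
  rewrite ler_wpM2r// (@le_trans _ _ (2 * `|C|)) ?lerDl//.
  by rewrite ler_wpM2l// ler_norm.
rewrite mulrC -ler_pdivlMr// distrC.
near: b; apply: cvgr_dist_le; [exact: cvg_id|exact: divr_gt0].
Unshelve. all: end_near. Qed.

Lemma has_deriv_cont f g : has_deriv f g -> continuous f.
Proof.
move=> fg x; apply: differentiable_continuous; apply/derivable1_diffP.
exact: ex_derive.
Qed.

Lemma qderiv_opp f g C : qderiv f g C -> qderiv (fun t => f (- t)) (fun t => - g (- t)) C.
Proof. by move=> fg a h; have := fg (- a) (- h); rewrite -opprD mulrN sqrrN mulNr. Qed.

Lemma FTC (f F : R -> R) (a b : R) : a <= b -> has_deriv F f -> continuous f ->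
  \int[lebesgue_measure]_(x in `[a, b]) f x = F b - F a.
Proof.
rewrite le_eqVlt => /predU1P[->|ab] dF cf.
  by rewrite set_itv1 Rintegral_set1 subrr.
rewrite /Rintegral (@continuous_FTC2 _ f F)//.
- exact: continuous_subspaceT.
- split.
  + by move=> x _; exact: ex_derive.
  + by apply: cvg_at_right_filter; exact: (has_deriv_cont dF).
  + by apply: cvg_at_left_filter; exact: (has_deriv_cont dF).
- by move=> x _; rewrite derive1E (@derive_val _ _ _ _ _ _ _ (dF x)).
Qed.

Lemma qderiv_int d (T : measurableType d) (m : {measure set T -> \bar R}) (D : set T)
    (f g : R -> R) C (w v : T -> R) (M : R) :
  measurable D -> (m D < +oo)%E -> qderiv f g C ->
  (forall tau, bm (fun y => f (v y + tau))) -> (forall tau, bm (fun y => g (v y + tau))) ->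
  bm w -> (forall y, D y -> `|w y| <= M) ->
  qderiv (fun tau => \int[m]_(y in D) (w y * f (v y + tau)))
         (fun tau => \int[m]_(y in D) (w y * g (v y + tau))) (M * C * fine (m D)).
Proof.
move=> mD fD fg bf bg bw wM a h.
have b1 tau : bm (fun y => w y * f (v y + tau)) by apply: bm_mul.
have b2 tau : bm (fun y => w y * g (v y + tau)) by apply: bm_mul.
rewrite -Int_sub// mulrC -Int_scale// -Int_sub//; last 2 first.
- exact: bm_sub.
- exact: bm_scale.
rewrite [leRHS]mulrAC; apply: Int_bound => //.
  by apply: bm_sub; [exact: bm_sub|exact: bm_scale].
move=> y Dy; have -> : w y * f (v y + (a + h)) - w y * f (v y + a) - h * (w y * g (v y + a))
  = w y * (f (v y + a + h) - f (v y + a) - g (v y + a) * h) by rewrite addrA; ring.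
by rewrite normrM -mulrA ler_pM// wM.
Qed.

End quadratic_derivative.

(** * A smooth step of width [dlt] and its derivative *)

Section cutoff.
Context {R : realType}.
Variable dlt : R.
Hypothesis dlt0 : 0 < dlt.

Definition clamp01 (x : R) : R := Num.min (Num.max x 0) 1.
(** The cubic smoothstep, rising from 0 at [0] to 1 at [dlt]. Its derivative [kappa] is a
    nonnegative bump of mass one on [[0, dlt]], approximating a Dirac mass, and is Lipschitz, which
    is the regularity that [qderiv] asks for. *)
Definition theta (x : R) : R := clamp01 (x / dlt) ^+ 2 * (3 - 2 * clamp01 (x / dlt)).
Definition kappa (x : R) : R := 6 / dlt * (clamp01 (x / dlt) * (1 - clamp01 (x / dlt))).

Lemma clamp01_itv x : 0 <= clamp01 x <= 1.
Proof.
rewrite /clamp01 le_min ge_min lexx orbT andbT ler01 andbT.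
by rewrite le_max lexx orbT.
Qed.

Lemma clamp01_le0 x : x <= 0 -> clamp01 x = 0.
Proof. by move=> x0; rewrite /clamp01 max_r// min_l. Qed.

Lemma clamp01_ge1 x : 1 <= x -> clamp01 x = 1.
Proof. by move=> x1; rewrite /clamp01 max_l ?min_r// (le_trans _ x1). Qed.

Lemma clamp01_id x : 0 <= x <= 1 -> clamp01 x = x.
Proof. by case/andP => x0 x1; rewrite /clamp01 max_l// min_l. Qed.

Lemma clamp01P x : [\/ x <= 0 /\ clamp01 x = 0, 1 <= x /\ clamp01 x = 1
  | 0 < x < 1 /\ clamp01 x = x].
Proof.
have [x0|x0] := leP x 0; first by constructor 1; rewrite clamp01_le0.
have [x1|x1] := leP 1 x; first by constructor 2; rewrite clamp01_ge1.
by constructor 3; rewrite clamp01_id// ?ltW.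
Qed.

Lemma theta_itv x : 0 <= theta x <= 1.
Proof.
rewrite /theta; have := clamp01_itv (x / dlt); set c := clamp01 _ => /andP[c0 c1].
apply/andP; split; first by rewrite mulr_ge0 ?sqr_ge0//; lra.
rewrite -subr_ge0 (_ : 1 - _ = (1 - c) ^+ 2 * (1 + 2 * c)); last by ring.
by rewrite mulr_ge0 ?sqr_ge0//; lra.
Qed.

Lemma theta_le0 x : x <= 0 -> theta x = 0.
Proof. by move=> x0; rewrite /theta clamp01_le0 ?expr0n ?mul0r// pmulr_lle0 ?invr_gt0. Qed.

Lemma theta_ge x : dlt <= x -> theta x = 1.
Proof. by move=> x0; rewrite /theta clamp01_ge1 ?ler_pdivlMr ?mul1r//; ring. Qed.

Lemma kappa_ge0 x : 0 <= kappa x.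
Proof.
rewrite /kappa; have /andP[c0 c1] := clamp01_itv (x / dlt).
by rewrite mulr_ge0 ?divr_ge0 ?(ltW dlt0)// mulr_ge0// subr_ge0.
Qed.

Lemma kappa_le x : kappa x <= 6 / dlt.
Proof.
rewrite /kappa; have /andP[c0 c1] := clamp01_itv (x / dlt).
rewrite ler_piMr ?divr_ge0 ?(ltW dlt0)// mulr_ile1// ?subr_ge0//.
by rewrite lerBlDr lerDl.
Qed.

Lemma kappa_le0 x : x <= 0 -> kappa x = 0.
Proof. by move=> x0; rewrite /kappa clamp01_le0 ?mul0r ?mulr0// pmulr_lle0 ?invr_gt0. Qed.

Lemma kappa_ge x : dlt <= x -> kappa x = 0.
Proof. by move=> x0; rewrite /kappa clamp01_ge1 ?ler_pdivlMr ?mul1r// subrr !mulr0. Qed.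

(** Nine cases, according to the positions of [X] and [X + H] relative to [[0, 1]]. The constant 11
    is generous; only its independence of [X] and [H] matters. *)
Lemma clamp01_poly_remainder (X H : R) :
  `|clamp01 (X + H) ^+ 2 * (3 - 2 * clamp01 (X + H)) - clamp01 X ^+ 2 * (3 - 2 * clamp01 X)
     - 6 * (clamp01 X * (1 - clamp01 X)) * H| <= 11 * H ^+ 2.
Proof.
have H2 : 0 <= H ^+ 2 by exact: sqr_ge0.
have [[hx ->]|[hx ->]|[/andP[x0 x1] ->]] := clamp01P X;
have [[hy ->]|[hy ->]|[/andP[y0 y1] ->]] := clamp01P (X + H).
- by rewrite (_ : _ - _ - _ = 0); [rewrite normr0 mulr_ge0|ring].
- have H1 : 1 <= H by lra.
  rewrite (_ : _ - _ - _ = 1) ?normr1; last by ring.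
  have : 1 <= H ^+ 2 by rewrite exprn_ege1.
  by lra.
- have YH : (X + H) ^+ 2 <= H ^+ 2 by rewrite ler_sqr ?nnegrE; lra.
  rewrite (_ : _ - _ - _ = (X + H) ^+ 2 * (3 - 2 * (X + H))); last by ring.
  have Y2 : 0 <= (X + H) ^+ 2 by exact: sqr_ge0.
  rewrite ger0_norm; last by apply: mulr_ge0 => //; lra.
  have : (X + H) ^+ 2 * (3 - 2 * (X + H)) <= (X + H) ^+ 2 * 3 by apply: ler_wpM2l => //; lra.
  by lra.
- have H1 : 1 <= - H by lra.
  rewrite (_ : _ - _ - _ = - 1) ?normrN1; last by ring.
  have : 1 <= (- H) ^+ 2 by rewrite exprn_ege1.
  by rewrite sqrrN; lra.
- by rewrite (_ : _ - _ - _ = 0); [rewrite normr0 mulr_ge0|ring].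
- have YH : (1 - (X + H)) ^+ 2 <= H ^+ 2 by rewrite -[leRHS]sqrrN ler_sqr ?nnegrE; lra.
  rewrite (_ : _ - _ - _ = - ((1 - (X + H)) ^+ 2 * (1 + 2 * (X + H)))); last by ring.
  have Y2 : 0 <= (1 - (X + H)) ^+ 2 by exact: sqr_ge0.
  rewrite normrN ger0_norm; last by apply: mulr_ge0 => //; lra.
  have : (1 - (X + H)) ^+ 2 * (1 + 2 * (X + H)) <= (1 - (X + H)) ^+ 2 * 3 by apply: ler_wpM2l => //; lra.
  by lra.
- have XH : X ^+ 2 <= H ^+ 2 by rewrite -[leRHS]sqrrN ler_sqr ?nnegrE; lra.
  have X2 : 0 <= X ^+ 2 by exact: sqr_ge0.
  rewrite (_ : _ - _ - _ = - (X ^+ 2 * (3 - 2 * X)) + 6 * (X * (- H) * (1 - X))); last by ring.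
  have p1 : 0 <= X ^+ 2 * (3 - 2 * X) <= X ^+ 2 * 3.
    by rewrite mulr_ge0//=; [apply: ler_wpM2l => //; lra|lra].
  have p2a : X * (- H) <= (- H) * (- H) by apply: ler_wpM2r; lra.
  have p2b : 0 <= X * (- H) by apply: mulr_ge0; lra.
  have p2 : 0 <= X * (- H) * (1 - X) <= (- H) * (- H).
    apply/andP; split; first by apply: mulr_ge0 => //; lra.
    by apply: le_trans p2a; rewrite ler_piMr//; lra.
  rewrite mulrNN -expr2 in p2.
  by rewrite ler_norml; move: p1 p2 => /andP[? ?] /andP[? ?]; apply/andP; split; lra.
- have XH : (1 - X) ^+ 2 <= H ^+ 2 by rewrite ler_sqr ?nnegrE; lra.
  have X2 : 0 <= (1 - X) ^+ 2 by exact: sqr_ge0.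
  rewrite (_ : _ - _ - _ = (1 - X) ^+ 2 * (1 + 2 * X) - 6 * ((1 - X) * H * X)); last by ring.
  have p1 : 0 <= (1 - X) ^+ 2 * (1 + 2 * X) <= (1 - X) ^+ 2 * 3.
    by rewrite mulr_ge0//=; [apply: ler_wpM2l => //; lra|lra].
  have p2a : (1 - X) * H <= H * H by apply: ler_wpM2r; lra.
  have p2b : 0 <= (1 - X) * H by apply: mulr_ge0; lra.
  have p2 : 0 <= (1 - X) * H * X <= H * H.
    apply/andP; split; first by apply: mulr_ge0 => //; lra.
    by apply: le_trans p2a; rewrite ler_piMr//; lra.
  rewrite -expr2 in p2.
  by rewrite ler_norml; move: p1 p2 => /andP[? ?] /andP[? ?]; apply/andP; split; lra.
- rewrite (_ : _ - _ - _ = H ^+ 2 * (3 * (1 - 2 * X) - 2 * H)); last by ring.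
  rewrite normrM (ger0_norm H2) mulrC; apply: ler_wpM2r => //.
  by rewrite ler_norml; apply/andP; split; lra.
Qed.

Lemma theta_qderiv : qderiv theta kappa (11 / dlt ^+ 2).
Proof.
move=> a h; have := clamp01_poly_remainder (a / dlt) (h / dlt).
rewrite -mulrDl /theta /kappa.
rewrite (_ : 6 * _ * (h / dlt) = 6 / dlt * (clamp01 (a / dlt) * (1 - clamp01 (a / dlt))) * h); last first.
  by field; rewrite gt_eqF.
by rewrite (_ : 11 * (h / dlt) ^+ 2 = 11 / dlt ^+ 2 * h ^+ 2)//; field; rewrite gt_eqF.
Qed.

Lemma theta_deriv : has_deriv theta kappa.
Proof. exact: qderiv_has_deriv theta_qderiv. Qed.

Lemma kappa_cont : continuous kappa.
Proof. exact: qderiv_cont theta_qderiv. Qed.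

Lemma theta_cont : continuous theta.
Proof. exact: has_deriv_cont theta_deriv. Qed.

Lemma theta_nondecr x y : x <= y -> theta x <= theta y.
Proof.
rewrite le_eqVlt => /predU1P[->//|xy].
have [c _] := MVT xy (fun z _ => theta_deriv z) (continuous_subspaceT theta_cont).
by move=> E; rewrite -subr_ge0 E mulr_ge0 ?kappa_ge0// subr_ge0 ltW.
Qed.

Lemma has_deriv_comp_sub (f g : R -> R) x : has_deriv f g ->
  has_deriv (fun t => f (x - t)) (fun t => - g (x - t)).
Proof.
move=> fg t.
have dl : is_derive t (1 : R) (fun t : R => x - t) (- 1).
  by rewrite -[- 1]add0r; apply: is_deriveB.
have := @is_derive1_comp R f (fun t => x - t) t _ _ (fg (x - t)) dl.
by rewrite mulrN1.
Qed.

Lemma Int_kappa (a b x : R) : a <= b ->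
  \int[lebesgue_measure]_(t in `[a, b]) kappa (x - t) = theta (x - a) - theta (x - b).
Proof.
move=> ab; rewrite (FTC (F := fun t => - theta (x - t)))//.
- by ring.
- move=> t; rewrite -[kappa _]opprK; apply: is_deriveN.
  exact: (has_deriv_comp_sub x theta_deriv t).
- by apply: cont_comp; [exact: kappa_cont|apply: cont_sub; [exact: cont_cst|move=> z; exact: cvg_id]].
Qed.

End cutoff.

(** * From Brunn-Minkowski to a lower bound on the smoothed perimeter *)

Section isoperimetric.
Context {R : realType} (d : nat).
Local Notation E := 'rV[R]_d.
Local Notation mu := (lebesgue_rV d).
Local Notation leb := (@lebesgue_measure R).
Local Notation om := (@unit_ball_volume R d).
Implicit Types (u v : E -> R) (x y : E) (Om K : set E).

Definition gsq u x : R := \sum_i partial i u x ^+ 2.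
Definition gnorm u x : R := Num.sqrt (gsq u x).

Lemma gsq_ge0 u x : 0 <= gsq u x.
Proof. by apply: sumr_ge0 => i _; exact: sqr_ge0. Qed.

Lemma gnorm_sq u x : gnorm u x ^+ 2 = gsq u x.
Proof. by rewrite sqr_sqrtr// gsq_ge0. Qed.

Lemma sqrt_cont : continuous (@Num.sqrt R).
Proof. by move=> x; exact: sqrt_continuous. Qed.

Lemma gsq_bm Om u : C1c Om u -> bm (gsq u).
Proof. by move=> Cu; apply: bm_sum => i; apply: bm_exp; exact: C1c_partial_bm Cu. Qed.

Lemma gnorm_bm Om u : C1c Om u -> bm (gnorm u).
Proof. by move=> Cu; apply: bm_comp; [exact: sqrt_cont|exact: gsq_bm Cu]. Qed.

Lemma sum_CS n (a b : 'I_n -> R) :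
  `|\sum_i a i * b i| <= Num.sqrt (\sum_i a i ^+ 2) * Num.sqrt (\sum_i b i ^+ 2).
Proof.
set A := \sum_i a i ^+ 2; set B := \sum_i b i ^+ 2; set c := \sum_i a i * b i.
have A0 : 0 <= A by apply: sumr_ge0 => i _; exact: sqr_ge0.
have B0 : 0 <= B by apply: sumr_ge0 => i _; exact: sqr_ge0.
have H s : 0 <= A - 2 * s * c + s ^+ 2 * B.
  have -> : A - 2 * s * c + s ^+ 2 * B = \sum_i (a i - s * b i) ^+ 2.
    rewrite /A /B /c !mulr_sumr -sumrN -!big_split /=; apply: eq_bigr => i _; ring.
  by apply: sumr_ge0 => i _; exact: sqr_ge0.
rewrite -sqrtrM// -sqrtr_sqr ler_sqrt ?mulr_ge0//.
have [B0'|Bp] := eqVneq B 0.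
  have [->|c0] := eqVneq c 0; first by rewrite expr0n mulr_ge0.
  (* When [B = 0] the nonnegative quadratic is affine in [s], and at this [s] it would equal
     [-1]. *)
  have := H ((A + 1) / (2 * c)); rewrite B0' mulr0 addr0.
  have -> : 2 * ((A + 1) / (2 * c)) * c = A + 1 by field.
  by rewrite opprD addrA subrr sub0r lerNr oppr0 ler10.
have Bp' : 0 < B by rewrite lt_neqAle eq_sym Bp.
have := H (c / B).
have -> : A - 2 * (c / B) * c + (c / B) ^+ 2 * B = (A * B - c ^+ 2) / B by field.
by rewrite pmulr_lge0 ?invr_gt0// subr_ge0.
Qed.

(** Compactness gives uniformity on a box wider than the support by 1; for base points outside that
    box both values vanish, as [eta] is at most 1. *)
Lemma unif_cont_supp (g : E -> R) K (k : R) : compact K -> continuous g ->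
  (forall x, ~ K x -> g x = 0) -> 0 < k ->
  exists2 eta, 0 < eta & forall x y, (forall i, `|y 0 i| < eta) -> `|g (x + y) - g x| < k.
Proof.
move=> cK cg g0 k0; have [N N0 HN] := compact_rV_bounded cK.
pose B := [set x : E | forall i, `|x 0 i| <= N + 1].
have cB : compact B.
  have -> : B = [set x : E | forall i, `[- (N + 1), N + 1]%classic (x 0 i)].
    by apply/seteqP; split => x /= H i; have := H i; rewrite /= in_itv/= -ler_norml.
  apply: (@rV_compact _ _ (fun=> `[- (N + 1), N + 1]%classic)) => i.
  exact: segment_compact.
have HX x : B x -> \forall x' \near x & y \near (0 : E), `|g (x' + y) - g x'| < k.
  move=> Bx.
  have H : (fun p : E * E => g (p.1 + p.2) - g p.1) @ (x, (0 : E)) --> g (x + 0) - g x.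
    apply: cvgB; last by apply: cvg_comp; [exact: cvg_fst|exact: cg].
    apply: (@cvg_comp _ _ _ (fun p : E * E => p.1 + p.2) g _ (nbhs (x + 0))); last exact: cg.
    by apply: cvgD; [exact: cvg_fst|exact: cvg_snd].
  move: H; rewrite addr0 subrr => /cvgr0Pnorm_lt/(_ _ k0).
  by [].
have NC : \forall y \near (0 : E), B `<=` (fun x => `|g (x + y) - g x| < k).
  exact: ((compact_near_coveringP B).1 cB E (nbhs (0 : E))
    (fun y x => `|g (x + y) - g x| < k) _ HX).
move/nbhs_ballP : NC => [e /= e0 He].
exists (Num.min e 1); first by rewrite lt_min e0 ltr01.
move=> x y Hy.
have [Bx|Bx] := pselect (B x).
  apply: He => //; split => // i j; rewrite ord1 /ball /= mxE sub0r normrN.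
  by have := Hy j; rewrite lt_min => /andP[].
have nK : ~ K x by move=> /HN Kx; apply: Bx => i; rewrite (le_trans (Kx i))// lerDl.
have nK' : ~ K (x + y).
  move=> /HN Kx; apply: Bx => i; have := Kx i; rewrite mxE => h.
  have -> : x 0 i = (x 0 i + y 0 i) - y 0 i by rewrite addrK.
  rewrite (le_trans (ler_normB _ _))// lerD//.
  by have := Hy i; rewrite lt_min => /andP[_ /ltW].
by rewrite !g0// subrr normr0.
Qed.

(** The expansion is one-sided and uniform in [x], with the Euclidean length of the gradient. It
    places the enlargement of a superlevel set of [u] by a small ball inside a superlevel set of
    [u + eps * (gnorm u + k)]. *)
Lemma C1c_taylor Om u (k : R) : (0 < d)%N -> C1c Om u -> 0 < k ->
  exists2 eta, 0 < eta & forall eps, 0 < eps < eta -> forall x y, euclidean_ball 0 eps y ->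
    u (x + y) <= u x + eps * (gnorm u x + k).
Proof.
move=> d0 [du cu [K cK [KO u0]]] k0.
(* The error [k] is shared equally among the [d] coordinates. *)
have k'0 : 0 < k / d%:R by rewrite divr_gt0// ltr0n.
have H i : exists eta, 0 < eta /\ forall x y, (forall i, `|y 0 i| < eta) ->
    `|partial i u (x + y) - partial i u x| < k / d%:R.
  have [eta h1 h2] := unif_cont_supp cK (cu i) (partial_supp i cK u0) k'0.
  by exists eta.
have [eta Heta] := choice H.
exists (\big[Num.min/1]_i eta i).
  by elim/big_ind: _ => // [a b a0 b0|i _]; [rewrite lt_min a0|case: (Heta i)].
move=> eps /andP[e0 elt] x y By.
have [s /andP[s0 s1] E] := MVT_rV x y du.
have yi i : `|y 0 i| <= eps by have := euclidean_ball_bounded By i; rewrite mxE subr0.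
rewrite -lerBlDl E.
have -> : \sum_i y 0 i * partial i u (x + s *: y) =
   \sum_i y 0 i * partial i u x + \sum_i y 0 i * (partial i u (x + s *: y) - partial i u x).
  by rewrite -big_split /=; apply: eq_bigr => i _; ring.
rewrite mulrDr lerD//.
  apply: (le_trans (ler_norm _)); apply: (le_trans (sum_CS _ _)).
  rewrite ler_wpM2r ?sqrtr_ge0//; apply: ltW; move: By; rewrite /euclidean_ball /=.
  by under eq_bigr do rewrite mxE subr0.
apply: (@le_trans _ _ (\sum_(i < d) eps * (k / d%:R))); last first.
  rewrite sumr_const card_ord -[leLHS]mulr_natr -mulrA divfK//.
  by rewrite pnatr_eq0 -lt0n.
apply: ler_sum => i _; apply: (le_trans (ler_norm _)); rewrite normrM ler_pM//.
apply: ltW; apply: (Heta i).2 => j; rewrite mxE normrM gtr0_norm//.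
have ee : eps < eta i.
  apply: lt_le_trans elt _; exact: bigmin_le.
apply: le_lt_trans ee; apply: (le_trans _ (yi j)).
by rewrite ler_piMl// ltW.
Qed.

Definition radius (s : R) : R := (s / om) `^ (d%:R^-1).

Lemma radius_ge0 s : 0 <= radius s. Proof. exact: powR_ge0. Qed.

Lemma radiusX s : (0 < d)%N -> 0 <= s -> om * radius s ^+ d = s.
Proof.
move=> d0 s0; have om0 := unit_ball_volume_gt0 (R := R) d.
rewrite /radius -powR_mulrn ?powR_ge0// -powRrM mulVf ?pnatr_eq0 -?lt0n//.
by rewrite powRr1 ?divr_ge0 ?(ltW om0)// mulrC divfK// gt_eqF.
Qed.

Lemma radius_le s s' : 0 <= s <= s' -> radius s <= radius s'.
Proof.
move=> /andP[s0 ss]; have om0 := unit_ball_volume_gt0 (R := R) d.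
have s0' := le_trans s0 ss; have om0' := ltW om0.
apply: ge0_ler_powR; [by rewrite invr_ge0|by rewrite nnegrE divr_ge0|by rewrite nnegrE divr_ge0|].
by rewrite ler_wpM2r// invr_ge0.
Qed.

Lemma radius_gt0 s : 0 < s -> 0 < radius s.
Proof. by move=> s0; rewrite powR_gt0// divr_gt0// unit_ball_volume_gt0. Qed.

(** First two terms of the binomial expansion; the linear one is the surface term extracted from
    Brunn-Minkowski. *)
Lemma exprD_ge (a e : R) n : 0 <= a -> 0 <= e -> a ^+ n + n%:R * a ^+ n.-1 * e <= (a + e) ^+ n.
Proof.
move=> a0 e0; case: n => [|n]; first by rewrite !expr0 mul0r mul0r addr0.
elim: n => [|n IH] /=; first by rewrite !expr1 expr0 !mul1r.
rewrite exprSr [in leRHS]exprSr; apply: le_trans (ler_wpM2r (addr_ge0 a0 e0) IH).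
rewrite /= -subr_ge0.
rewrite (_ : _ - _ = n.+1%:R * a ^+ n * e ^+ 2).
  by rewrite mulr_ge0 ?sqr_ge0// mulr_ge0// exprn_ge0.
by rewrite [a ^+ n.+1]exprS -[n.+2%:R]natr1; ring.
Qed.

Section level_sets.
Context (Om : set E) (u : E -> R) (dlt t : R).
Hypotheses (d0 : (0 < d)%N) (mOm : measurable Om) (fOm : (mu Om < +oo)%E).
Hypotheses (Cu : C1c Om u) (dlt0 : 0 < dlt) (t0 : 0 <= t).
Local Notation th := (theta dlt).
Local Notation ka := (kappa dlt).

Lemma kappa_sub_cont : continuous (fun s : R => ka (s - t)).
Proof.
by apply: cont_comp; [exact: kappa_cont|apply: cont_sub; [move=> z; exact: cvg_id|exact: cont_cst]].
Qed.

Lemma theta_sub_deriv : has_deriv (fun s : R => th (s - t)) (fun s : R => ka (s - t)).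
Proof.
move=> s; have dl : is_derive s (1 : R) (fun z : R => z - t) 1.
  by rewrite -[X in is_derive _ _ _ X]subr0; apply: is_deriveB.
have := @is_derive1_comp R th (fun s => s - t) s _ 1 (theta_deriv dlt0 (s - t)) dl.
by rewrite mulr1.
Qed.

Lemma bm_kappa_sub : bm (fun s : measurableTypeR R => ka (s - t)).
Proof.
split; first exact: (continuous_measurable_fun kappa_sub_cont).
by exists (6 / dlt) => s; rewrite ger0_norm ?kappa_ge0 ?kappa_le.
Qed.

Lemma bm_level_measure (B : set E) (v : E -> R) : measurable B -> (mu B < +oo)%E ->
  measurable_fun setT v ->
  bm (fun s : measurableTypeR R => fine (mu (B `&` [set x | s < v x]))).
Proof.
move=> mB fB mv; pose W := [set z : E * measurableTypeR R | z.2 < v z.1].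
have mW : measurable W.
  by apply: measurable_predP; apply: measurable_fun_ltr => //; exact: (measurableT_comp mv).
have bf : bm (fun z => \1_W z : R).
  split; first exact: measurable_indic.
  by exists 1 => z; rewrite indicE; case: (_ \in _); rewrite ?normr1 ?normr0.
apply: eq_bm (bm_int_param mB fB bf) => s.
rewrite [LHS](_ : _ = \int[mu]_(x in B) \1_[set x | s < v x] x); last first.
  by apply: eq_Rintegral => x _; rewrite !indicE /W !mem_setE.
rewrite /Rintegral integral_indic// 1?setIC//.
by apply: measurable_predP; exact: measurable_fun_ltr.
Qed.

(** Write [theta] as the integral of [kappa] over the levels below [v x] and exchange the integrals.
    The function [v] is arbitrary because the formula is used both for [u] and for its first-order
    perturbation, which is only continuous. *)
Lemma theta_layer_cake (B : set E) (v : E -> R) : measurable B -> (mu B < +oo)%E ->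
  measurable_fun setT v ->
  \int[mu]_(x in B) th (v x - t) =
  \int[leb]_(s in `[t, t + dlt]) (ka (s - t) * fine (mu (B `&` [set x | s < v x]))).
Proof.
move=> mB fB mv.
pose W := [set z : measurableTypeR R * E | z.1 < v z.2].
have mW : measurable W.
  by apply: measurable_predP; apply: measurable_fun_ltr => //; exact: (measurableT_comp mv).
pose f (z : measurableTypeR R * E) : R := ka (z.1 - t) * \1_W z.
have WE s x : \1_W (s, x) = (s < v x)%R%:R :> R by rewrite indicE /W /= mem_setE.
have bf : bm f.
  split.
    apply: measurable_funM; last exact: measurable_indic.
    apply: (measurableT_comp (continuous_measurable_fun (kappa_cont dlt0))).
    by apply: measurable_funB.
  exists (6 / dlt) => z; rewrite normrM ger0_norm ?kappa_ge0// indicE.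
  by case: (_ \in _); rewrite ?normr1 ?normr0 ?mulr1 ?mulr0 ?kappa_le// divr_ge0// ltW.
have mI : measurable (`[t, t + dlt]%classic : set (measurableTypeR R)) by exact: measurable_itv.
have fI : (leb (`[t, (t + dlt)%R]%classic : set (measurableTypeR R)) < +oo)%E.
  by rewrite lebesgue_measure_itv/=; case: ifPn => _; rewrite ltry.
transitivity (\int[mu]_(x in B) \int[leb]_(s in `[t, t + dlt]) f (s, x)).
  apply: eq_Rintegral => x _; under eq_Rintegral do rewrite /f /= WE.
  have [vt|tv] := leP (v x) t.
    rewrite theta_le0 ?subr_le0//; apply/esym.
    rewrite (@eq_Rintegral _ _ _ _ _ (fun=> 0)); first by rewrite Rintegral_cst// mul0r.
    by move=> s; rewrite inE /= in_itv/= => /andP[ts _]; rewrite ltNge (le_trans vt ts) mulr0.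
  rewrite [RHS](_ : _ = \int[leb]_(s in `[t, v x[) (ka (s - t) * (s < v x)%R%:R)); last first.
    apply: eq_Int_support => s H; have [sv|] := ltP s (v x); last by rewrite mulr0.
    rewrite mulr1; have [ts|st] := leP t s; last by rewrite kappa_le0// subr_le0 ltW.
    rewrite kappa_ge//; rewrite lerBrDl leNgt; apply/negP => h; apply: H; split => /=.
      by rewrite in_itv/= ts ltW.
    by rewrite in_itv/= ts.
  have ck := kappa_sub_cont.
  rewrite [RHS](_ : _ = \int[leb]_(s in `[t, v x[) ka (s - t)); last first.
    by apply: eq_Rintegral => s; rewrite inE /= in_itv/= => /andP[_ ->]; rewrite mulr1.
  rewrite Rintegral_itv_bndo_bndc; last first.
    have mI2 : measurable (`[t, v x[%classic : set (measurableTypeR R)) by exact: measurable_itv.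
    have fI2 : (leb (`[t, v x[%classic : set (measurableTypeR R)) < +oo)%E.
      by rewrite lebesgue_measure_itv/=; case: ifPn => _; rewrite ltry.
    exact: (bm_integrable mI2 fI2 bm_kappa_sub).
  rewrite (FTC (F := fun s => th (s - t)) (ltW tv))//; last exact: theta_sub_deriv.
  by rewrite subrr (theta_le0 dlt0 (lexx 0)) subr0.
rewrite -(bm_fubini mI mB fI fB bf); apply: eq_Rintegral => s _.
have ms : measurable [set x | s < v x].
  by apply: measurable_predP; exact: measurable_fun_ltr.
have bi : bm (fun x => \1_W (s, x) : R).
  split; last by exists 1 => x; rewrite WE; case: (_ < _); rewrite ?normr1 ?normr0.
  by apply: (measurableT_comp (measurable_indic mW)); exact: measurable_fun_pair.
rewrite /f /= Int_scale//; congr (_ * _).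
rewrite (@eq_Rintegral _ _ _ _ _ (fun x => \1_[set x | s < v x] x)); last first.
  by move=> x _; rewrite WE indicE mem_setE.
by rewrite /Rintegral integral_indic// setIC.
Qed.

(** The enlargement of [{u > s}] by a ball of radius [eps] lies in the superlevel set of the
    perturbed function, so Brunn-Minkowski gives the gain. Taking the radius at the top level
    [t + dlt] makes the gain uniform over the levels in [[t, t + dlt]]. *)
Lemma level_set_bound (eps k : R) K (N : R) : 0 < eps <= 1 ->
  (forall x y, euclidean_ball 0 eps y -> u (x + y) <= u x + eps * (gnorm u x + k)) ->
  (forall x, ~ K x -> u x = 0) -> (forall x, K x -> forall i, `|x 0 i| <= N) ->
  let B := [set x : E | forall i, `|x 0 i| <= N + 1] in
  let a := fine (mu [set x | t + dlt < u x]) in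
  0 < a ->
  forall s, t <= s <= t + dlt ->
  fine (mu (B `&` [set x | s < u x])) + d%:R * om * radius a ^+ d.-1 * eps <=
  fine (mu (B `&` [set x | s < u x + eps * (gnorm u x + k)])).
Proof.
move=> /andP[e0 e1] uT u0 KN B a a0 s /andP[ts st].
have s0 : 0 <= s := le_trans t0 ts.
have mB : measurable B by exact: measurable_box.
have fB A : measurable A -> (mu (B `&` A) < +oo)%E.
  move=> mA; apply: (bounded_lebesgue_rV (measurableI _ _ mB mA) (a := N + 1)).
  by move=> x [].
have mu_ := bm_meas (C1c_bm Cu).
have mA r : measurable [set x | r < u x].
  by apply: measurable_predP; apply: measurable_fun_ltr.
have mC : measurable [set x | s < u x + eps * (gnorm u x + k)].
  apply: measurable_predP; apply: measurable_fun_ltr => //.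
  apply: measurable_funD => //; apply: measurable_funM => //.
  by apply: measurable_funD => //; exact: bm_meas (gnorm_bm Cu).
have AB r : 0 <= r -> B `&` [set x | r < u x] = [set x | r < u x].
  move=> r0; apply/seteqP; split => x; first by case.
  move=> /= rx; split => //= i.
  have Kx : K x by apply: contrapT => /u0 ux; move: rx; rewrite ux ltNge r0.
  by rewrite (le_trans (KN _ Kx i))// lerDl.
have finA r : 0 <= r -> mu [set x | r < u x] \is a fin_num.
  by move=> r0; rewrite -(AB r r0) ge0_fin_numE// fB.
set a' := fine (mu (B `&` [set x | s < u x])).
have aa' : a <= a'.
  rewrite /a /a' AB// fine_le ?finA ?addr_ge0 ?(ltW dlt0)//.
  by apply: le_measure; rewrite ?inE// => x /=; apply: le_lt_trans.
have a'0 : 0 < a' := lt_le_trans a0 aa'.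
have om0 : 0 < om := unit_ball_volume_gt0 d.
have := @brunn_minkowski_ball _ _ [set x | s < u x] (B `&` [set x | s < u x + eps * (gnorm u x + k)])
  (radius a') eps N d0 (radius_gt0 a'0) e0 (mA s) (measurableI _ _ mB mC).
have KA x : s < u x -> K x.
  by move=> sx; apply: contrapT => /u0 ux; move: sx; rewrite ux ltNge s0.
move=> /(_ (fun x sx => KN x (KA x sx))).
have Ea : mu [set x | s < u x] = (om * radius a' ^+ d)%:E.
  by rewrite radiusX ?(ltW a'0)// /a' AB// fineK// finA.
have H : (forall x y, [set x | s < u x] x -> euclidean_ball 0 eps y ->
    (B `&` [set x | s < u x + eps * (gnorm u x + k)]) (x + y)).
  move=> x y /= sx By.
  have yi i : `|y 0 i| <= 1.
    by have := euclidean_ball_bounded By i; rewrite mxE subr0 => /le_trans; apply.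
  split.
    by move=> i; rewrite mxE (le_trans (ler_normD _ _))// lerD// KN//; exact: KA.
  (* The expansion is used at [x + y] with displacement [- y], so that the gradient is evaluated at
     the new point. *)
  apply: (lt_le_trans sx); rewrite -[in leLHS](addrK y x); apply: uT.
  move: By; rewrite /euclidean_ball /=.
  by under eq_bigr do rewrite mxE subr0; under [in X in _ -> X]eq_bigr do rewrite !mxE subr0 sqrrN.
move=> /(_ Ea H) {}H.
have H2 : om * (radius a' + eps) ^+ d <= fine (mu (B `&` [set x | s < u x + eps * (gnorm u x + k)])).
  by rewrite -lee_fin fineK// ge0_fin_numE// fB.
apply: le_trans H2.
have r1 : radius a <= radius a' by apply: radius_le; rewrite (ltW a0).
apply: (@le_trans _ _ (om * (radius a' ^+ d + d%:R * radius a' ^+ d.-1 * eps))).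
  rewrite mulrDr radiusX ?(ltW a'0)// lerD2l [d%:R * om]mulrC -!mulrA ler_pM2l// !mulrA.
  by rewrite ler_pM2r// ler_wpM2l// lerXn2r ?nnegrE ?radius_ge0.
by rewrite ler_pM2l// exprD_ge ?radius_ge0 ?ltW.
Qed.

(** The left side is the perimeter of the ball whose volume [a] is that of [{u > t + dlt}]. The form
    [a / om / radius a], instead of a power [d.-1] of the radius, vanishes at [a = 0] even when
    [d = 1]. The proof compares the integrals of [theta] of [u] and of [u + eps * (gnorm u + k)]:
    from below by the volume gained, from above by the Taylor expansion of [theta], then divides by
    [eps]. *)
Lemma isoperimetric_level :
  d%:R * om * (fine (mu [set x | t + dlt < u x]) / om / radius (fine (mu [set x | t + dlt < u x])))
  <= \int[mu]_(x in Om) (ka (u x - t) * gnorm u x).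
Proof.
set a := fine _; have om0 : 0 < om := unit_ball_volume_gt0 d.
have a0 : 0 <= a by rewrite fine_ge0.
move: a0; rewrite le_eqVlt => /predU1P[<-|a0].
  rewrite !mul0r mulr0; apply: Rintegral_ge0 => x _.
  by rewrite mulr_ge0 ?kappa_ge0 ?sqrtr_ge0.
have -> : a / om / radius a = radius a ^+ d.-1.
  have Ea : a = om * radius a * radius a ^+ d.-1.
    by rewrite -mulrA -exprS prednK// radiusX// ltW.
  rewrite {1}Ea; field.
  by rewrite !gt_eqF// radius_gt0.
have [du cu [K cK [KO u0]]] := Cu.
have [N N0 KN] := compact_rV_bounded cK.
pose B := [set x : E | forall i, `|x 0 i| <= N + 1].
have mB : measurable B by exact: measurable_box.
have fB : (mu B < +oo)%E by apply: (bounded_lebesgue_rV mB (a := N + 1)).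
have KB : K `<=` B by move=> x Kx i; rewrite (le_trans (KN _ Kx i))// lerDl.
have gK x : ~ K x -> gnorm u x = 0.
  move=> nK; rewrite /gnorm /gsq big1 ?sqrtr0// => i _.
  by rewrite (partial_supp i cK u0 nK) expr0n.
have -> : \int[mu]_(x in Om) (ka (u x - t) * gnorm u x) = \int[mu]_(x in B) (ka (u x - t) * gnorm u x).
  apply: eq_Int_support => x H; rewrite gK ?mulr0// => Kx; apply: H; split; [exact: KO|exact: KB].
have bu := C1c_bm Cu; have bg := gnorm_bm Cu.
have bka : bm (fun x => ka (u x - t)).
  by apply: (bm_comp (kappa_cont dlt0)); apply: bm_sub => //; exact: bm_cst.
have bk (k : R) : bm (fun x => gnorm u x + k) by bm_tac.
set I := \int[mu]_(x in B) _; set P := d%:R * om * radius a ^+ d.-1.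
(* the increment of the theta-truncated integral, bounded above to first order *)
have step k : 0 < k -> exists2 C, 0 <= C & exists2 eta, 0 < eta & forall eps, 0 < eps < eta ->
    P <= I + k * (6 / dlt * fine (mu B)) + eps * C.
  move=> k0; have [eta eta0 Heta] := C1c_taylor d0 Cu k0.
  exists (11 / dlt ^+ 2 * \int[mu]_(x in B) ((gnorm u x + k) ^+ 2)).
    rewrite mulr_ge0 ?divr_ge0 ?sqr_ge0//.
    by apply: Rintegral_ge0 => x _; exact: sqr_ge0.
  exists (Num.min eta 1); first by rewrite lt_min eta0 ltr01.
  move=> eps /andP[e0]; rewrite lt_min => /andP[e1 e2].
  have uT := Heta eps (introT andP (conj e0 e1)).
  pose v x := u x + eps * (gnorm u x + k).
  have bv : bm v by rewrite /v; bm_tac.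
  have bth w : bm w -> bm (fun x => th (w x - t)).
    by move=> bw; apply: (bm_comp (theta_cont dlt0)); bm_tac.
  have lower : \int[mu]_(x in B) th (u x - t) + P * eps <= \int[mu]_(x in B) th (v x - t).
    rewrite (theta_layer_cake mB fB (bm_meas bu)) (theta_layer_cake mB fB (bm_meas bv)).
    have mI : measurable (`[t, t + dlt]%classic : set (measurableTypeR R)) by exact: measurable_itv.
    have fI : (leb (`[t, (t + dlt)%R]%classic : set (measurableTypeR R)) < +oo)%E.
      by rewrite lebesgue_measure_itv/=; case: ifPn => _; rewrite ltry.
    have b1 := bm_level_measure mB fB (bm_meas bu).
    have b2 := bm_level_measure mB fB (bm_meas bv).
    have b3 := bm_kappa_sub.
    have -> : P * eps = \int[leb]_(s in `[t, t + dlt]) (P * eps * ka (s - t)).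
      rewrite (Int_scale mI fI)// (FTC (F := fun s => th (s - t)) _ theta_sub_deriv kappa_sub_cont).
        by rewrite subrr (theta_le0 dlt0 (lexx 0)) addrAC subrr add0r theta_ge// subr0 mulr1.
      by rewrite lerDl ltW.
    rewrite -(Int_add mI fI); [|by bm_tac|by bm_tac].
    apply: (le_Int mI fI); [by bm_tac|by bm_tac|].
    move=> s /=; rewrite in_itv/= => sI.
    rewrite [P * eps * _]mulrC -mulrDr ler_wpM2l ?kappa_ge0//.
    by apply: (level_set_bound _ uT u0 KN) => //; rewrite e0 ltW.
  have upper : \int[mu]_(x in B) th (v x - t) <= \int[mu]_(x in B) th (u x - t)
      + eps * (I + k * \int[mu]_(x in B) ka (u x - t)) + eps ^+ 2 * (11 / dlt ^+ 2 * \int[mu]_(x in B) ((gnorm u x + k) ^+ 2)).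
    have b1 := bth _ bu; have b2 := bth _ bv; have b3 := bk k.
    rewrite /I -!(Int_scale mB fB); try by bm_tac.
    rewrite -!(Int_add mB fB); try by bm_tac.
    rewrite -!(Int_scale mB fB); try by bm_tac.
    rewrite -!(Int_add mB fB); try by bm_tac.
    apply: (le_Int mB fB); [by bm_tac|by bm_tac|] => x _.
    have := theta_qderiv dlt0 (u x - t) (eps * (gnorm u x + k)).
    rewrite (_ : u x - t + _ = v x - t); last by rewrite /v; ring.
    move=> /ler_normlW; rewrite -subr_ge0 => h; rewrite -subr_ge0.
    by apply: le_trans h _; rewrite le_eqVlt; apply/orP; left; apply/eqP; ring.
  have kaB : \int[mu]_(x in B) ka (u x - t) <= 6 / dlt * fine (mu B).
    rewrite -Rintegral_cst//; apply: (le_Int mB fB) => //; first exact: bm_cst.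
    by move=> x _; exact: kappa_le.
  have := le_trans lower upper; rewrite -addrA lerD2l expr2 -mulrA -mulrDr [P * eps]mulrC ler_pM2l//.
  by move=> h; apply: (le_trans h); rewrite lerD2r lerD2l ler_wpM2l// ltW.
apply/ler_addgt0Pr => e e0.
set M0 := 6 / dlt * fine (mu B) in step.
have M00 : 0 <= M0 by rewrite mulr_ge0 ?divr_ge0 ?(ltW dlt0)// fine_ge0.
(* First [k], then [eps], since the second-order constant [C] depends on [k]; each of the two errors
   is at most [e / 2]. *)
have k0 : 0 < e / 2 / (M0 + 1) by rewrite !divr_gt0// ltr_wpDl.
have [C C0 [eta eta0 H]] := step _ k0.
have c0 : 0 < e / 2 / (C + 1) by rewrite !divr_gt0// ltr_wpDl.
pose eps := Num.min (eta / 2) (e / 2 / (C + 1)).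
have e1 : 0 < eps by rewrite lt_min c0 divr_gt0.
have e2 : eps < eta by rewrite gt_min ltr_pdivrMr// mulrDr mulr1 ltrDl eta0.
have := H eps; rewrite e1 e2 => /(_ isT) /le_trans; apply.
rewrite -addrA lerD2l [leRHS](splitr e) lerD//.
  rewrite mulrAC ler_pdivrMr ?ltr_wpDl// ler_wpM2l ?divr_ge0 ?(ltW e0)//.
  by rewrite lerDl.
apply: (@le_trans _ _ (e / 2 / (C + 1) * C)); first by rewrite ler_wpM2r// ge_min lexx orbT.
rewrite mulrAC ler_pdivrMr ?ltr_wpDl// ler_wpM2l ?divr_ge0 ?(ltW e0)//.
by rewrite lerDl.
Qed.

End level_sets.

End isoperimetric.

(** * Level integrals *)

Section one_dim.
Context {R : realType}.
Local Notation leb := (@lebesgue_measure R).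

Lemma measurable_seg (a b : R) : measurable (`[a, b]%classic : set (measurableTypeR R)).
Proof. exact: measurable_itv. Qed.

Lemma leb_seg_lty (a b : R) : (leb (`[a, b]%classic : set (measurableTypeR R)) < +oo)%E.
Proof. by rewrite lebesgue_measure_itv/=; case: ifPn => _; rewrite ltry. Qed.

Lemma leb_seg (a b : R) : a <= b -> fine (leb (`[a, b]%classic : set (measurableTypeR R))) = b - a.
Proof.
rewrite le_eqVlt => /predU1P[->|ab]; first by rewrite set_itv1 lebesgue_measure_set1 subrr.
by rewrite lebesgue_measure_itv/= lte_fin ab.
Qed.

Lemma cont_int_seg (f : R -> R) (a b : R) : continuous f ->
  leb.-integrable `[a, b] (EFin \o f).
Proof.
move=> cf; apply: continuous_compact_integrable; first exact: segment_compact.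
exact: continuous_subspaceT.
Qed.

(** Integrals from a far left endpoint [- A], normalised to vanish at 0, do not depend on [A]; so
    [A] may grow with [|x|] and one primitive serves the whole line. *)
Lemma primitive_exists (f : R -> R) : continuous f -> exists P, has_deriv P f.
Proof.
move=> cf; pose Q A x := \int[leb]_(t in `[- A, x]) f t.
pose P (x : R) := Q (`|x| + 1) x - Q (`|x| + 1) 0.
have QB (A B x : R) : 0 < A -> A <= B -> - A < x -> Q B x - Q B 0 = Q A x - Q A 0.
  move=> A0 AB Ax.
  have H (y : R) : - A < y -> Q B y = Q B (- A) + Q A y.
    move=> Ay; have := @Rintegral_itvB _ f (BLeft (- B)) (BRight y) (- A) (cont_int_seg (- B) y cf).
    rewrite bnd_simp lerN2 bnd_simp => /(_ AB (ltW Ay)) E.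
    rewrite -[Q A y](@Rintegral_itv_obnd_cbnd _ (- A) (BRight y) f).
      by rewrite /Q -E; ring.
    by apply: integrableS (cont_int_seg (- A) y cf) => //; apply: subset_itvr; rewrite bnd_simp.
  by rewrite (H x Ax) (H 0) ?oppr_lt0//; move: (Q _ _) (Q _ _) (Q _ _) => a b c; ring.
exists P => x.
set A := `|x| + 2.
have A0 : 0 < A by rewrite ltr_wpDl.
have Ax : - A < x < A.
  by rewrite -ltr_norml /A ltr_pwDr.
have dQ : is_derive x (1 : R) (fun y => Q A y - Q A 0) (f x).
  have [||dx ex] := @continuous_FTC1 _ f (BLeft (- A)) x A _ (cont_int_seg (- A) A cf) _ (cf x).
    by case/andP: Ax.
    by case/andP: Ax => h _; rewrite /= lte_fin.
  rewrite -[f x]subr0; apply: is_deriveB.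
  by apply: (@DeriveDef _ _ _ _ _ (Q A) _ dx); rewrite -derive1E; exact: ex.
apply: (near_eq_is_derive _ dQ).
near=> y; rewrite /P.
have yA : `|y| + 1 <= A.
  rewrite /A -[2]/(1 + 1) addrA lerD2r.
  apply: (@le_trans _ _ (`|x| + `|y - x|)); first by rewrite -{1}(subrK x y) addrC ler_normD.
  by rewrite lerD2l distrC; near: y; apply: cvgr_dist_le; [exact: cvg_id|exact: ltr01].
apply: QB => //.
by rewrite -ltrNl (le_lt_trans (ler_norm _))// normrN ltrDl.
Unshelve. all: end_near. Qed.

Lemma FTC_ge0_le (f P : R -> R) (a b : R) : has_deriv P f -> a <= b ->
  (forall x, a <= x <= b -> 0 <= f x) -> P a <= P b.
Proof.
move=> Pf; rewrite le_eqVlt => /predU1P[->//|ab] f0.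
have [c cI E] := MVT ab (fun z _ => Pf z) (continuous_subspaceT (has_deriv_cont Pf)).
rewrite -subr_ge0 E mulr_ge0 ?subr_ge0 ?(ltW ab)// f0//.
by move: cI; rewrite in_itv/= => /andP[/ltW -> /ltW ->].
Qed.

Lemma bm_cont_bounded (k : R -> R) M : continuous k -> (forall x, `|k x| <= M) ->
  bm (k : measurableTypeR R -> R).
Proof. by move=> ck kM; split; [exact: continuous_measurable_fun|exists M]. Qed.

(* Gives the Hoelder modulus of continuity of the [d]-th root. *)
Lemma exprB_le (a b : R) n : 0 <= b -> b <= a -> (0 < n)%N -> (a - b) ^+ n <= a ^+ n - b ^+ n.
Proof.
move=> b0 ba; case: n => // n _; elim: n => [|n IH]; first by rewrite !expr1.
have a0 := le_trans b0 ba.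
rewrite exprS; apply: (le_trans (ler_wpM2l _ IH)); first by rewrite subr_ge0.
rewrite [a ^+ n.+2]exprS [b ^+ n.+2]exprS -subr_ge0.
rewrite (_ : _ - _ = a * b ^+ n.+1 + b * a ^+ n.+1 - 2 * (b * b ^+ n.+1)); last by ring.
rewrite subr_ge0 mulrDl mul1r lerD//.
  by rewrite ler_wpM2r// exprn_ge0.
by rewrite ler_wpM2l// lerXn2r ?nnegrE.
Qed.

(** The truncation at 0 gives a function continuous on the whole line, ready to be composed with the
    nonnegative [mud]. *)
Lemma radius_cont d : (0 < d)%N -> continuous (fun s : R => radius d (Num.max s 0)).
Proof.
move=> d0 s; apply/cvgrPdist_lt => e e0.
have om0 : 0 < unit_ball_volume d := @unit_ball_volume_gt0 R d.
have mx x : 0 <= Num.max x 0 :> R by rewrite le_max lexx orbT.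
have key a b : 0 <= b <= a -> `|a - b| < unit_ball_volume d * e ^+ d ->
    `|radius d a - radius d b| < e.
  move=> /andP[b0 ba] H; have a0 := le_trans b0 ba.
  have rab : radius d b <= radius d a by apply: radius_le; rewrite b0.
  rewrite ger0_norm ?subr_ge0// -(ltr_pXn2r (n := d)) ?nnegrE ?subr_ge0 ?(ltW e0)//.
  rewrite -(ltr_pM2l om0); apply: le_lt_trans H.
  rewrite ger0_norm ?subr_ge0// -{2}(radiusX d0 a0) -{2}(radiusX d0 b0) -mulrBr.
  by rewrite ler_pM2l// exprB_le// radius_ge0.
near=> y.
have H : `|Num.max s 0 - Num.max y 0| < unit_ball_volume d * e ^+ d.
  apply: (@le_lt_trans _ _ `|s - y|).
    have [s0|s0] := leP s 0; have [y0|y0] := leP y 0.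
    - by rewrite subrr normr0.
    - by rewrite sub0r normrN distrC !ger0_norm; lra.
    - by rewrite subr0 !ger0_norm; lra.
    - by [].
  by near: y; apply: cvgr_dist_lt; [exact: cvg_id|rewrite mulr_gt0// exprn_gt0].
have [h|/ltW h] := leP (Num.max y 0) (Num.max s 0).
  by apply: key => //; rewrite mx.
by rewrite distrC; apply: key; rewrite ?mx// distrC.
Unshelve. all: end_near. Qed.

End one_dim.

(** * Smoothed distribution function, perimeter and energy of the levels of [u] *)

Section levels.
Context {R : realType} (d : nat).
Local Notation E := 'rV[R]_d.
Local Notation mu := (lebesgue_rV d).
Local Notation leb := (@lebesgue_measure R).
Local Notation om := (@unit_ball_volume R d).
Context (Om : set E) (u : E -> R) (dlt : R).
Hypotheses (d0 : (0 < d)%N) (mOm : measurable Om) (fOm : (mu Om < +oo)%E).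
Hypotheses (Cu : C1c Om u) (dlt0 : 0 < dlt).
Local Notation th := (theta dlt).
Local Notation ka := (kappa dlt).
Local Notation V := (fine (mu Om)).

Let V0 : 0 <= V. Proof. exact: fine_ge0. Qed.

(* [lev theta 1] is a smoothed distribution function of [u], [- lev kappa 1] its
   derivative, and [lev kappa (gnorm u)] a smoothed perimeter of [{u > t}]. *)
Definition lev (k : R -> R) (w : E -> R) (t : R) := \int[mu]_(x in Om) (k (u x - t) * w x).
Local Notation mud := (lev th (fun=> 1)).
Local Notation Dd := (lev ka (fun=> 1)).
Local Notation Ed := (lev ka (gsq u)).
Local Notation Sd := (lev ka (gnorm u)).

Lemma theta_bound x : `|th x| <= 1.
Proof. by have /andP[h1 h2] := theta_itv dlt x; rewrite ger0_norm. Qed.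

Lemma kappa_bound x : `|ka x| <= 6 / dlt.
Proof. by rewrite ger0_norm ?kappa_ge0 ?kappa_le. Qed.

Section fub.
Variables (k : R -> R) (M : R) (w : E -> R).
Hypotheses (ck : continuous k) (kM : forall x, `|k x| <= M) (bw : bm w).

Let bmf (g : measurableTypeR R -> R) : bm g ->
  bm (fun z : measurableTypeR R * E => g z.1 * (k (u z.2 - z.1) * w z.2)).
Proof.
move=> bg.
have b1 : bm (fun z : measurableTypeR R * E => g z.1).
  by case: bg => mg [N HN]; split; [exact: (measurableT_comp mg)|exists N].
have b2 : bm (fun z : measurableTypeR R * E => w z.2).
  by case: bw => mg [N HN]; split; [exact: (measurableT_comp mg)|exists N].
have b3 : bm (fun z : measurableTypeR R * E => k (u z.2 - z.1)).
  split; last by exists M.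
  apply: (measurableT_comp (continuous_measurable_fun ck)).
  by apply: measurable_funB => //; apply: (measurableT_comp (bm_meas (C1c_bm Cu))).
by bm_tac.
Qed.

Let bmf' (g : measurableTypeR R -> R) : bm g ->
  bm (fun z : E * measurableTypeR R => g z.2 * (k (u z.1 - z.2) * w z.1)).
Proof.
move=> /bmf [mf [N HN]]; split; last by exists N => z; exact: (HN (z.2, z.1)).
have := measurableT_comp mf (@measurable_swap _ _ E (measurableTypeR R)).
by [].
Qed.

Lemma bm_lev : bm (lev k w : measurableTypeR R -> R).
Proof.
have := bm_int_param mOm fOm (bmf' (bm_cst _ 1)).
apply: eq_bm => t; rewrite /lev; apply: eq_Rintegral => x _.
by rewrite mul1r.
Qed.

Lemma lev_fubini (g : measurableTypeR R -> R) a b : bm g ->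
  \int[leb]_(t in `[a, b]) (g t * lev k w t) =
  \int[mu]_(x in Om) ((\int[leb]_(t in `[a, b]) (g t * k (u x - t))) * w x).
Proof.
move=> bg; have := bm_fubini (measurable_seg a b) mOm (leb_seg_lty a b) fOm (bmf bg).
have bkx x : bm (fun t : measurableTypeR R => k (u x - t)).
  split; last by exists M.
  apply: (continuous_measurable_fun); apply: cont_comp => //.
  by apply: cont_sub; [exact: cont_cst|move=> z; exact: cvg_id].
have bkt t : bm (fun x => k (u x - t)).
  apply: (bm_comp ck); apply: bm_sub; [exact: C1c_bm Cu|exact: bm_cst].
move=> H; transitivity (\int[leb]_(t in `[a, b]) \int[mu]_(x in Om) (g t * (k (u x - t) * w x))).
  apply: eq_Rintegral => t _; rewrite /lev -(Int_scale mOm fOm)//; have := bkt t; move=> ?; by bm_tac.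
rewrite H; apply: eq_Rintegral => x _ /=.
rewrite [RHS]mulrC -(Int_scale (measurable_seg a b) (leb_seg_lty a b)); last by bm_tac.
by apply: eq_Rintegral => t _; ring.
Qed.

End fub.

Lemma bm_gsq : bm (gsq u). Proof. exact: gsq_bm Cu. Qed.
Lemma bm_gnorm : bm (gnorm u). Proof. exact: gnorm_bm Cu. Qed.
Lemma bm_mud : bm (mud : measurableTypeR R -> R).
Proof. by apply: bm_lev theta_bound (bm_cst _ 1); exact: theta_cont. Qed.
Lemma bm_Dd : bm (Dd : measurableTypeR R -> R).
Proof. by apply: bm_lev kappa_bound (bm_cst _ 1); exact: kappa_cont. Qed.
Lemma bm_Ed : bm (Ed : measurableTypeR R -> R).
Proof. by apply: bm_lev kappa_bound bm_gsq; exact: kappa_cont. Qed.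
Lemma bm_Sd : bm (Sd : measurableTypeR R -> R).
Proof. by apply: bm_lev kappa_bound bm_gnorm; exact: kappa_cont. Qed.

Lemma bm_th_u t : bm (fun x => th (u x - t)).
Proof. by apply: (bm_comp (theta_cont dlt0)); apply: bm_sub; [exact: C1c_bm Cu|exact: bm_cst]. Qed.
Lemma bm_ka_u t : bm (fun x => ka (u x - t)).
Proof. by apply: (bm_comp (kappa_cont dlt0)); apply: bm_sub; [exact: C1c_bm Cu|exact: bm_cst]. Qed.

Lemma mud_itv t : 0 <= mud t <= V.
Proof.
apply/andP; split.
  by apply: Rintegral_ge0 => x _; rewrite mulr1; case/andP: (theta_itv dlt (u x - t)).
have -> : V = \int[mu]_(x in Om) 1 by rewrite Rintegral_cst// mul1r.
apply: (le_Int mOm fOm); [by have := bm_th_u t => ?; bm_tac|exact: bm_cst|].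
by move=> x _; rewrite mulr1; case/andP: (theta_itv dlt (u x - t)).
Qed.

Lemma mud_nincr t s : t <= s -> mud s <= mud t.
Proof.
move=> ts; have h1 := bm_th_u t; have h2 := bm_th_u s.
apply: (le_Int mOm fOm); [by bm_tac|by bm_tac|].
by move=> x _; rewrite !mulr1 theta_nondecr// lerD2l lerN2.
Qed.

Lemma mud_qderiv : qderiv mud (fun t => - Dd t) (1 * (11 / dlt ^+ 2) * V).
Proof.
have b1 tau : bm (fun x => th (u x + tau)) by have := bm_th_u (- tau); rewrite opprK.
have b2 tau : bm (fun x => ka (u x + tau)) by have := bm_ka_u (- tau); rewrite opprK.
have h1 y : Om y -> `|1 : R| <= 1 by rewrite normr1.
have := qderiv_opp (qderiv_int mOm fOm (theta_qderiv dlt0) b1 b2 (bm_cst _ 1) h1).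
congr qderiv; apply/funext => t; rewrite /lev; last congr (- _).
  by apply: eq_Rintegral => x _; rewrite mul1r mulr1.
by apply: eq_Rintegral => x _; rewrite mul1r mulr1.
Qed.

(** With [level_measure_le], the volume of [{u > t + dlt}] is enclosed between [mud (t + dlt)] and
    [mud t], because [theta] vanishes left of 0 and equals 1 beyond [dlt]. This is where the shift
    by [dlt] in the later inequalities comes from. *)
Lemma level_measure_ge t : 0 <= t -> mud (t + dlt) <= fine (mu [set x | t + dlt < u x]).
Proof.
move=> t0; set A := [set x | _]; have bth := bm_th_u (t + dlt).
have mA : measurable A.
  by apply: measurable_predP; apply: measurable_fun_ltr => //; exact: bm_meas (C1c_bm Cu).
have AO : A `<=` Om.
  move=> x; apply: contraPP => /(C1c_out Cu) ux; rewrite /A /= ux => h.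
  by have := lt_trans h; move/(_ _ (ltr_wpDl t0 dlt0)); rewrite ltxx.
have fA : (mu A < +oo)%E by apply: le_lt_trans fOm; apply: le_measure; rewrite ?inE.
have -> : mud (t + dlt) = \int[mu]_(x in A) th (u x - (t + dlt)).
  rewrite /lev; under eq_Rintegral do rewrite mulr1.
  apply: eq_Int_support => x H; apply: theta_le0 => //; rewrite subr_le0 leNgt.
  by apply/negP => h; apply: H; split => //; exact: AO.
have -> : fine (mu A) = \int[mu]_(x in A) 1 by rewrite Rintegral_cst// mul1r.
apply: (le_Int mA fA) => //; first exact: bm_cst.
by move=> x _; case/andP: (theta_itv dlt (u x - (t + dlt))).
Qed.

Lemma level_measure_fin t : 0 <= t -> (mu [set x | (t + dlt < u x)%R] < +oo)%E.
Proof.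
move=> t0; set A := [set x | _].
have mA : measurable A.
  by apply: measurable_predP; apply: measurable_fun_ltr => //; exact: bm_meas (C1c_bm Cu).
apply: le_lt_trans fOm; apply: le_measure; rewrite ?inE// => x.
apply: contraPP => /(C1c_out Cu) ux; rewrite /A /= ux => h.
by have := lt_trans h; move/(_ _ (ltr_wpDl t0 dlt0)); rewrite ltxx.
Qed.

Lemma level_measure_le t : 0 <= t -> fine (mu [set x | t + dlt < u x]) <= mud t.
Proof.
move=> t0; set A := [set x | _]; have bth := bm_th_u t; have fA := level_measure_fin t0.
have mA : measurable A.
  by apply: measurable_predP; apply: measurable_fun_ltr => //; exact: bm_meas (C1c_bm Cu).
have -> : fine (mu A) = \int[mu]_(x in A) 1 by rewrite Rintegral_cst// mul1r.
apply: (@le_trans _ _ (\int[mu]_(x in A) th (u x - t))).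
  apply: (le_Int mA fA) => //; first exact: bm_cst.
  by move=> x Ax; rewrite theta_ge// lerBrDl ltW.
have -> : mud t = \int[mu]_(x in Om) th (u x - t).
  by rewrite /lev; under eq_Rintegral do rewrite mulr1.
have AO : A `<=` Om.
  move=> x; apply: contraPP => /(C1c_out Cu) ux; rewrite /A /= ux => h.
  by have := lt_trans h; move/(_ _ (ltr_wpDl t0 dlt0)); rewrite ltxx.
rewrite /Rintegral fine_le//.
- by apply: integrable_fin_num => //; exact: (bm_integrable mA fA).
- by apply: integrable_fin_num => //; exact: (bm_integrable mOm fOm).
- apply: ge0_subset_integral => //.
  + by apply/measurable_EFinP; apply: (@measurable_funS _ _ _ _ setT) => //; exact: bm_meas.
  + by move=> x _; rewrite lee_fin; case/andP: (theta_itv dlt (u x - t)).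
Qed.

Let om0 : 0 < om. Proof. exact: unit_ball_volume_gt0. Qed.
Let dp : 0 < d%:R :> R. Proof. by rewrite ltr0n. Qed.

(** The isoperimetric inequality with the radius cleared. Any upper bound [b] of the radius is
    allowed: [level_ineq] takes the radius of the level itself, [mud_le_surface] that of the whole
    domain. *)
Lemma surface_ge t b : 0 <= t -> radius d (mud t) <= b ->
  d%:R * mud (t + dlt) <= b * Sd t.
Proof.
move=> t0 rb; set a := fine (mu [set x | t + dlt < u x]).
have a0 : 0 <= a by exact: fine_ge0.
have am : mud (t + dlt) <= a := level_measure_ge t0.
have b0 : 0 <= b := le_trans (radius_ge0 _ _) rb.
have S0 : 0 <= Sd t by apply: Rintegral_ge0 => x _; rewrite mulr_ge0 ?kappa_ge0 ?sqrtr_ge0.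
apply: (@le_trans _ _ (d%:R * a)); first by rewrite ler_pM2l.
have [->|an] := eqVneq a 0; first by rewrite mulr0 mulr_ge0.
have ap : 0 < a by rewrite lt_neqAle eq_sym an.
have rap := radius_gt0 d ap.
have rab : radius d a <= b.
  by apply: le_trans rb; apply: radius_le; rewrite a0; exact: level_measure_le.
have := isoperimetric_level d0 Cu dlt0 t0; rewrite -/a => H.
apply: (@le_trans _ _ (radius d a * Sd t)); last by rewrite ler_wpM2r.
apply: le_trans (ler_wpM2l (ltW rap) H).
by rewrite le_eqVlt; apply/orP; left; apply/eqP; field; rewrite !gt_eqF.
Qed.

(** Integrate [ka * (b / d - |grad u|) ^ 2 >= 0]. The comparison value [b / d] is the length of the
    gradient on the sphere of radius [b] when [-Lap u = 1] on a ball, so nothing is lost in the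
    model case. *)
Lemma level_ineq t : 0 <= t ->
  2 * mud (t + dlt) <= radius d (mud t) ^+ 2 / d%:R ^+ 2 * Dd t + Ed t.
Proof.
move=> t0; have := surface_ge t0 (lexx _); set b := radius d _ => H.
have ba := bm_ka_u t; have bg := bm_gnorm; have bs := bm_gsq.
have : 2 * (b / d%:R) * Sd t <= (b / d%:R) ^+ 2 * Dd t + Ed t.
  rewrite -!(Int_scale mOm fOm) -?(Int_add mOm fOm); try by bm_tac.
  apply: (le_Int mOm fOm); try by bm_tac.
  move=> x _; rewrite mulr1 -gnorm_sq -subr_ge0.
  rewrite (_ : _ - _ = ka (u x - t) * (b / d%:R - gnorm u x) ^+ 2); last by ring.
  by rewrite mulr_ge0 ?kappa_ge0 ?sqr_ge0.
rewrite expr_div_n; apply: le_trans.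
by rewrite -!mulrA ler_pM2l// mulrCA mulrC ler_pdivlMr// mulrC.
Qed.

Lemma mud_le_surface t : 0 <= t -> mud (t + dlt) <= radius d V / d%:R * Sd t.
Proof.
move=> t0; rewrite mulrAC ler_pdivlMr// mulrC; apply: surface_ge => //.
by apply: radius_le; exact: mud_itv.
Qed.

Lemma mud_cont : continuous (mud : R -> R).
Proof. exact: has_deriv_cont (qderiv_has_deriv mud_qderiv). Qed.

Lemma Dd_cont : continuous (Dd : R -> R).
Proof.
have := cont_opp (qderiv_cont mud_qderiv).
by rewrite (_ : (fun x => - - Dd x) = Dd)//; apply/funext => t; rewrite opprK.
Qed.

(** Telescoping: up to a term of favourable sign, the shifted integral only loses the piece over
    [[0, dlt]], where [mud <= V]. *)
Lemma mud_shift T : 0 <= T ->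
  \int[leb]_(t in `[0, T]) (mud t - mud (t + dlt)) <= dlt * V.
Proof.
move=> T0; have [P dP] := primitive_exists mud_cont.
have cs : continuous (fun t : R => mud (t + dlt)).
  by apply: (cont_comp mud_cont); apply: cont_add; [move=> z; exact: cvg_id|exact: cont_cst].
have dPs : has_deriv (fun t => P (t + dlt)) (fun t => mud (t + dlt)).
  move=> t; have dl : is_derive t (1 : R) (fun t : R => t + dlt) 1.
    by rewrite -[X in is_derive _ _ _ X]addr0; apply: is_deriveD.
  by have := @is_derive1_comp R P (fun t => t + dlt) t _ _ (dP (t + dlt)) dl; rewrite mulr1.
rewrite (@FTC _ _ (fun t => P t - P (t + dlt)))//; last 2 first.
- by move=> t; apply: is_deriveB; [exact: dP|exact: dPs].
- by apply: cont_sub => //; exact: mud_cont.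
rewrite add0r.
have h1 : P T <= P (T + dlt).
  by apply: (FTC_ge0_le dP) => [|x _]; [rewrite lerDl ltW|case/andP: (mud_itv x)].
have h2 : V * 0 - P 0 <= V * dlt - P dlt.
  apply: (@FTC_ge0_le _ (fun t => V - mud t) (fun t => V * t - P t)) => [t||t _].
  - apply: is_deriveB; last exact: dP.
    by rewrite -[X in is_derive _ _ _ X]mulr1; exact: is_deriveZ.
  - exact: ltW.
  - by rewrite subr_ge0; case/andP: (mud_itv t).
by move: h1 h2; rewrite mulr0; lra.
Qed.

Section weights.
Variables (g : measurableTypeR R -> R) (T M : R).
Hypotheses (bg : bm g) (T0 : 0 <= T) (gM : forall t, 0 <= t <= T -> 0 <= g t <= M).
(** A smoothed primitive of the weight [g] in the level variable, with derivative [hw]. The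
    compositions [Hw (u x)] are admissible test functions, and Fubini turns their integrals into
    integrals over levels with weight [g]. *)
Definition Hw (tau : R) := \int[leb]_(t in `[0, T]) (g t * th (tau - t)).
Definition hw (tau : R) := \int[leb]_(t in `[0, T]) (g t * ka (tau - t)).

Let bth tau : bm (fun t : measurableTypeR R => th (tau - t)).
Proof.
apply: (bm_cont_bounded _ (M := 1)); last by move=> x; exact: theta_bound.
by apply: (cont_comp (theta_cont dlt0)); apply: cont_sub; [exact: cont_cst|move=> z; exact: cvg_id].
Qed.

Let bka tau : bm (fun t : measurableTypeR R => ka (tau - t)).
Proof.
apply: (bm_cont_bounded _ (M := 6 / dlt)); last by move=> x; exact: kappa_bound.
by apply: (cont_comp (kappa_cont dlt0)); apply: cont_sub; [exact: cont_cst|move=> z; exact: cvg_id].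
Qed.

Let mT := measurable_seg 0 T.
Let fT := leb_seg_lty 0 T.

Lemma Hw_qderiv : qderiv Hw hw (M * (11 / dlt ^+ 2) * fine (leb (`[0, T]%classic : set (measurableTypeR R)))).
Proof.
have b1 tau : bm (fun t : measurableTypeR R => th (- t + tau)).
  by have := bth tau; apply: eq_bm => t; rewrite addrC.
have b2 tau : bm (fun t : measurableTypeR R => ka (- t + tau)).
  by have := bka tau; apply: eq_bm => t; rewrite addrC.
have gM' t : [set` `[0, T]] t -> `|g t| <= M.
  by rewrite /= in_itv /= => /gM /andP[g0 g1]; rewrite ger0_norm.
have E1 : Hw = fun tau => \int[leb]_(t in `[0, T]) (g t * th (- t + tau)).
  by apply/funext => tau; apply: eq_Rintegral => x _; rewrite [- x + _]addrC.
have E2 : hw = fun tau => \int[leb]_(t in `[0, T]) (g t * ka (- t + tau)).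
  by apply/funext => tau; apply: eq_Rintegral => x _; rewrite [- x + _]addrC.
by rewrite E1 E2; exact: qderiv_int mT fT (theta_qderiv dlt0) b1 b2 bg gM'.
Qed.

Lemma Hw_deriv : has_deriv Hw hw. Proof. exact: qderiv_has_deriv Hw_qderiv. Qed.
Lemma hw_cont : continuous hw. Proof. exact: qderiv_cont Hw_qderiv. Qed.
Lemma Hw_cont : continuous Hw. Proof. exact: has_deriv_cont Hw_deriv. Qed.

Lemma Hw_le0 tau : tau <= 0 -> Hw tau = 0.
Proof.
move=> t0; transitivity (\int[leb]_(t in `[0, T]) (0 : R)).
  apply: eq_Rintegral => t; rewrite inE /= in_itv /= => /andP[h _].
  by rewrite theta_le0 ?mulr0//; lra.
by rewrite Rintegral_cst// mul0r.
Qed.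

Lemma hw_itv tau : 0 <= hw tau <= M.
Proof.
have M0 : 0 <= M by have /andP[h1 h2] := gM (introT andP (conj (lexx 0) T0)); exact: le_trans h1 h2.
apply/andP; split.
  apply: Rintegral_ge0 => t; rewrite /= in_itv /= => /gM /andP[g0 _].
  by rewrite mulr_ge0 ?kappa_ge0.
apply: (@le_trans _ _ (\int[leb]_(t in `[0, T]) (M * ka (tau - t)))).
  have b1 := bka tau; apply: (le_Int mT fT); try by bm_tac.
  by move=> t; rewrite /= in_itv /= => /gM /andP[_ g1]; rewrite ler_wpM2r ?kappa_ge0.
rewrite (Int_scale mT fT)// Int_kappa// ler_piMr//.
have /andP[_ h1] := theta_itv dlt (tau - 0); have /andP[h2 _] := theta_itv dlt (tau - T).
by lra.
Qed.

Lemma Hw_C1c : C1c Om (fun x => Hw (u x)) /\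
  forall i x, partial i (fun x => Hw (u x)) x = hw (u x) * partial i u x.
Proof. by apply: C1c_comp => //; [exact: Hw_deriv|exact: hw_cont|exact: Hw_le0]. Qed.

Lemma Int_hw (w : E -> R) : bm w ->
  \int[mu]_(x in Om) (hw (u x) * w x) = \int[leb]_(t in `[0, T]) (g t * lev ka w t).
Proof. by move=> bw; rewrite (lev_fubini (kappa_cont dlt0) kappa_bound bw). Qed.

Lemma Int_Hw (w : E -> R) : bm w ->
  \int[mu]_(x in Om) (Hw (u x) * w x) = \int[leb]_(t in `[0, T]) (g t * lev th w t).
Proof. by move=> bw; rewrite (lev_fubini (theta_cont dlt0) theta_bound bw). Qed.

End weights.
End levels.

(** * Comparison at the level of test functions *)

Section continuous_min_max.
Context {R : realType} (T : topologicalType).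
Implicit Types f g : T -> R.

Lemma cont_norm f : continuous f -> continuous (fun x => `|f x|).
Proof. by move=> cf x; apply: continuous_comp; [exact: cf|exact: norm_continuous]. Qed.

Lemma cont_min f g : continuous f -> continuous g -> continuous (fun x => Num.min (f x) (g x)).
Proof.
move=> cf cg; rewrite (_ : (fun _ => _) = fun x => (f x + g x - `|f x - g x|) * 2^-1).
  apply: cont_mul; last exact: cont_cst.
  by apply: cont_sub; [exact: cont_add|exact/cont_norm/cont_sub].
by apply/funext => x; rewrite minr_absE.
Qed.

Lemma cont_max f g : continuous f -> continuous g -> continuous (fun x => Num.max (f x) (g x)).
Proof.
move=> cf cg; rewrite (_ : (fun _ => _) = fun x => (f x + g x + `|f x - g x|) * 2^-1).
  apply: cont_mul; last exact: cont_cst.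
  by apply: cont_add; [exact: cont_add|exact/cont_norm/cont_sub].
by apply/funext => x; rewrite maxr_absE.
Qed.

End continuous_min_max.

(** * Near-minimisers of the Dirichlet energy and comparison of their levels *)

Section torsion_energy.
Context {R : realType} (d : nat).
Local Notation E := 'rV[R]_d.
Local Notation mu := (lebesgue_rV d).
Local Notation leb := (@lebesgue_measure R).
Local Notation om := (@unit_ball_volume R d).
Context (Om : set E).
Hypotheses (d0 : (0 < d)%N) (mOm : measurable Om) (fOm : (mu Om < +oo)%E).
Local Notation V := (fine (mu Om)).
Local Notation r := (radius d V).

Let V0 : 0 <= V. Proof. exact: fine_ge0. Qed.
Let dp : 0 < d%:R :> R. Proof. by rewrite ltr0n. Qed.
Let r0 : 0 <= r. Proof. exact: radius_ge0. Qed.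
Let rd0 : 0 <= r / d%:R. Proof. by rewrite divr_ge0. Qed.

Definition gdot (u v : E -> R) x := \sum_i partial i u x * partial i v x.

Lemma le_Int_comb (f g h : E -> R) (a b : R) : bm f -> bm g -> bm h ->
  (forall x, 2 * f x <= a * g x + b * h x) ->
  2 * \int[mu]_(x in Om) f x <= a * \int[mu]_(x in Om) g x + b * \int[mu]_(x in Om) h x.
Proof.
move=> bf bg bh H; rewrite -!(Int_scale mOm fOm)// -(Int_add mOm fOm); try by bm_tac.
by apply: (le_Int mOm fOm) => //; bm_tac.
Qed.

Lemma gdot_bm (u v : E -> R) : C1c Om u -> C1c Om v -> bm (gdot u v).
Proof.
move=> Cu Cv; apply: bm_sum => i.
by apply: bm_mul; [exact: C1c_partial_bm Cu|exact: C1c_partial_bm Cv].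
Qed.

Lemma gsq_add_scale (u v : E -> R) s x : differentiable u x -> differentiable v x ->
  gsq (fun y => u y + s * v y) x = gsq u x + (2 * s * gdot u v x + s ^+ 2 * gsq v x).
Proof.
move=> du dv; rewrite /gsq /gdot !mulr_sumr -!big_split /=; apply: eq_bigr => i _.
by rewrite partial_add ?partial_scale//; [ring|exact: differentiable_scale].
Qed.

Section fixed_function.
Context (u : E -> R) (dlt T : R).
Hypotheses (Cu : C1c Om u) (dlt0 : 0 < dlt) (T0 : 0 <= T).
Local Notation th := (theta dlt).
Local Notation ka := (kappa dlt).
Local Notation mud := (lev Om u th (fun=> 1)).
Local Notation Sd := (lev Om u ka (gnorm u)).
Let mT := measurable_seg 0 T.
Let fT := leb_seg_lty 0 T.
Let one_itv : forall t : R, 0 <= t <= T -> 0 <= (1 : R) <= 1.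
Proof. by move=> t _; rewrite ler01 lexx. Qed.

(** For the unit weight, [Hw] is nonnegative and has slope exactly 1 between [dlt] and [T], so it
    lags behind the identity by at most [dlt]. *)
Lemma Hw1_ge x : x <= T -> x - dlt <= Hw dlt (fun=> 1) T x.
Proof.
move=> xT; have H0 y : 0 <= Hw dlt (fun=> 1) T y.
  by apply: Rintegral_ge0 => t _; rewrite mul1r; case/andP: (theta_itv dlt (y - t)).
have [xd|/ltW dx] := leP x dlt; first by rewrite (le_trans _ (H0 x))// subr_le0.
have dH := Hw_deriv dlt0 (bm_cst _ (1 : R)) one_itv.
have : Hw dlt (fun=> 1) T dlt - dlt <= Hw dlt (fun=> 1) T x - x.
  apply: (@FTC_ge0_le _ (fun t => hw dlt (fun=> 1) T t - 1) (fun t => Hw dlt (fun=> 1) T t - t)) => //.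
    by move=> t; apply: is_deriveB; exact: dH.
  move=> t /andP[dt tx]; rewrite /hw; under eq_Rintegral do rewrite mul1r.
  rewrite Int_kappa// subr0 theta_ge// theta_le0 ?subr0 ?subrr//.
  by rewrite subr_le0 (le_trans tx).
by have := H0 dlt; lra.
Qed.

Lemma mud_int_ge : (forall x, u x <= T) ->
  \int[mu]_(x in Om) u x <= dlt * V + \int[leb]_(t in `[0, T]) mud t.
Proof.
move=> uT; have bu := C1c_bm Cu.
have bH : bm (fun x => Hw dlt (fun=> 1) T (u x)).
  by apply: (bm_comp (Hw_cont dlt0 (bm_cst _ (1 : R)) one_itv)).
have E1 : \int[leb]_(t in `[0, T]) mud t = \int[mu]_(x in Om) Hw dlt (fun=> 1) T (u x).
  transitivity (\int[leb]_(t in `[0, T]) (1 * mud t)).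
    by apply: eq_Rintegral => t _; rewrite mul1r.
  rewrite -(Int_Hw mOm fOm Cu dlt0 T (bm_cst _ (1 : R)) (bm_cst _ (1 : R))).
  by apply: eq_Rintegral => x _; rewrite mulr1.
have -> : dlt * V = \int[mu]_(x in Om) dlt by rewrite Rintegral_cst.
rewrite E1 -(Int_add mOm fOm)//; last exact: bm_cst.
apply: (le_Int mOm fOm) => //; first by bm_tac.
by move=> x _; rewrite -lerBlDl Hw1_ge.
Qed.

(** Isoperimetry at the fixed radius [r], integrated over the levels: together with [mud_int_ge] it
    bounds the integral of [u] by that of its gradient. *)
Lemma mud_int_le : \int[leb]_(t in `[0, T]) mud t <=
  dlt * V + r / d%:R * \int[mu]_(x in Om) gnorm u x.
Proof.
have bm1 := bm_mud mOm fOm Cu dlt0; have bS := bm_Sd mOm fOm Cu dlt0.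
have bms : bm (fun t : measurableTypeR R => mud (t + dlt)).
  apply: (bm_cont_bounded _ (M := V)) => [|x].
    apply: (cont_comp (mud_cont mOm fOm Cu dlt0)).
    by apply: cont_add; [move=> z; exact: cvg_id|exact: cont_cst].
  by have /andP[h1 h2] := mud_itv mOm fOm Cu dlt0 (x + dlt); rewrite ger0_norm.
have := mud_shift mOm fOm Cu dlt0 T0; rewrite (Int_sub mT fT)//.
have H : \int[leb]_(t in `[0, T]) mud (t + dlt) <= \int[leb]_(t in `[0, T]) (r / d%:R * Sd t).
  apply: (le_Int mT fT) => //; first exact: bm_scale.
  by move=> t; rewrite /= in_itv /= => /andP[t0 _]; exact: mud_le_surface.
have H2 : \int[leb]_(t in `[0, T]) (r / d%:R * Sd t) <= r / d%:R * \int[mu]_(x in Om) gnorm u x.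
  rewrite (Int_scale mT fT)// ler_wpM2l//.
  have bg := bm_gnorm Cu.
  have -> : \int[leb]_(t in `[0, T]) Sd t = \int[mu]_(x in Om) (hw dlt (fun=> 1) T (u x) * gnorm u x).
    rewrite (Int_hw mOm fOm Cu dlt0 T (bm_cst _ (1 : R)) bg).
    by apply: eq_Rintegral => t _; rewrite mul1r.
  have bh : bm (fun x => hw dlt (fun=> 1) T (u x)).
    by apply: (bm_comp (hw_cont dlt0 (bm_cst _ (1 : R)) one_itv)); exact: C1c_bm Cu.
  apply: (le_Int mOm fOm) => //; first exact: bm_mul.
  move=> x _; rewrite ler_piMl ?sqrtr_ge0//.
  by have /andP[] := hw_itv dlt0 (bm_cst _ (1 : R)) T0 one_itv (u x).
by rewrite lerBlDr => h; apply: (le_trans h); rewrite lerD2l; exact: le_trans H H2.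
Qed.

End fixed_function.

(** The constant of [poincare] at smoothing width 1: each of the two shifts costs [V], and AM-GM
    gives the last term. It bounds the energy [J] below, and [gradient_bound] follows from
    [J u <= 1], as [J u] is at least a quarter of the Dirichlet integral minus [energy_lb]. *)
Definition energy_lb := 2 * V + (r / d%:R) ^+ 2 * V.
Definition gradient_bound := 4 * (1 + energy_lb).

Lemma poincare u : C1c Om u ->
  \int[mu]_(x in Om) u x <= 4^-1 * (\int[mu]_(x in Om) gsq u x) + energy_lb.
Proof.
move=> Cu; have [N N0 HN] := bm_bound (C1c_bm Cu).
have uN x : u x <= N by exact: le_trans (ler_norm _) (HN x).
have h1 := mud_int_ge Cu ltr01 N0 uN; have h2 := mud_int_le Cu ltr01 N0.
have bs := bm_gsq Cu; have bg := bm_gnorm Cu.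
have h3 : r / d%:R * \int[mu]_(x in Om) gnorm u x <=
   4^-1 * \int[mu]_(x in Om) gsq u x + (r / d%:R) ^+ 2 * V.
  rewrite -(Rintegral_cst _ mOm) -!(Int_scale mOm fOm)// -(Int_add mOm fOm); try by bm_tac.
  apply: (le_Int mOm fOm); try by bm_tac.
  move=> x _; rewrite -gnorm_sq -subr_ge0; move: (gnorm u x) (r / d%:R) => g a.
  by rewrite (_ : _ - _ = (2^-1 * g - a) ^+ 2) ?sqr_ge0//; field.
by rewrite /energy_lb; lra.
Qed.

(* The Euler-Lagrange equation [- Lap u = 1], up to an error controlled
   by the Dirichlet integral of the test function. *)
Definition near_critical (e : R) u := forall psi, C1c Om psi ->
  `|\int[mu]_(x in Om) gdot u psi x - \int[mu]_(x in Om) psi x|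
  <= e * (\int[mu]_(x in Om) gsq psi x + 1).

Let J u := 2^-1 * (\int[mu]_(x in Om) gsq u x) - \int[mu]_(x in Om) u x.

(** Take [u] within [e ^+ 2] of the infimum. The variations of [u] by [e * psi] and [- e * psi]
    divide this defect by [e], so the Euler-Lagrange equation holds up to order [e]. *)
Lemma torsion_near_minimizer (e : R) : 0 < e <= 1 ->
  exists u, [/\ C1c Om u, \int[mu]_(x in Om) gsq u x <= gradient_bound & near_critical e u].
Proof.
move=> /andP[e0 e1]; pose A := [set J u | u in C1c Om].
have bs v : C1c Om v -> bm (gsq v) by move=> Cv; exact: bm_gsq Cv.
have lbA : lbound A (- energy_lb).
  move=> _ [v Cv <-]; have := poincare Cv.
  have : 0 <= \int[mu]_(x in Om) gsq v x by apply: Rintegral_ge0 => x _; exact: gsq_ge0.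
  by rewrite /J; lra.
have J0 : J (fun=> 0) = 0.
  rewrite /J; under eq_Rintegral do rewrite /gsq.
  rewrite Rintegral_cst// mul0r subr0.
  transitivity (2^-1 * \int[mu]_(x in Om) (0 : R)); last by rewrite Rintegral_cst// mul0r mulr0.
  congr (_ * _); apply: eq_Rintegral => x _; apply: big1 => i _.
  by rewrite partial_cst expr0n.
have hA : has_inf A.
  by split; [exists (J (fun=> 0)); exists (fun=> 0) => //; exact: C1c0|exists (- energy_lb)].
have [_ [u Cu <-] Ju] := inf_adherent (exprn_gt0 2 e0) hA.
have Jmin v : C1c Om v -> J u < J v + e ^+ 2.
  move=> Cv; apply: (lt_le_trans Ju); rewrite lerD2r.
  by apply: ge_inf; [case: hA|exists v].
exists u; split => //.
  have := Jmin _ (C1c0 Om); rewrite J0 add0r => H.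
  have e21 : e ^+ 2 <= 1 by rewrite expr_le1// ltW.
  by have := poincare Cu; rewrite /gradient_bound; move: H; rewrite /J; lra.
move=> psi Cp; set G := \int[mu]_(x in Om) gsq psi x.
set L := (X in `|X|).
have bu := C1c_bm Cu; have bp := C1c_bm Cp; have b1 := bs _ Cu; have b2 := bs _ Cp.
have b3 := gdot_bm Cu Cp.
have G0 : 0 <= G by apply: Rintegral_ge0 => x _; exact: gsq_ge0.
have H s : 0 < s * L + 2^-1 * s ^+ 2 * G + e ^+ 2.
  have Cus : C1c Om (fun x => u x + s * psi x) by apply: C1c_add => //; exact: C1c_scale.
  have := Jmin _ Cus; rewrite -subr_gt0 /J (Int_add mOm fOm) ?(Int_scale mOm fOm)//; last by bm_tac.
  have -> : \int[mu]_(x in Om) gsq (fun y => u y + s * psi y) x =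
     \int[mu]_(x in Om) gsq u x + (2 * s * (\int[mu]_(x in Om) gdot u psi x) + s ^+ 2 * G).
    rewrite -!(Int_scale mOm fOm) -?(Int_add mOm fOm); try by bm_tac.
    by apply: eq_Rintegral => x _; apply: gsq_add_scale; [exact: C1c_diff Cu x|exact: C1c_diff Cp x].
  rewrite /L; move: (\int[mu]_(x in Om) gdot u psi x) (\int[mu]_(x in Om) gsq u x) => D2 X.
  move: (\int[mu]_(x in Om) u x) (\int[mu]_(x in Om) psi x) => U P.
  by congr (_ < _); field.
have e2 : 0 < e ^+ 2 by rewrite exprn_gt0.
have eG : 0 <= e ^+ 2 * G by rewrite mulr_ge0// ltW.
rewrite ler_norml; apply/andP; split.
  have E1 : e * - (e * (G + 1)) = - (e ^+ 2 * G) - e ^+ 2 by ring.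
  by have := H e; rewrite -(ler_pM2l e0) E1 -[2^-1 * _ * _]mulrA; lra.
have E1 : e * (e * (G + 1)) = e ^+ 2 * G + e ^+ 2 by ring.
by have := H (- e); rewrite -(ler_pM2l e0) E1 mulNr sqrrN -[2^-1 * _ * _]mulrA; lra.
Qed.

Lemma scaled_power_le (k a b M N : R) n : 0 < k -> 0 <= a ->
  k * a ^+ n = M -> k * b ^+ n = N -> a <= b -> M <= N.
Proof.
move=> k0 a0 <- <- ab; rewrite ler_pM2l//.
by rewrite lerXn2r// nnegrE// (le_trans a0).
Qed.

Lemma scaled_power_ratio (k a b M N : R) n : 0 < k -> 0 < b ->
  k * a ^+ n = M -> k * b ^+ n = N -> M = a ^+ n / b ^+ n * N.
Proof. by move=> k0 b0 <- <-; field; rewrite gt_eqF// exprn_gt0. Qed.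

Section levels_of_near_minimizer.
Context (u : E -> R) (e dlt C0 : R).
Hypotheses (Cu : C1c Om u) (e0 : 0 < e) (dlt0 : 0 < dlt).
Hypotheses (uC : \int[mu]_(x in Om) gsq u x <= C0) (ncu : near_critical e u).
Local Notation th := (theta dlt).
Local Notation ka := (kappa dlt).
Local Notation mud := (lev Om u th (fun=> 1)).
Local Notation Dd := (lev Om u ka (fun=> 1)).
Local Notation Ed := (lev Om u ka (gsq u)).
Local Notation Sd := (lev Om u ka (gnorm u)).

(** The defect of [near_critical] for a test function whose gradient is at most [M] times that of
    [u]. *)
Definition en_err (M : R) := e * (M ^+ 2 * C0 + 1).
Definition rt t := radius d (mud t).

Let gu0 : 0 <= \int[mu]_(x in Om) gsq u x.
Proof. by apply: Rintegral_ge0 => x _; exact: gsq_ge0. Qed.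
Let C00 : 0 <= C0. Proof. exact: le_trans gu0 uC. Qed.

Lemma gdot_gsq_comp (h k : R -> R) (v : E -> R) :
  (forall i x, partial i (fun x => h (u x)) x = k (u x) * partial i u x) ->
  (forall x, gdot v (fun x => h (u x)) x = k (u x) * gdot v u x) /\
  (forall x, gsq (fun x => h (u x)) x = k (u x) ^+ 2 * gsq u x).
Proof.
move=> P; split => x; rewrite /gdot /gsq mulr_sumr; apply: eq_bigr => i _.
  by rewrite P; ring.
by rewrite P exprMn.
Qed.

(** Test the near-critical equation with [Hw dlt g T (u x)]: its Dirichlet pairing with [u] is the
    weighted energy of the levels, its integral the weighted volume above them. In the limit this
    says that the flux through a level equals the volume it encloses. *)
Lemma weighted_energy (g : measurableTypeR R -> R) T M : bm g -> 0 <= T ->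
  (forall t, 0 <= t <= T -> 0 <= g t <= M) ->
  `|\int[leb]_(t in `[0, T]) (g t * Ed t) - \int[leb]_(t in `[0, T]) (g t * mud t)| <= en_err M.
Proof.
move=> bg T0 gM; have [CH PH] := Hw_C1c Cu dlt0 bg gM.
have [H1 H2] := gdot_gsq_comp u PH.
have bh : bm (fun x => hw dlt g T (u x)).
  by apply: (bm_comp (hw_cont dlt0 bg gM)); exact: C1c_bm Cu.
have bH := C1c_bm CH; have bs := bm_gsq Cu.
rewrite -(Int_hw mOm fOm Cu dlt0 T bg bs) -(Int_Hw mOm fOm Cu dlt0 T bg (bm_cst _ (1 : R))).
have := ncu CH.
rewrite [X in `|X - _|](_ : _ = \int[mu]_(x in Om) (hw dlt g T (u x) * gsq u x)); last first.
  by apply: eq_Rintegral => x _; rewrite H1.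
rewrite [X in `|_ - X|](_ : _ = \int[mu]_(x in Om) (Hw dlt g T (u x) * 1)); last first.
  by apply: eq_Rintegral => x _; rewrite mulr1.
move=> /le_trans; apply; rewrite /en_err ler_pM2l// lerD2r.
apply: (@le_trans _ _ (M ^+ 2 * \int[mu]_(x in Om) gsq u x)); last by rewrite ler_wpM2l// sqr_ge0.
rewrite -(Int_scale mOm fOm)//.
have bgs : bm (gsq (fun x => Hw dlt g T (u x))) := bm_gsq CH.
apply: (le_Int mOm fOm) => //; first by bm_tac.
move=> x _; rewrite H2 ler_wpM2r ?gsq_ge0//.
have /andP[h1 h2] := hw_itv dlt0 bg T0 gM (u x).
by rewrite lerXn2r// ?nnegrE// (le_trans h1).
Qed.

Lemma rt_itv t : 0 <= rt t <= r.
Proof. by rewrite radius_ge0; apply: radius_le; exact: mud_itv. Qed.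

Lemma rt_cont : continuous rt.
Proof.
have := cont_comp (radius_cont d0) (mud_cont mOm fOm Cu dlt0).
rewrite (_ : (fun _ => _) = rt)//; apply/funext => t; rewrite /rt; congr (radius _ _).
by apply/max_idPl; case/andP: (mud_itv mOm fOm Cu dlt0 t).
Qed.

Lemma bm_rt (f : R -> R) M : continuous f -> (forall x, 0 <= x <= r -> 0 <= f x <= M) ->
  bm (fun t : measurableTypeR R => f (rt t)).
Proof.
move=> cf fM; apply: (bm_cont_bounded _ (M := M)).
  exact: cont_comp cf rt_cont.
by move=> t; have /andP[h1 h2] := fM _ (rt_itv t); rewrite ger0_norm.
Qed.

Lemma has_deriv_compose (f f' g g' : R -> R) : has_deriv f f' -> has_deriv g g' ->
  has_deriv (fun x => f (g x)) (fun x => f' (g x) * g' x).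
Proof. by move=> df dg x; exact: (@is_derive1_comp R f g x _ _ (df (g x)) (dg x)). Qed.

Lemma has_deriv_monomial (k : R) n :
  has_deriv (fun x => k * x ^+ n.+1) (fun x => k * (n.+1%:R * x ^+ n)).
Proof.
move=> x; have := is_deriveZ k (@is_deriveX _ _ (fun x : R => x) n.+1 x 1 1 (is_derive_id _ _)).
rewrite /GRing.scale/= mulr1 (_ : k \*: _ = fun x => k * x ^+ n.+1)//.
by apply/funext => y; rewrite /= exprfctE.
Qed.

Lemma radius_ball (rho : R) : 0 <= rho -> radius d (om * rho ^+ d) = rho.
Proof.
move=> rho0; have om0 : 0 < om := @unit_ball_volume_gt0 R d.
have := @radiusX R d (om * rho ^+ d) d0 (mulr_ge0 (ltW om0) (exprn_ge0 _ rho0)).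
move=> /(mulfI (negbT (gt_eqF om0))) /eqP; rewrite eqrXn2 ?radius_ge0//.
by move/eqP.
Qed.

(** Since [Dd] is minus the derivative of [mud], two substitutions suffice: volume [s = mud t], then
    radius [s = om * x ^+ d]. *)
Lemma level_weight_integral (f : R -> R) M T : continuous f ->
  (forall x, 0 <= x <= r -> 0 <= f x <= M) -> 0 <= T ->
  \int[leb]_(t in `[0, T]) (f (rt t) * (rt t ^+ 2 / d%:R ^+ 2 * Dd t)) <=
  om / d%:R * \int[leb]_(x in `[0, r]) (f x * x ^+ d.+1).
Proof.
move=> cf fM T0; have om0 : 0 < om := @unit_ball_volume_gt0 R d.
pose g (s : R) := f (radius d (Num.max s 0)) * (radius d (Num.max s 0) ^+ 2 / d%:R ^+ 2).
have cr := @radius_cont R d d0.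
have cg : continuous g.
  apply: cont_mul; first exact: cont_comp cf cr.
  by apply: cont_mul; [exact: cont_exp|exact: cont_cst].
have [P dP] := primitive_exists cg.
have g0 s : 0 <= s <= V -> 0 <= g s.
  move=> /andP[s0 sV]; have -> : g s = f (radius d s) * (radius d s ^+ 2 / d%:R ^+ 2).
    by rewrite /g (max_idPl s0).
  rewrite mulr_ge0 ?divr_ge0 ?exprn_ge0 ?radius_ge0 ?ler0n//.
  have rs : 0 <= radius d s <= r by rewrite radius_ge0; apply: radius_le; rewrite s0.
  by case/andP: (fM _ rs).
have gm t : g (mud t) = f (rt t) * (rt t ^+ 2 / d%:R ^+ 2).
  by rewrite /g (max_idPl _)//; case/andP: (mud_itv mOm fOm Cu dlt0 t).
have dm := qderiv_has_deriv (mud_qderiv mOm fOm Cu dlt0).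
have -> : \int[leb]_(t in `[0, T]) (f (rt t) * (rt t ^+ 2 / d%:R ^+ 2 * Dd t)) =
    P (mud 0) - P (mud T).
  transitivity (\int[leb]_(t in `[0, T]) (g (mud t) * Dd t)).
    by apply: eq_Rintegral => t _; rewrite gm mulrA.
  rewrite (@FTC _ _ (fun t => - P (mud t)))//; first by rewrite opprK addrC.
    move=> t; have := has_deriv_compose dP dm t; rewrite mulrN => H.
    by rewrite -[X in is_derive _ _ _ X]opprK; exact: is_deriveN.
  apply: cont_mul; first exact: cont_comp cg (mud_cont mOm fOm Cu dlt0).
  exact: Dd_cont.
have /andP[m0 mV] := mud_itv mOm fOm Cu dlt0 0.
have /andP[m0' mV'] := mud_itv mOm fOm Cu dlt0 T.
(* The integrand is nonnegative on [[0, V]], so the range from [mud T] to [mud 0] may be extended to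
   all of it. *)
have h1 : P (mud 0) <= P V.
  by apply: (FTC_ge0_le dP) => // s /andP[s1 s2]; apply: g0; rewrite s2 (le_trans m0).
have h2 : P 0 <= P (mud T).
  by apply: (FTC_ge0_le dP) => // s /andP[s1 s2]; apply: g0; rewrite s1 (le_trans s2).
apply: (@le_trans _ _ (P V - P 0)); first by rewrite lerB.
have [n Ed'] : exists n, d = n.+1 by exists d.-1; rewrite prednK.
have Er : om * r ^+ n.+1 = V by rewrite -Ed' radiusX.
have dQ := has_deriv_compose dP (has_deriv_monomial om n).
have cx : continuous (fun x : R => x) by move=> z; exact: cvg_id.
have := FTC r0 dQ; rewrite Er expr0n mulr0 => <-; last first.
  apply: cont_mul; first by apply: (cont_comp cg); apply: cont_mul; [exact: cont_cst|exact: cont_exp].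
  apply: cont_mul; first exact: cont_cst.
  by apply: cont_mul; [exact: cont_cst|exact: cont_exp].
rewrite le_eqVlt; apply/orP; left; apply/eqP.
have iE : leb.-integrable `[0, r] (EFin \o (fun x => f x * x ^+ d.+1)).
  by apply: cont_int_seg; apply: cont_mul => //; exact: cont_exp.
rewrite -RintegralZl//.
apply: eq_Rintegral => x; rewrite inE /= in_itv /= => /andP[x0 xr].
have Ex : x ^+ d.+1 = x ^+ 2 * x ^+ n by rewrite Ed' -exprD.
rewrite /g -Ed' (max_idPl _) ?mulr_ge0 ?exprn_ge0 ?(ltW om0)// radius_ball// Ex.
by field; rewrite gt_eqF.
Qed.

(* [2 mu(t + dlt) <= R^2/d^2 (- mu'(t)) + E(t)] is integrated against [f(R(t))];
   the energy term [E] costs at most one [mu], leaving one [mu] on the left. *)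
Lemma talenti (f : R -> R) M T : continuous f ->
  (forall x, 0 <= x <= r -> 0 <= f x <= M) -> 0 <= T ->
  \int[leb]_(t in `[0, T]) (f (rt t) * mud t) <=
  om / d%:R * \int[leb]_(x in `[0, r]) (f x * x ^+ d.+1) + (2 * (M * (dlt * V)) + en_err M).
Proof.
move=> cf fM T0; have mT := measurable_seg 0 T; have fT := leb_seg_lty 0 T.
have M0 : 0 <= M by have /andP[h1 h2] := fM 0 (introT andP (conj (lexx 0) r0)); exact: le_trans h2.
have bF := bm_rt cf fM; have b1 := bm_mud mOm fOm Cu dlt0.
have b2 := bm_Dd mOm fOm Cu dlt0; have b3 := bm_Ed mOm fOm Cu dlt0.
have bs : bm (fun t : measurableTypeR R => mud (t + dlt)).
  apply: (bm_cont_bounded _ (M := V)) => [|x].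
    apply: (cont_comp (mud_cont mOm fOm Cu dlt0)).
    by apply: cont_add; [move=> z; exact: cvg_id|exact: cont_cst].
  by have /andP[h1 h2] := mud_itv mOm fOm Cu dlt0 (x + dlt); rewrite ger0_norm.
have br2 : bm (fun t : measurableTypeR R => rt t ^+ 2 / d%:R ^+ 2).
  apply: (@bm_rt (fun x => x ^+ 2 / d%:R ^+ 2) (r ^+ 2 / d%:R ^+ 2)).
    by apply: cont_mul; [apply: cont_exp => z; exact: cvg_id|exact: cont_cst].
  move=> x /andP[x0 xr]; rewrite divr_ge0 ?sqr_ge0//= ler_pM2r ?invr_gt0 ?exprn_gt0//.
  by rewrite lerXn2r// nnegrE.
have h1 := level_weight_integral cf fM T0.
have gM t : 0 <= t <= T -> 0 <= f (rt t) <= M by move=> _; apply: fM; exact: rt_itv.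
have := weighted_energy bF T0 gM; rewrite ler_norml => /andP[_ h2].
have h3 : 2 * \int[leb]_(t in `[0, T]) (f (rt t) * mud (t + dlt)) <=
   \int[leb]_(t in `[0, T]) (f (rt t) * (rt t ^+ 2 / d%:R ^+ 2 * Dd t)) +
   \int[leb]_(t in `[0, T]) (f (rt t) * Ed t).
  rewrite -(Int_scale mT fT) -?(Int_add mT fT); try by bm_tac.
  apply: (le_Int mT fT); try by bm_tac.
  move=> t; rewrite /= in_itv /= => tT; rewrite -mulrDr mulrCA ler_wpM2l//.
    by case/andP: (gM _ tT).
  by apply: level_ineq => //; case/andP: tT.
have h4 : \int[leb]_(t in `[0, T]) (f (rt t) * mud t) -
    \int[leb]_(t in `[0, T]) (f (rt t) * mud (t + dlt)) <= M * (dlt * V).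
  apply: le_trans (ler_wpM2l M0 (mud_shift mOm fOm Cu dlt0 T0)).
  rewrite -(Int_sub mT fT) -?(Int_scale mT fT); try by bm_tac.
  apply: (le_Int mT fT); try by bm_tac.
  move=> t; rewrite /= in_itv /= => tT; rewrite -mulrBr ler_wpM2r//.
    by rewrite subr_ge0 mud_nincr// lerDl ltW.
  by case/andP: (gM _ tT).
move: h1 h2 h3 h4.
move: (\int[leb]_(t in `[0, T]) (f (rt t) * mud t)) (\int[leb]_(t in `[0, T]) (f (rt t) * mud (t + dlt))).
move: (\int[leb]_(t in `[0, T]) (f (rt t) * Ed t)) => a b c.
move: (\int[leb]_(t in `[0, T]) (f (rt t) * (rt t ^+ 2 / d%:R ^+ 2 * Dd t))) => x.
move: (om / d%:R * _) (M * (dlt * V)) (en_err M) => y z w.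
lra.
Qed.

Lemma one_itv (T : R) t : 0 <= t <= T -> 0 <= (1 : R) <= 1.
Proof. by rewrite ler01 lexx. Qed.

Lemma lev_gnorm_deriv : has_deriv (lev Om u th (gnorm u)) (fun t => - Sd t).
Proof.
have bg := bm_gnorm Cu; have [M M0 HM] := bm_bound bg.
have b1 tau : bm (fun x => th (u x + tau)) by have := bm_th_u Cu dlt0 (- tau); rewrite opprK.
have b2 tau : bm (fun x => ka (u x + tau)) by have := bm_ka_u Cu dlt0 (- tau); rewrite opprK.
have := qderiv_has_deriv (qderiv_opp (qderiv_int mOm fOm (theta_qderiv dlt0) b1 b2 bg (fun y _ => HM y))).
have -> : lev Om u th (gnorm u) = fun t => \int[mu]_(x in Om) (gnorm u x * th (u x - t)).
  by apply/funext => t; apply: eq_Rintegral => x _; rewrite mulrC.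
have -> // : (fun t => - Sd t) = fun t => - \int[mu]_(x in Om) (gnorm u x * ka (u x - t)).
by apply/funext => t; congr (- _); apply: eq_Rintegral => x _; rewrite mulrC.
Qed.

Definition tail_const := V + r / d%:R * (2^-1 * (V + C0)).

(** As [mud] is nonincreasing, the left side is at most its integral over [[0, T]], which
    [mud_int_le] bounds independently of [T]. *)
Lemma mud_decay T : dlt <= 1 -> 0 <= T -> T * mud T <= tail_const.
Proof.
move=> dlt1 T0; have mT := measurable_seg 0 T; have fT := leb_seg_lty 0 T.
have := mud_int_le Cu dlt0 T0.
have h1 : T * mud T <= \int[leb]_(t in `[0, T]) mud t.
  rewrite mulrC -[X in _ * X]subr0 -leb_seg// -(Rintegral_cst _ mT).
  apply: (le_Int mT fT); [exact: bm_cst|exact: bm_mud|].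
  by move=> t; rewrite /= in_itv /= => /andP[_ tT]; exact: mud_nincr.
have h2 : \int[mu]_(x in Om) gnorm u x <= 2^-1 * (V + C0).
  have bg := bm_gnorm Cu; have bs := bm_gsq Cu.
  apply: (@le_trans _ _ (2^-1 * (V + \int[mu]_(x in Om) gsq u x))); last first.
    by rewrite ler_pM2l ?invr_gt0// lerD2l.
  have -> : V = \int[mu]_(x in Om) 1 by rewrite Rintegral_cst// mul1r.
  rewrite -(Int_add mOm fOm)//; last exact: bm_cst.
  rewrite -(Int_scale mOm fOm); last by bm_tac.
  apply: (le_Int mOm fOm); try by bm_tac.
  move=> x _; rewrite -gnorm_sq -subr_ge0; move: (gnorm u x) => g.
  have -> : 2^-1 * (1 + g ^+ 2) - g = 2^-1 * (g - 1) ^+ 2 by field.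
  by rewrite mulr_ge0 ?sqr_ge0 ?invr_ge0.
move=> h3; apply: le_trans h1 _; apply: le_trans h3 _; rewrite lerD//.
  by rewrite ler_piMl.
by rewrite ler_wpM2l.
Qed.

Definition tail_err (lam T : R) :=
  dlt * V + r / d%:R * (2^-1 * (tail_const / (lam * T)) + 2^-1 * (lam * C0)).

(** The estimate above height [T], uniform in [u]. By [mud_le_surface] the volumes above [T + dlt]
    integrate to at most a multiple of the integral of [|grad u|] over the levels above [T]. AM-GM
    with weight [lam] splits the latter into [mud T], small by [mud_decay], and the Dirichlet
    integral. *)
Lemma tail_bound (lam T : R) : dlt <= 1 -> 0 < lam -> 0 < T ->
  \int[mu]_(x in Om) (u x - Hw dlt (fun=> 1) (T + dlt) (u x)) <= tail_err lam T.
Proof.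
move=> dlt1 lam0 T0; have [N N0 HN] := bm_bound (C1c_bm Cu).
have bu := C1c_bm Cu; have bg := bm_gnorm Cu; have bs := bm_gsq Cu.
have bt := bm_th_u Cu dlt0 T.
have TD0 : 0 <= T + dlt by rewrite addr_ge0// ltW.
pose T2 := Num.max (T + dlt) N.
have TT2 : T + dlt <= T2 by rewrite /T2 le_max lexx.
have T20 : 0 <= T2 := le_trans TD0 TT2.
have uT2 x : u x <= T2 by rewrite (le_trans (le_trans (ler_norm _) (HN x)))// /T2 le_max lexx orbT.
have H1 := mud_int_ge Cu dlt0 T20 uT2.
have bH : bm (fun x => Hw dlt (fun=> 1) (T + dlt) (u x)).
  exact: (bm_comp (Hw_cont dlt0 (bm_cst _ (1 : R)) (@one_itv (T + dlt)))).
have E1 : \int[mu]_(x in Om) Hw dlt (fun=> 1) (T + dlt) (u x) = \int[leb]_(t in `[0, T + dlt]) mud t.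
  transitivity (\int[mu]_(x in Om) (Hw dlt (fun=> 1) (T + dlt) (u x) * 1)).
    by apply: eq_Rintegral => x _; rewrite mulr1.
  rewrite (Int_Hw mOm fOm Cu dlt0 _ (bm_cst _ (1 : R)) (bm_cst _ (1 : R))).
  by apply: eq_Rintegral => t _; rewrite mul1r.
have [P dP] := primitive_exists (mud_cont mOm fOm Cu dlt0).
have cm := mud_cont mOm fOm Cu dlt0.
rewrite (Int_sub mOm fOm)// E1 (FTC TD0 dP cm).
move: H1; rewrite (FTC T20 dP cm) => H1.
have Th0 t : 0 <= lev Om u th (gnorm u) t.
  by apply: Rintegral_ge0 => x _; rewrite mulr_ge0 ?sqrtr_ge0//; case/andP: (theta_itv dlt (u x - t)).
(* By [mud_le_surface] the derivative of [Z] is nonnegative, and its monotonicity up to the height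
   [T2], above which [u] has no values, is the integrated inequality. *)
pose Z t := r / d%:R * - lev Om u th (gnorm u) (t - dlt) - P t.
have dZ : has_deriv Z (fun t => r / d%:R * Sd (t - dlt) - mud t).
  have ds : has_deriv (fun t : R => t - dlt) (fun=> 1).
    by move=> t; rewrite -[X in is_derive _ _ _ X]subr0; apply: is_deriveB.
  move=> t; apply: is_deriveB; last exact: dP.
  apply: is_deriveZ.
  rewrite -[Sd _]opprK; apply: is_deriveN.
  by have := has_deriv_compose lev_gnorm_deriv ds t; rewrite mulr1.
have H2 : Z (T + dlt) <= Z T2.
  apply: (FTC_ge0_le dZ TT2) => t /andP[t1 t2].
  have := @mud_le_surface _ _ _ _ _ d0 mOm fOm Cu dlt0 (t - dlt).
  by rewrite subrK subr_ge0 subr_ge0; apply; rewrite (le_trans _ t1)// lerDr ltW.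
have H3 : lev Om u th (gnorm u) T <= 2^-1 * (tail_const / (lam * T)) + 2^-1 * (lam * C0).
  apply: (@le_trans _ _ (2^-1 * (lam^-1 * mud T) + 2^-1 * (lam * \int[mu]_(x in Om) gsq u x))); last first.
    rewrite lerD// ler_pM2l ?invr_gt0//; last by rewrite ler_pM2l.
    rewrite invfM mulrCA ler_pM2l ?invr_gt0// ler_pdivlMr// mulrC.
    exact: mud_decay (ltW T0).
  rewrite -!(Int_scale mOm fOm) -?(Int_add mOm fOm); try by bm_tac.
  apply: (le_Int mOm fOm); try by bm_tac.
  move=> x _; have /andP[t0 t1] := theta_itv dlt (u x - T).
  rewrite mulr1 -gnorm_sq; move: (gnorm u x) (th _) t0 t1 => g t t0 t1.
  apply: (@le_trans _ _ (2^-1 * (lam^-1 * t ^+ 2) + 2^-1 * (lam * g ^+ 2))).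
    rewrite -subr_ge0 (_ : _ - _ = 2^-1 * lam^-1 * (t - lam * g) ^+ 2).
      by apply: mulr_ge0; [rewrite divr_ge0 ?invr_ge0 ?(ltW lam0)|exact: sqr_ge0].
    by field; rewrite gt_eqF.
  rewrite lerD2r ler_pM2l ?invr_gt0// ler_pM2l ?invr_gt0//.
  by rewrite expr2 ler_piMl.
move: H2; rewrite /Z addrK => H2.
have H4 : r / d%:R * lev Om u th (gnorm u) T <= r / d%:R * (2^-1 * (tail_const / (lam * T)) + 2^-1 * (lam * C0)).
  by rewrite ler_wpM2l.
have H5 : 0 <= r / d%:R * lev Om u th (gnorm u) (T2 - dlt) by rewrite mulr_ge0.
move: H1 H2 H4 H5; rewrite /tail_err.
move: (r / d%:R * (_ + _)) => a.
rewrite !mulrN; move: (r / d%:R * _) (r / d%:R * _) => b c.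
move: (\int[mu]_(x in Om) u x) (dlt * V) (P 0) (P T2) (P (T + dlt)) => v w p1 p2 p3.
lra.
Qed.

(** Test the near-critical equation with [u - Hw (u)], whose derivative in [u] lies in [[0, 1]]: the
    energy outside the levels of [[0, T]] is controlled by the integral just estimated. *)
Lemma truncation_energy T : 0 <= T ->
  \int[mu]_(x in Om) ((1 - hw dlt (fun=> 1) T (u x)) * gsq u x) <=
  \int[mu]_(x in Om) (u x - Hw dlt (fun=> 1) T (u x)) + en_err 1.
Proof.
move=> T0; have b1 := bm_cst (measurableTypeR R) (1 : R).
have dH : has_deriv (fun y => y - Hw dlt (fun=> 1) T y) (fun y => 1 - hw dlt (fun=> 1) T y).
  by move=> y; apply: is_deriveB; exact: (Hw_deriv dlt0 b1 (@one_itv T)).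
have ch : continuous (fun y => 1 - hw dlt (fun=> 1) T y).
  by apply: cont_sub; [exact: cont_cst|exact: (hw_cont dlt0 b1 (@one_itv T))].
have H0 : 0 - Hw dlt (fun=> 1) T 0 = 0 by rewrite Hw_le0// subr0.
have [CH PH] := C1c_comp Cu dH ch H0.
have [K1 K2] := @gdot_gsq_comp (fun y => y - Hw dlt (fun=> 1) T y) (fun y => 1 - hw dlt (fun=> 1) T y) u PH.
have := ncu CH; rewrite ler_norml => /andP[_].
have -> : \int[mu]_(x in Om) gdot u (fun y => u y - Hw dlt (fun=> 1) T (u y)) x =
    \int[mu]_(x in Om) ((1 - hw dlt (fun=> 1) T (u x)) * gsq u x).
  by apply: eq_Rintegral => x _; exact: K1.
rewrite lerBlDl => /le_trans; apply; rewrite lerD2l /en_err expr1n mul1r ler_pM2l// lerD2r.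
apply: le_trans uC.
have b2 : bm (gsq (fun x => u x - Hw dlt (fun=> 1) T (u x))) := bm_gsq CH.
have b3 := bm_gsq Cu.
apply: (le_Int mOm fOm) => // x _; rewrite K2 ler_piMl ?gsq_ge0//.
have /andP[h1 h2] := hw_itv dlt0 b1 T0 (@one_itv T) (u x).
by rewrite expr_le1 ?subr_ge0// lerBlDr lerDl.
Qed.

(** * The functions [G] and [Q] built from the radial weight [q]; [sigma] is the tension *)

Section dual_certificate.
Context (sigma Mq : R) (q : R -> R) (T : R).
Hypotheses (sigma0 : 0 <= sigma) (cq : continuous q) (T0 : 0 <= T) (V_gt0 : 0 < V).
Hypotheses (qM : forall x, 0 <= x <= r -> 0 <= q x <= Mq).
Hypothesis (q1 : forall x, 0 <= x <= r -> 0 <= 1 - sigma * q x <= 1).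
Hypothesis ball_identity : forall p, 0 < p <= r ->
  om / d%:R * \int[leb]_(x in `[0, r])
    ((1 - sigma * q x) * (p ^+ d / Num.max x p ^+ d - p ^+ d / r ^+ d) * x ^+ d.+1)
  = om * p ^+ d * q p.

Let qt (t : measurableTypeR R) := q (rt t).
Let at_ (t : measurableTypeR R) := 1 - sigma * q (rt t).
Local Notation Q := (fun x => Hw dlt qt T (u x)).
Local Notation G := (fun x => Hw dlt at_ T (u x)).
Let err1 := 2 * (1 * (dlt * V)) + en_err 1.

Let om0 : 0 < om. Proof. exact: unit_ball_volume_gt0. Qed.
Let rp : 0 < r. Proof. exact: radius_gt0. Qed.
Let mT := measurable_seg 0 T.
Let fT := leb_seg_lty 0 T.
Let Er : om * r ^+ d = V. Proof. exact: radiusX. Qed.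
Let Ert t : om * rt t ^+ d = mud t.
Proof. by rewrite radiusX//; case/andP: (mud_itv mOm fOm Cu dlt0 t). Qed.

Let mud_rt_le t s : rt s <= rt t -> mud s <= mud t.
Proof.
by move=> h; exact: scaled_power_le om0 (radius_ge0 _ _) (Ert s) (Ert t) h.
Qed.

Let ca : continuous (fun x => 1 - sigma * q x).
Proof. by apply: cont_sub; [exact: cont_cst|apply: cont_mul => //; exact: cont_cst]. Qed.
Let bqt : bm qt. Proof. exact: bm_rt cq qM. Qed.
Let bat : bm at_. Proof. exact: bm_rt ca q1. Qed.
Let qtM t : 0 <= t <= T -> 0 <= qt t <= Mq. Proof. by move=> _; exact/qM/rt_itv. Qed.
Let at1 t : 0 <= t <= T -> 0 <= at_ t <= 1. Proof. by move=> _; exact/q1/rt_itv. Qed.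
Let bmud := bm_mud mOm fOm Cu dlt0.
Let err10 : 0 <= err1.
Proof. by rewrite /err1 /en_err addr_ge0 ?mulr_ge0 ?addr_ge0 ?mulr_ge0 ?(ltW dlt0) ?(ltW e0)// sqr_ge0. Qed.

Let bG : bm G. Proof. by apply: (bm_comp (Hw_cont dlt0 bat at1)); exact: C1c_bm Cu. Qed.

Lemma level_correlation t s :
  \int[mu]_(x in Om) (th (u x - t) * th (u x - s)) <= Num.min (mud t) (mud s).
Proof.
have h1 := bm_th_u Cu dlt0 t; have h2 := bm_th_u Cu dlt0 s.
rewrite le_min; apply/andP; split; apply: (le_Int mOm fOm); try by bm_tac.
  move=> x _; rewrite mulr1; have /andP[a0 a1] := theta_itv dlt (u x - t).
  by have /andP[b0 b1] := theta_itv dlt (u x - s); rewrite ler_piMr.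
move=> x _; rewrite mulr1; have /andP[a0 a1] := theta_itv dlt (u x - t).
by have /andP[b0 b1] := theta_itv dlt (u x - s); rewrite ler_piMl.
Qed.

Lemma min_mud_bm t : bm (fun s : measurableTypeR R => Num.min (mud t) (mud s)).
Proof.
have cm := mud_cont mOm fOm Cu dlt0.
apply: (bm_cont_bounded _ (M := V)) => [|s].
  by apply: cont_min => //; exact: cont_cst.
have /andP[a0 a1] := mud_itv mOm fOm Cu dlt0 t; have /andP[b0 b1] := mud_itv mOm fOm Cu dlt0 s.
by rewrite ger0_norm ?le_min ?a0// ge_min a1.
Qed.

Lemma lev_G_le t : lev Om u th G t <= \int[leb]_(s in `[0, T]) (at_ s * Num.min (mud t) (mud s)).
Proof.
have h1 := bm_th_u Cu dlt0 t; have h2 := min_mud_bm t.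
have -> : lev Om u th G t = \int[mu]_(x in Om) (Hw dlt at_ T (u x) * th (u x - t)).
  by apply: eq_Rintegral => x _; rewrite mulrC.
rewrite (Int_Hw mOm fOm Cu dlt0 T bat h1).
have h3 := bm_lev mOm fOm Cu (theta_cont dlt0) (@theta_bound _ dlt) h1.
apply: (le_Int mT fT); try by bm_tac.
move=> s; rewrite /= in_itv /= => /at1 /andP[a0 _].
by rewrite ler_wpM2l// minC; exact: level_correlation.
Qed.

(** With [p = rt t], the quotient of [min (mud t) (mud s)] by [mud s] is
    [p ^+ d / max (rt s) p ^+ d], a function of [rt s] alone. Hence the covariance of [G] with the
    step at level [t] is bounded by an integral of the form treated by [talenti], and
    [ball_identity] evaluates the resulting bound exactly. *)
Lemma covariance_le t :
  lev Om u th G t - mud t / V * \int[leb]_(s in `[0, T]) (at_ s * mud s) <= mud t * qt t + err1.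
Proof.
have /andP[m0 mV] := mud_itv mOm fOm Cu dlt0 t.
have h2 := min_mud_bm t.
(* [ball_identity] needs a positive radius [p]; for an empty level both terms on the left are
   trivial. *)
have [z|mn] := eqVneq (mud t) 0.
  rewrite z !mul0r subr0 add0r; apply: le_trans (lev_G_le t) _.
  apply: (@le_trans _ _ (\int[leb]_(s in `[0, T]) (0 : R))); last by rewrite Rintegral_cst// mul0r.
  apply: (le_Int mT fT); [by bm_tac|exact: bm_cst|].
  move=> s _; rewrite z min_l ?mulr0//.
  by case/andP: (mud_itv mOm fOm Cu dlt0 s).
have mp : 0 < mud t by rewrite lt_neqAle eq_sym mn.
have pp : 0 < rt t := radius_gt0 d mp.
have /andP[_ pr] := rt_itv t; set p := rt t in pp pr *.
pose f x := (1 - sigma * q x) * (p ^+ d / Num.max x p ^+ d - p ^+ d / r ^+ d).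
have mxp x : 0 < Num.max x p by rewrite lt_max pp orbT.
have cmx : continuous (fun x : R => Num.max x p ^+ d).
  by apply: cont_exp; apply: cont_max; [move=> z; exact: cvg_id|exact: cont_cst].
have cf : continuous f.
  apply: cont_mul => //; apply: cont_sub; last exact: cont_cst.
  apply: cont_mul; first exact: cont_cst.
  move=> x; apply: (@continuous_comp _ _ _ (fun x => Num.max x p ^+ d) (fun y : R => y^-1)).
    exact: cmx.
  by apply: inv_continuous; rewrite gt_eqF// exprn_gt0.
have fM x : 0 <= x <= r -> 0 <= f x <= 1.
  move=> /[dup] /q1 /andP[a0 a1] /andP[x0 xr].
  have k1 : p ^+ d / r ^+ d <= p ^+ d / Num.max x p ^+ d.
    rewrite ler_pM2l ?exprn_gt0// lef_pV2 ?posrE ?exprn_gt0// lerXn2r ?nnegrE ?(ltW rp) ?(ltW (mxp x))//.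
    by rewrite ge_max xr.
  have k2 : p ^+ d / Num.max x p ^+ d <= 1.
    rewrite ler_pdivrMr ?exprn_gt0// mul1r lerXn2r ?nnegrE ?(ltW pp) ?(ltW (mxp x))//.
    by rewrite le_max lexx orbT.
  have k3 : 0 <= p ^+ d / r ^+ d by rewrite divr_ge0 ?exprn_ge0 ?(ltW pp) ?(ltW rp).
  apply/andP; split; first by apply: mulr_ge0 => //; rewrite subr_ge0.
  apply: mulr_ile1 => //; first by rewrite subr_ge0.
  by rewrite lerBlDr (le_trans k2)// lerDl.
have := talenti cf fM T0; rewrite ball_identity ?pp//.
rewrite [om * _]Ert -/err1; apply: le_trans.
have b1 := bm_scale (mud t / V) (bm_mul bat bmud).
rewrite -(Int_scale mT fT); last exact: bm_mul.
apply: (le_trans (lerB (lev_G_le t) (lexx _))).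
rewrite -(Int_sub mT fT)//; last by bm_tac.
have bf := bm_rt cf fM.
apply: (le_Int mT fT); try by bm_tac.
move=> s; rewrite /= in_itv /= => sT.
rewrite le_eqVlt; apply/orP; left; apply/eqP.
have -> : mud t / V = p ^+ d / r ^+ d.
  by rewrite (scaled_power_ratio om0 rp (Ert t) Er) mulfK// gt_eqF.
have alg (A K N L : R) : A * (K * N) - L * (A * N) = A * (K - L) * N by ring.
rewrite /f -/(at_ s) -alg; congr (_ * _ - _).
have [h|h] := leP (rt s) p.
  rewrite divff ?gt_eqF ?exprn_gt0// mul1r min_r//.
  exact: mud_rt_le.
rewrite min_l; last by apply: mud_rt_le; exact: ltW.
have sp : 0 < rt s := lt_trans pp h.
exact: scaled_power_ratio om0 sp (Ert t) (Ert s).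
Qed.

(** Fubini in one of the two factors writes the variance as the integral over [t] of [at_ t] times
    the covariance of [G] with the step at [t]. Each level costs [err1], so the total error grows
    with [T], which is why the height must be kept finite. *)
Lemma variance_le (m : R) : m = (\int[mu]_(x in Om) G x) / V ->
  \int[mu]_(x in Om) ((G x - m) ^+ 2) <= \int[leb]_(t in `[0, T]) (at_ t * (mud t * qt t)) + T * err1.
Proof.
move=> Em; set g1 := \int[leb]_(s in `[0, T]) (at_ s * mud s).
have EG : \int[mu]_(x in Om) G x = g1.
  rewrite /g1 -(Int_Hw mOm fOm Cu dlt0 T bat (bm_cst _ (1 : R))).
  by apply: eq_Rintegral => x _; rewrite mulr1.
have blG := bm_lev mOm fOm Cu (theta_cont dlt0) (@theta_bound _ dlt) bG.
have E2 : \int[mu]_(x in Om) (G x * G x) = \int[leb]_(t in `[0, T]) (at_ t * lev Om u th G t).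
  by rewrite (Int_Hw mOm fOm Cu dlt0 T bat bG).
have -> : \int[mu]_(x in Om) ((G x - m) ^+ 2) =
   \int[leb]_(t in `[0, T]) (at_ t * (lev Om u th G t - mud t / V * g1)).
  transitivity (\int[mu]_(x in Om) (G x * G x - (2 * m * G x - m ^+ 2))).
    by apply: eq_Rintegral => x _; ring.
  rewrite (Int_sub mOm fOm); try by bm_tac.
  rewrite E2 (Int_sub mOm fOm); try by bm_tac.
  rewrite (Int_scale mOm fOm)// Rintegral_cst//.
  transitivity (\int[leb]_(t in `[0, T]) (at_ t * lev Om u th G t - g1 / V * (at_ t * mud t))); last first.
    by apply: eq_Rintegral => t _; ring.
  rewrite (Int_sub mT fT); try by bm_tac.
  rewrite (Int_scale mT fT); last by bm_tac.
  rewrite -/g1 EG Em EG; congr (_ - _); field; exact: lt0r_neq0.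
have b2 := bm_scale T (bm_cst (measurableTypeR R) err1).
have -> : T * err1 = \int[leb]_(t in `[0, T]) err1.
  by rewrite Rintegral_cst// leb_seg// subr0 mulrC.
rewrite -(Int_add mT fT); try by bm_tac.
have bb : bm (fun t : measurableTypeR R => mud t / V * g1) by bm_tac.
apply: (le_Int mT fT); try by bm_tac.
move=> t; rewrite /= in_itv /= => /at1 /andP[a0 a1].
apply: (le_trans (ler_wpM2l a0 (covariance_le t))).
by rewrite mulrDr lerD2l ler_piMl.
Qed.

(** Jensen's inequality for the weight [kappa], of mass at most one: the square of the smoothed
    weight [hw] of [q] is at most the smoothed [q ^+ 2]. Then [weighted_energy] applies with weight
    [q ^+ 2]. *)
Lemma gsq_Q_le : \int[mu]_(x in Om) gsq Q x <=
  \int[leb]_(t in `[0, T]) (qt t ^+ 2 * mud t) + en_err (Mq ^+ 2).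
Proof.
have [CQ PQ] := Hw_C1c Cu dlt0 bqt qtM.
have [_ K2] := @gdot_gsq_comp (Hw dlt qt T) (hw dlt qt T) u PQ.
have bq2 : bm (fun t => qt t ^+ 2) by exact: bm_exp.
have q2M t : 0 <= t <= T -> 0 <= qt t ^+ 2 <= Mq ^+ 2.
  by move=> /qtM /andP[h1 h2]; rewrite sqr_ge0 lerXn2r// nnegrE (le_trans h1).
have := weighted_energy bq2 T0 q2M; rewrite ler_norml => /andP[_].
rewrite lerBlDl; apply: le_trans; have bs := bm_gsq Cu.
rewrite -(Int_hw mOm fOm Cu dlt0 T bq2 bs).
have b1 : bm (gsq Q) := bm_gsq CQ.
have b2 : bm (fun x => hw dlt (fun t => qt t ^+ 2) T (u x)).
  by apply: (bm_comp (hw_cont dlt0 bq2 q2M)); exact: C1c_bm Cu.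
apply: (le_Int mOm fOm); try by bm_tac.
move=> x _; rewrite K2 ler_wpM2r ?gsq_ge0//.
set c := hw dlt qt T (u x).
have bk : bm (fun t : measurableTypeR R => ka (u x - t)).
  apply: (bm_cont_bounded _ (M := 6 / dlt)); last by move=> z; exact: kappa_bound.
  by apply: (cont_comp (kappa_cont dlt0)); apply: cont_sub; [exact: cont_cst|move=> z; exact: cvg_id].
have : 0 <= \int[leb]_(t in `[0, T]) ((qt t - c) ^+ 2 * ka (u x - t)).
  by apply: Rintegral_ge0 => t _; rewrite mulr_ge0 ?sqr_ge0 ?kappa_ge0.
have -> : \int[leb]_(t in `[0, T]) ((qt t - c) ^+ 2 * ka (u x - t)) =
   hw dlt (fun t => qt t ^+ 2) T (u x) - (2 * c * c - c ^+ 2 * (th (u x - 0) - th (u x - T))).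
  transitivity (\int[leb]_(t in `[0, T]) (qt t ^+ 2 * ka (u x - t) -
     (2 * c * (qt t * ka (u x - t)) - c ^+ 2 * ka (u x - t)))).
    by apply: eq_Rintegral => t _; ring.
  rewrite (Int_sub mT fT); try by bm_tac.
  rewrite (Int_sub mT fT); try by bm_tac.
  rewrite (Int_scale mT fT); last by bm_tac.
  rewrite (Int_scale mT fT) ?Int_kappa//.
have /andP[_ h1] := theta_itv dlt (u x - 0); have /andP[h2 _] := theta_itv dlt (u x - T).
have : 0 <= c ^+ 2 * (1 - (th (u x - 0) - th (u x - T))) by rewrite mulr_ge0 ?sqr_ge0//; lra.
move: (hw dlt (fun t => qt t ^+ 2) T (u x)) (th (u x - 0) - th (u x - T)) => X z.
by move: c => c; rewrite !mulrBr mulr1 -mulrA -expr2 => k1 k2; lra.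
Qed.

Section test_function_bound.
Context (phi : E -> R) (eta : R).
Hypotheses (Cphi : C1c Om phi) (Cdphi : forall i, C1c Om (partial i phi)) (eta0 : 0 < eta).
Let lap x := \sum_i partial i (partial i phi) x.
Let Phi := \int[mu]_(x in Om) gsq phi x.
(** The fraction of [grad u] that is not carried by the levels in [[0, T]], hence not captured by
    [G] and [Q]. *)
Let zeta x := 1 - hw dlt (fun=> 1) T (u x).

Lemma gdot_amgm (v w : E -> R) (k : R) x : 0 < k ->
  2 * gdot v w x <= k^-1 * gsq v x + k * gsq w x.
Proof.
move=> k0; rewrite /gdot /gsq !mulr_sumr -big_split /=; apply: ler_sum => i _.
rewrite -subr_ge0; move: (partial i v x) (partial i w x) => a b.
have -> : k^-1 * a ^+ 2 + k * b ^+ 2 - 2 * (a * b) = k^-1 * (a - k * b) ^+ 2.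
  by field; rewrite gt_eqF.
by rewrite mulr_ge0 ?invr_ge0 ?sqr_ge0// ltW.
Qed.

Lemma gdot_amgm1 (v w : E -> R) x : 2 * gdot v w x <= 1 * gsq v x + 1 * gsq w x.
Proof. by have := @gdot_amgm v w 1 x ltr01; rewrite invr1. Qed.

Lemma gdot_amgm_weight (v w : E -> R) (k z : R) x : 0 < k -> 0 <= z <= 1 ->
  2 * (z * gdot v w x) <= k^-1 * (z * gsq v x) + k * gsq w x.
Proof.
move=> k0 /andP[z0 z1]; have z2 := ler_wpM2l z0 (@gdot_amgm v w k x k0).
have z3 : z * (k * gsq w x) <= k * gsq w x.
  by rewrite ler_piMl// mulr_ge0 ?gsq_ge0// ltW.
move: z2 z3; move: (gdot v w x) (gsq v x) (gsq w x) => a b c.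
by rewrite mulrDr [z * (2 * a)]mulrCA [z * (k^-1 * b)]mulrCA => k4 k5; lra.
Qed.

Lemma square_amgm (a m b : R) : 2 * ((m - a) * b) <= 1 * (a - m) ^+ 2 + 1 * b ^+ 2.
Proof.
rewrite -subr_ge0 (_ : _ - _ = (a - m + b) ^+ 2) ?sqr_ge0//; ring.
Qed.

(** [A], [B], [C] are the pairings of [phi] with [G], [Q] and the truncated remainder. [Y1], [Y2],
    [Y3] are the level integrals of [mud] with weights [at_ * qt], [qt ^+ 2] and [qt]; they combine
    because [at_ + sigma * qt = 1]. *)
Lemma dual_arith (sg ee X1 X2 A B C VG L2 GQ Ph Z Y1 Y2 Y3 TB er0 er1 er2 k : R) : 0 <= sg ->
  - (ee * (Ph + 1)) <= X1 - X2 -> X1 = A + sg * B + C ->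
  2 * A <= 1 * VG + 1 * L2 -> 2 * B <= 1 * GQ + 1 * Ph -> 2 * C <= k^-1 * Z + k * Ph ->
  VG <= Y1 + er1 -> sg * GQ <= sg * (Y2 + er2) -> Y3 <= TB + er0 -> Y1 + sg * Y2 = Y3 ->
  2 * X2 - L2 - sg * Ph <=
  TB + (er0 + er1 + sg * er2 + 2 * (ee * (Ph + 1)) + (k^-1 * Z + k * Ph)).
Proof.
move=> sg0 h1 E0 k1 k2 k3 h3 h4 h5 h6; have k4 := ler_wpM2l sg0 k2.
have : 2 * X1 <= VG + L2 + sg * (GQ + Ph) + (k^-1 * Z + k * Ph).
  by rewrite E0; move: k4; rewrite !mul1r mulrCA; lra.
by move: h4 h3 h5; rewrite -h6 !mulrDr; lra.
Qed.

Let blap : bm lap. Proof. by apply: bm_sum => i; exact: C1c_partial_bm (Cdphi i). Qed.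

Lemma Int_lap (v : E -> R) : C1c Om v ->
  \int[mu]_(x in Om) gdot v phi x = - \int[mu]_(x in Om) (v x * lap x).
Proof.
move=> Cv; have bv := C1c_bm Cv.
have b1 i : bm (fun x => partial i v x * partial i phi x).
  by apply: bm_mul; [exact: C1c_partial_bm Cv|exact: C1c_partial_bm Cphi].
have b2 i : bm (fun x => v x * partial i (partial i phi) x).
  by apply: bm_mul => //; exact: C1c_partial_bm (Cdphi i).
rewrite /gdot (Int_sum mOm fOm)//.
transitivity (- \int[mu]_(x in Om) (\sum_i v x * partial i (partial i phi) x)); last first.
  by congr (- _); apply: eq_Rintegral => x _; rewrite /lap mulr_sumr.
rewrite (Int_sum mOm fOm)// -sumrN; apply: eq_bigr => i _.
by rewrite (Int_by_parts i mOm fOm (Cdphi i)) ?opprK//; case: Cv.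
Qed.

Lemma Int_lap0 : \int[mu]_(x in Om) lap x = 0.
Proof.
rewrite /lap (Int_sum mOm fOm); last by move=> i; exact: C1c_partial_bm (Cdphi i).
by apply: big1 => i _; exact: Int_partial0 (Cdphi i).
Qed.

Lemma dual_bound :
  2 * \int[mu]_(x in Om) phi x - \int[mu]_(x in Om) (lap x ^+ 2) - sigma * Phi <=
  om / d%:R * \int[leb]_(x in `[0, r]) (q x * x ^+ d.+1) +
  ((2 * (Mq * (dlt * V)) + en_err Mq) + T * err1 + sigma * en_err (Mq ^+ 2)
   + 2 * (e * (Phi + 1)) + (eta^-1 * \int[mu]_(x in Om) (zeta x * gsq u x) + eta * Phi)).
Proof.
have b1 := bm_cst (measurableTypeR R) (1 : R).
have [CG PG] := Hw_C1c Cu dlt0 bat at1.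
have [CQ PQ] := Hw_C1c Cu dlt0 bqt qtM.
have [G1 _] := @gdot_gsq_comp (Hw dlt at_ T) (hw dlt at_ T) phi PG.
have [Q1 _] := @gdot_gsq_comp (Hw dlt qt T) (hw dlt qt T) phi PQ.
have bs := bm_gsq Cu; have bphi := C1c_bm Cphi.
have bsp : bm (gsq phi) := bm_gsq Cphi.
have bsQ : bm (gsq Q) := bm_gsq CQ.
have bz : bm zeta.
  apply: bm_sub; first exact: bm_cst.
  by apply: (bm_comp (hw_cont dlt0 b1 (@one_itv T))); exact: C1c_bm Cu.
have zI x : 0 <= zeta x <= 1.
  have /andP[h1 h2] := hw_itv dlt0 b1 T0 (@one_itv T) (u x).
  by rewrite subr_ge0 h2 lerBlDr lerDl.
have gC (v w : E -> R) x : gdot v w x = gdot w v x.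
  by apply: eq_bigr => i _; rewrite mulrC.
have bup := gdot_bm Cu Cphi; have bGp := gdot_bm CG Cphi; have bQp := gdot_bm CQ Cphi.
have split_dot x : gdot u phi x = gdot G phi x + sigma * gdot Q phi x + zeta x * gdot u phi x.
  have hE : hw dlt (fun=> 1) T (u x) = hw dlt at_ T (u x) + sigma * hw dlt qt T (u x).
    have bk : bm (fun t : measurableTypeR R => ka (u x - t)).
      apply: (bm_cont_bounded _ (M := 6 / dlt)); last by move=> z; exact: kappa_bound.
      by apply: (cont_comp (kappa_cont dlt0)); apply: cont_sub; [exact: cont_cst|move=> z; exact: cvg_id].
    rewrite /hw -(Int_scale mT fT); last by bm_tac.
    rewrite -(Int_add mT fT); try by bm_tac.
    by apply: eq_Rintegral => t _; rewrite /at_ /qt; ring.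
  rewrite [gdot G _ _]gC G1 [gdot Q _ _]gC Q1 ![gdot phi u x]gC /zeta hE; ring.
(* Any constant may be inserted, as [lap] has integral zero; the mean is the one that turns the
   second moment of [G] into a variance. *)
set m := (\int[mu]_(x in Om) G x) / V.
have HG : \int[mu]_(x in Om) gdot G phi x = \int[mu]_(x in Om) ((m - G x) * lap x).
  rewrite (Int_lap CG).
  transitivity (\int[mu]_(x in Om) (m * lap x - G x * lap x)); last first.
    by apply: eq_Rintegral => x _; ring.
  rewrite (Int_sub mOm fOm); try by bm_tac.
  by rewrite (Int_scale mOm fOm)// Int_lap0 mulr0 sub0r.
have bmG : bm (fun x => m - G x) by bm_tac.
have := ncu Cphi; rewrite ler_norml -/Phi => /andP[h1 _].
have E0 : \int[mu]_(x in Om) gdot u phi x = \int[mu]_(x in Om) ((m - G x) * lap x) +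
    sigma * \int[mu]_(x in Om) gdot Q phi x + \int[mu]_(x in Om) (zeta x * gdot u phi x).
  rewrite -HG -(Int_scale mOm fOm)// -!(Int_add mOm fOm); try by bm_tac.
  by apply: eq_Rintegral => x _; exact: split_dot.
have bGm : bm (fun x => (G x - m) ^+ 2) by bm_tac.
have bl2 : bm (fun x => lap x ^+ 2) by bm_tac.
have bml : bm (fun x => (m - G x) * lap x) by bm_tac.
have bzp : bm (fun x => zeta x * gdot u phi x) by bm_tac.
have bzg : bm (fun x => zeta x * gsq u x) by bm_tac.
have k1 := @le_Int_comb _ _ _ 1 1 bml bGm bl2.
have k2 := @le_Int_comb _ _ _ 1 1 bQp bsQ bsp.
have k3 := @le_Int_comb _ _ _ eta^-1 eta bzp bzg bsp.
have {}k1 := k1 (fun x => @square_amgm (G x) m (lap x)).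
have {}k2 := k2 (fun x => @gdot_amgm1 Q phi x).
have {}k3 := k3 (fun x => @gdot_amgm_weight u phi eta (zeta x) x eta0 (zI x)).
have h3 := variance_le (erefl m).
have h4 := ler_wpM2l sigma0 gsq_Q_le.
have h5 := talenti cq qM T0.
have h6 : \int[leb]_(t in `[0, T]) (at_ t * (mud t * qt t)) +
    sigma * \int[leb]_(t in `[0, T]) (qt t ^+ 2 * mud t) = \int[leb]_(t in `[0, T]) (q (rt t) * mud t).
  rewrite -(Int_scale mT fT); last by bm_tac.
  rewrite -(Int_add mT fT); try by bm_tac.
  by apply: eq_Rintegral => t _; rewrite /at_ /qt; ring.
exact: (dual_arith sigma0 h1 E0 k1 k2 k3 h3 h4 h5 h6).
Qed.

End test_function_bound.

End dual_certificate.

End levels_of_near_minimizer.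

(** The scales are [e = dlt = x ^+ 5], height [T = x ^- 4] (plus [dlt]), [lam = x ^+ 2] and
    [eta = x]. The two critical products are [T] times the error per level, of order
    [x ^- 4 * x ^+ 5], and [eta^-1] times the tail, of order [x^-1 * x ^+ 2]; every term is then of
    order [x]. *)
Lemma plate_error_le (x a1 a2 a3 a4 a5 tc C0 rd Ph : R) : 0 < x <= 1 ->
  0 <= a1 -> 0 <= a2 -> 0 <= a3 -> 0 <= a4 -> 0 <= a5 ->
  x ^+ 5 * a1 + (x ^- 4 + x ^+ 5) * (x ^+ 5 * a2) + x ^+ 5 * a3 + x ^+ 5 * a4 +
  (x^-1 * (x ^+ 5 * a5 + rd * (2^-1 * (tc / (x ^+ 2 * x ^- 4)) + 2^-1 * (x ^+ 2 * C0))) + x * Ph)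
  <= x * (a1 + 2 * a2 + a3 + a4 + a5 + rd * (2^-1 * tc + 2^-1 * C0) + Ph).
Proof.
move=> /andP[x0 x1] h1 h2 h3 h4 h5.
have pw n a : 0 <= a -> x ^+ n.+1 * a <= x * a.
  move=> a0; rewrite ler_wpM2r// exprS ler_piMr ?(ltW x0)// exprn_ile1//.
  exact: ltW.
have -> : x ^+ 5 * a1 + (x ^- 4 + x ^+ 5) * (x ^+ 5 * a2) + x ^+ 5 * a3 + x ^+ 5 * a4 +
  (x^-1 * (x ^+ 5 * a5 + rd * (2^-1 * (tc / (x ^+ 2 * x ^- 4)) + 2^-1 * (x ^+ 2 * C0))) + x * Ph) =
  x ^+ 5 * a1 + x * a2 + x ^+ 10 * a2 + x ^+ 5 * a3 + x ^+ 5 * a4 + x ^+ 4 * a5 +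
  x * (rd * (2^-1 * tc + 2^-1 * C0)) + x * Ph.
  by field; rewrite gt_eqF.
have := pw 4 _ h1; have := pw 9 _ h2; have := pw 4 _ h3; have := pw 4 _ h4; have := pw 3 _ h5.
move: (x ^+ 5 * a1) (x ^+ 10 * a2) (x ^+ 5 * a3) (x ^+ 5 * a4) (x ^+ 4 * a5) => *.
rewrite !mulrDr [x * (2 * a2)]mulrCA; lra.
Qed.

(** * The bound for test functions, as the scale tends to zero *)

Section plate_bound.
Context (sigma Mq : R) (q : R -> R).
Hypotheses (sigma0 : 0 <= sigma) (cq : continuous q) (V_gt0 : 0 < V).
Hypothesis (qM : forall x, 0 <= x <= r -> 0 <= q x <= Mq).
Hypothesis (q1 : forall x, 0 <= x <= r -> 0 <= 1 - sigma * q x <= 1).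
Hypothesis ball_identity : forall p, 0 < p <= r ->
  om / d%:R * \int[leb]_(x in `[0, r])
    ((1 - sigma * q x) * (p ^+ d / Num.max x p ^+ d - p ^+ d / r ^+ d) * x ^+ d.+1)
  = om * p ^+ d * q p.

Lemma plate_bound phi : C1c Om phi -> (forall i, C1c Om (partial i phi)) ->
  2 * \int[mu]_(x in Om) phi x
  - \int[mu]_(x in Om) ((\sum_i partial i (partial i phi) x) ^+ 2)
  - sigma * \int[mu]_(x in Om) gsq phi x
  <= om / d%:R * \int[leb]_(x in `[0, r]) (q x * x ^+ d.+1).
Proof.
move=> Cphi Cdphi.
have Mq0 : 0 <= Mq by have /andP[h1 h2] := qM (introT andP (conj (lexx 0) r0)); exact: le_trans h2.
set Phi := \int[mu]_(x in Om) gsq phi x.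
have Ph0 : 0 <= Phi by apply: Rintegral_ge0 => x _; exact: gsq_ge0.
have C00 : 0 <= gradient_bound.
  by rewrite mulr_ge0// addr_ge0// addr_ge0 ?mulr_ge0 ?sqr_ge0.
set C0 := gradient_bound in C00.
set tc := tail_const C0.
set TB := om / d%:R * _.
pose a1 := 2 * (Mq * V) + (Mq ^+ 2 * C0 + 1).
pose a2 := 2 * V + (1 ^+ 2 * C0 + 1).
pose a3 := sigma * ((Mq ^+ 2) ^+ 2 * C0 + 1).
pose a4 := 2 * (Phi + 1).
pose a5 := V + (1 ^+ 2 * C0 + 1).
pose Ct := a1 + 2 * a2 + a3 + a4 + a5 + r / d%:R * (2^-1 * tc + 2^-1 * C0) + Phi.
have a10 : 0 <= a1 by rewrite /a1; nneg.
have a20 : 0 <= a2 by rewrite /a2; nneg.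
have a30 : 0 <= a3 by rewrite /a3; nneg.
have a40 : 0 <= a4 by rewrite /a4; nneg.
have a50 : 0 <= a5 by rewrite /a5; nneg.
have tc0 : 0 <= tc by rewrite /tc /tail_const; nneg.
have Ct0 : 0 <= Ct by rewrite /Ct; nneg.
apply/ler_addgt0Pr => eps eps0.
pose x := Num.min 1 (eps / (Ct + 1)).
have x0 : 0 < x by rewrite lt_min ltr01/= divr_gt0// ltr_wpDl.
have x1 : x <= 1 by rewrite ge_min lexx.
have xC : x * Ct <= eps.
  apply: (@le_trans _ _ (eps / (Ct + 1) * (Ct + 1))); last by rewrite divfK// gt_eqF// ltr_wpDl.
  apply: ler_pM => //; [exact: ltW| by rewrite ge_min lexx orbT|by rewrite lerDl].
have e0 : 0 < x ^+ 5 by rewrite exprn_gt0.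
have e1 : x ^+ 5 <= 1 by rewrite exprn_ile1// ltW.
have T0 : 0 < x ^- 4 by rewrite invr_gt0 exprn_gt0.
have l0 : 0 < x ^+ 2 by rewrite exprn_gt0.
have TD0 : 0 <= x ^- 4 + x ^+ 5 by rewrite addr_ge0// ltW.
have ee : 0 < x ^+ 5 <= 1 by rewrite e0.
have [u [Cu uC ncu]] := torsion_near_minimizer ee.
have h1 := dual_bound Cu e0 e0 uC ncu sigma0 cq TD0 V_gt0 qM q1 ball_identity Cphi Cdphi x0.
have h2 := truncation_energy Cu e0 e0 uC ncu TD0.
have h3 := tail_bound Cu e0 uC e1 l0 T0.
apply: (le_trans h1); rewrite lerD2l; apply: le_trans xC.
have xx : 0 < x <= 1 by rewrite x0.
have := plate_error_le tc C0 (r / d%:R) Phi xx a10 a20 a30 a40 a50; rewrite -/Ct.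
apply: le_trans.
have h4 := le_trans h2 (lerD h3 (lexx (en_err (x ^+ 5) C0 1))).
rewrite -/Phi; move: h4; set Z := (X in X <= _) => h4.
have h5 : x^-1 * Z <= x^-1 * (x ^+ 5 * a5 + r / d%:R * (2^-1 * (tc / (x ^+ 2 * x ^- 4)) + 2^-1 * (x ^+ 2 * C0))).
  rewrite ler_pM2l ?invr_gt0//; apply: (le_trans h4).
  rewrite /tail_err /en_err -/tc /a5 le_eqVlt; apply/orP; left; apply/eqP.
  by move: (r / d%:R * _) => y; ring.
apply: (@le_trans _ _ _ _ _ (lerD (lexx _) (lerD h5 (lexx (x * Phi))))).
rewrite le_eqVlt; apply/orP; left; apply/eqP.
congr (_ + _).
rewrite /en_err /a1 /a2 /a3 /a4 /C0 /Phi.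
by move: (x ^- 4) (x ^+ 5) gradient_bound (\int[mu]_(x in Om) _) V => y z c p v; ring.
Qed.

End plate_bound.

End torsion_energy.

(** * Jets and the plate form *)

Section sobolev.
Context {R : realType} (d : nat).
Local Notation E := 'rV[R]_d.
Local Notation mu := (lebesgue_rV d).
Context (Om : set E).
Hypotheses (mOm : measurable Om) (fOm : (mu Om < +oo)%E).
Local Notation V := (fine (mu Om)).
Local Notation sqi := (square_integrable Om).
Local Notation L1 f := (mu.-integrable Om (EFin \o f)).
Implicit Types (f g : E -> R) (U W : @jet2 R d).

Lemma sqi_mul f g : sqi f -> sqi g -> L1 (fun x => f x * g x).
Proof.
move=> [mf ff] [mg fg].
have mfg : measurable_fun Om (fun x => f x * g x) by exact: measurable_funM.
apply/integrableP; split; first exact/measurable_EFinP.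
apply: (@le_lt_trans _ _ (\int[mu]_(x in Om) ((f x ^+ 2)%:E + (g x ^+ 2)%:E))%E).
  apply: ge0_le_integral => //.
  - by apply: measurableT_comp => //; exact/measurable_EFinP.
  - by apply: emeasurable_funD; apply/measurable_EFinP; exact: measurable_funX.
  - move=> x _; rewrite -EFinD /= lee_fin normrM.
    rewrite -[f x ^+ 2]real_normK ?num_real// -[g x ^+ 2]real_normK ?num_real//.
    move: (normr_ge0 (f x)) (normr_ge0 (g x)); move: `|f x| `|g x| => a b a0 b0.
    have := sqr_ge0 (a - b); have := mulr_ge0 a0 b0; rewrite sqrrB; lra.
rewrite ge0_integralD//.
- exact: lte_add_pinfty.
- by move=> x _; rewrite lee_fin sqr_ge0.
- by apply/measurable_EFinP; exact: measurable_funX.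
- by move=> x _; rewrite lee_fin sqr_ge0.
- by apply/measurable_EFinP; exact: measurable_funX.
Qed.

Lemma sqi_sq f : sqi f -> L1 (fun x => f x ^+ 2).
Proof. by move=> sf; exact: sqi_mul. Qed.

Lemma L1_sqi f : measurable_fun Om f -> L1 (fun x => f x ^+ 2) -> sqi f.
Proof.
move=> mf /integrableP[_ H]; split => //; apply: le_lt_trans H.
rewrite le_eqVlt; apply/orP; left; apply/eqP; apply: eq_integral => x _ /=.
by rewrite ger0_norm// sqr_ge0.
Qed.

Lemma L1_add f g : L1 f -> L1 g -> L1 (fun x => f x + g x).
Proof. exact: integrableD. Qed.

Lemma L1_scale k f : L1 f -> L1 (fun x => k * f x).
Proof. exact: integrableZl. Qed.

Lemma L1_sum I (s : seq I) (F : I -> E -> R) : (forall i, L1 (F i)) ->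
  L1 (fun x => \sum_(i <- s) F i x).
Proof.
move=> LF; elim: s => [|i s IH].
  by under eq_fun do rewrite big_nil; apply: (bm_integrable mOm fOm); exact: bm_cst.
by under eq_fun do rewrite big_cons; exact: L1_add.
Qed.

Lemma Rint_sum I (s : seq I) (F : I -> E -> R) : (forall i, L1 (F i)) ->
  \int[mu]_(x in Om) (\sum_(i <- s) F i x) = \sum_(i <- s) \int[mu]_(x in Om) F i x.
Proof.
move=> LF; elim: s => [|i s IH].
  under eq_Rintegral do rewrite big_nil.
  by rewrite big_nil Rintegral_cst// mul0r.
under eq_Rintegral do rewrite big_cons.
by rewrite big_cons -IH RintegralD//; exact: L1_sum.
Qed.

Lemma sqi_add f g : sqi f -> sqi g -> sqi (fun x => f x + g x).
Proof.
move=> sf sg; apply: L1_sqi.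
  by apply: measurable_funD; [case: sf|case: sg].
have -> : (fun x => (f x + g x) ^+ 2) = (fun x => (f x ^+ 2 + 2 * (f x * g x)) + g x ^+ 2).
  by apply/funext => x; ring.
by apply: L1_add; [apply: L1_add; [exact: sqi_sq|exact/L1_scale/sqi_mul]|exact: sqi_sq].
Qed.

Lemma sqi_opp f : sqi f -> sqi (fun x => - f x).
Proof.
move=> [mf H]; split; first exact: measurableT_comp.
by under eq_integral do rewrite sqrrN.
Qed.

Lemma sqi_sub f g : sqi f -> sqi g -> sqi (fun x => f x - g x).
Proof. by move=> sf sg; apply: sqi_add => //; exact: sqi_opp. Qed.

Lemma bm_sqi f : bm f -> sqi f.
Proof.
move=> bf; apply: L1_sqi; first by apply: (@measurable_funS _ _ _ _ setT) => //; exact: bm_meas.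
by apply: (bm_integrable mOm fOm); exact: bm_exp.
Qed.

Lemma sqi_sum I (s : seq I) (F : I -> E -> R) : (forall i, sqi (F i)) ->
  sqi (fun x => \sum_(i <- s) F i x).
Proof.
move=> sF; elim: s => [|i s IH].
  by under eq_fun do rewrite big_nil; exact/bm_sqi/bm_cst.
by under eq_fun do rewrite big_cons; exact: sqi_add.
Qed.

Lemma sqi_L1 f : sqi f -> L1 f.
Proof.
move=> sf; have := sqi_mul sf (bm_sqi (bm_cst _ 1)).
by apply: eq_integrable => // x _ /=; rewrite mulr1.
Qed.

Definition sqi_jet U := [/\ sqi U, forall i, sqi (grad U i) & forall i j, sqi (hess U i j)].

Lemma sqi_jet_sub U W : sqi_jet U -> sqi_jet W -> sqi_jet (jet_sub U W).
Proof.
by move=> [a1 a2 a3] [b1 b2 b3]; split => [|i|i j] /=; exact: sqi_sub.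
Qed.

Definition H2_norm2 U := \int[mu]_(x in Om) (U x ^+ 2)
  + \sum_i \int[mu]_(x in Om) (grad U i x ^+ 2)
  + \sum_i \sum_j \int[mu]_(x in Om) (hess U i j x ^+ 2).

Lemma sqnorm_H2E U : sqi_jet U -> sqnorm_H2 Om U = (H2_norm2 U)%:E.
Proof.
move=> [a1 a2 a3]; rewrite /sqnorm_H2 /H2_norm2 !EFinD -!sumEFin.
have H f : sqi f -> (\int[mu]_(x in Om) (f x ^+ 2)%:E)%E = (\int[mu]_(x in Om) (f x ^+ 2))%:E.
  by move=> sf; rewrite /Rintegral fineK//; apply: integrable_fin_num => //; exact: sqi_sq.
congr (_ + _ + _)%E; first exact: H.
  by apply: eq_bigr => i _; exact: H.
by apply: eq_bigr => i _; rewrite -sumEFin; apply: eq_bigr => j _; exact: H.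
Qed.

Definition plate_form (sigma : R) U W :=
  \int[mu]_(x in Om) (laplacian U x * laplacian W x)
  + sigma * \int[mu]_(x in Om) (\sum_i grad U i x * grad W i x).

Lemma plate_formC sigma U W : plate_form sigma U W = plate_form sigma W U.
Proof.
rewrite /plate_form; congr (_ + _ * _); first by apply: eq_Rintegral => x _; rewrite mulrC.
by apply: eq_Rintegral => x _; apply: eq_bigr => i _; rewrite mulrC.
Qed.

Lemma sqi_laplacian U : sqi_jet U -> sqi (laplacian U).
Proof. by move=> [_ _ a3]; apply: sqi_sum => i; exact: a3. Qed.

Lemma L1_grad_dot U W : sqi_jet U -> sqi_jet W -> L1 (fun x => \sum_i grad U i x * grad W i x).
Proof. by move=> [_ a2 _] [_ b2 _]; apply: L1_sum => i; exact: sqi_mul. Qed.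

Lemma laplacian_sub U W x : laplacian (jet_sub U W) x = laplacian U x - laplacian W x.
Proof. by rewrite /laplacian /= sumrB. Qed.

Lemma plate_form_subr sigma U W Z : sqi_jet U -> sqi_jet W -> sqi_jet Z ->
  plate_form sigma U (jet_sub W Z) = plate_form sigma U W - plate_form sigma U Z.
Proof.
move=> sU sW sZ; have lU := sqi_laplacian sU; have lW := sqi_laplacian sW; have lZ := sqi_laplacian sZ.
have := RintegralB mOm (sqi_mul lU lW) (sqi_mul lU lZ).
have := RintegralB mOm (L1_grad_dot sU sW) (L1_grad_dot sU sZ).
rewrite /plate_form.
have -> : \int[mu]_(x in Om) (laplacian U x * laplacian (jet_sub W Z) x) =
   \int[mu]_(x in Om) (laplacian U x * laplacian W x - laplacian U x * laplacian Z x).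
  by apply: eq_Rintegral => x _; rewrite laplacian_sub mulrBr.
have -> : \int[mu]_(x in Om) (\sum_i grad U i x * grad (jet_sub W Z) i x) =
   \int[mu]_(x in Om) (\sum_i grad U i x * grad W i x - \sum_i grad U i x * grad Z i x).
  by apply: eq_Rintegral => x _; rewrite -sumrB; apply: eq_bigr => i _ /=; rewrite mulrBr.
by move=> -> ->; rewrite mulrBr opprD addrACA.
Qed.

Lemma plate_form_sub sigma U W : sqi_jet U -> sqi_jet W ->
  plate_form sigma (jet_sub U W) (jet_sub U W) =
  plate_form sigma U U - 2 * plate_form sigma U W + plate_form sigma W W.
Proof.
move=> sU sW; have sD := sqi_jet_sub sU sW.
rewrite plate_form_subr// !(plate_formC sigma (jet_sub U W)) !plate_form_subr//.
by rewrite (plate_formC sigma W U); ring.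
Qed.

Lemma H2_norm2_terms U : sqi_jet U ->
  [/\ \int[mu]_(x in Om) (U x ^+ 2) <= H2_norm2 U,
      \int[mu]_(x in Om) (\sum_i grad U i x * grad U i x) <= H2_norm2 U &
      \int[mu]_(x in Om) (laplacian U x * laplacian U x) <= d%:R * H2_norm2 U].
Proof.
move=> [a1 a2 a3].
have p (f : E -> R) : 0 <= \int[mu]_(x in Om) (f x ^+ 2).
  by apply: Rintegral_ge0 => x _; exact: sqr_ge0.
have p1 : 0 <= \sum_i \int[mu]_(x in Om) (grad U i x ^+ 2) by apply: sumr_ge0.
have p2 : 0 <= \sum_i \sum_j \int[mu]_(x in Om) (hess U i j x ^+ 2).
  by apply: sumr_ge0 => i _; apply: sumr_ge0.
have p0 := p U.
split; first by rewrite /H2_norm2 -addrA lerDl addr_ge0.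
  rewrite (Rint_sum _ (F := fun i x => grad U i x * grad U i x)); last by move=> i; exact: sqi_mul.
  rewrite /H2_norm2 addrAC -[leLHS]add0r lerD// addr_ge0//.
have pt x : laplacian U x * laplacian U x <= d%:R * \sum_i hess U i i x ^+ 2.
  have := @sum_CS R d (fun=> 1) (fun i => hess U i i x).
  under eq_bigr do rewrite mul1r.
  have -> : \sum_(i < d) (1 : R) ^+ 2 = d%:R.
    by under eq_bigr do rewrite expr1n; rewrite sumr_const card_ord.
  rewrite -/(laplacian U x) => H.
  rewrite -expr2 -real_normK ?num_real//.
  have s0 : 0 <= \sum_i hess U i i x ^+ 2 by apply: sumr_ge0 => i _; exact: sqr_ge0.
  apply: (@le_trans _ _ ((Num.sqrt d%:R * Num.sqrt (\sum_i hess U i i x ^+ 2)) ^+ 2)).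
    by rewrite lerXn2r// nnegrE ?mulr_ge0 ?sqrtr_ge0.
  by rewrite exprMn !sqr_sqrtr.
have sl : sqi (laplacian U) by apply: sqi_sum => i; exact: a3.
have ss : L1 (fun x => \sum_i hess U i i x ^+ 2) by apply: L1_sum => i; exact/sqi_sq/a3.
apply: (@le_trans _ _ (\int[mu]_(x in Om) (d%:R * \sum_i hess U i i x ^+ 2))).
  by apply: le_Rintegral => //; [exact: sqi_mul|exact: L1_scale].
rewrite RintegralZl// ler_wpM2l// Rint_sum; last by move=> i; exact/sqi_sq/a3.
rewrite /H2_norm2 -[leLHS]add0r lerD ?addr_ge0//.
apply: ler_sum => i _; rewrite (bigD1 i)//= lerDl.
by apply: sumr_ge0.
Qed.

Lemma plate_form_le sigma U : 0 <= sigma -> sqi_jet U ->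
  plate_form sigma U U <= (d%:R + sigma) * H2_norm2 U.
Proof.
move=> s0 /H2_norm2_terms[_ h1 h2]; rewrite mulrDl lerD// ler_wpM2l//.
Qed.

Lemma H2_sqi_jet U : H2 Om U -> sqi_jet U.
Proof. by move=> [h1 h2 h3]; split => // [i|i j]; [case: (h2 i)|case: (h3 i j)]. Qed.

Lemma H2_norm2_ge0 U : 0 <= H2_norm2 U.
Proof.
by rewrite !addr_ge0//; do ?[apply: sumr_ge0 => ? _|apply: Rintegral_ge0 => ? _; exact: sqr_ge0].
Qed.

Section test_functions.
Variable (phi : E -> R).
Hypothesis (tphi : test_function Om phi).

Let iterated_C1c s : C1c Om (foldr (@partial R d) phi s).
Proof.
case: tphi => sphi cK KO; elim: s => [|i s [IH1 IH2 [K cK' [KO' H]]]].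
  split => [x|i|]; first exact: (sphi [::] x).
    by move=> x; apply: differentiable_continuous; exact: (sphi [:: i] x).
  exists (closure [set x | phi x != 0]) => //; split => // x /= nx.
  by apply: contrapT => /eqP px; apply: nx; exact: subset_closure.
split => [x|j|].
- exact: (sphi (i :: s) x).
- by move=> x; apply: differentiable_continuous; exact: (sphi (j :: i :: s) x).
- by exists K => //; split => //; exact: partial_supp.
Qed.

Lemma test_function_C1c : C1c Om phi. Proof. exact: (iterated_C1c [::]). Qed.
Lemma test_function_partial_C1c i : C1c Om (partial i phi). Proof. exact: (iterated_C1c [:: i]). Qed.
Lemma test_function_partial2_C1c i j : C1c Om (partial j (partial i phi)).
Proof. exact: (iterated_C1c [:: j; i]). Qed.

End test_functions.

Lemma sqi_jet_test phi : test_function Om phi -> sqi_jet (jet_of phi).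
Proof.
move=> tp; split => [|i|i j] /=; apply: bm_sqi.
- exact: C1c_bm (test_function_C1c tp).
- exact: C1c_bm (test_function_partial_C1c tp i).
- exact: C1c_bm (test_function_partial2_C1c tp i j).
Qed.

Lemma H20_test phi : test_function Om phi -> H20 Om (jet_of phi).
Proof.
move=> tp; have [s1 s2 s3] := sqi_jet_test tp; split.
  have wp f i : C1c Om f -> weak_partial Om i f (partial i f).
    by move=> [df cf _] psi tpsi; exact: Int_by_parts (test_function_C1c tpsi) df cf.
  split => // [i|i j]; split => //; apply: wp; first exact: test_function_C1c.
  exact: test_function_partial_C1c.
exists (fun=> phi); split => //.
rewrite (_ : (fun _ : nat => _) = fun=> 0%E); first exact: cvg_cst.
apply/funext => _; rewrite sqnorm_H2E; last exact: sqi_jet_sub (sqi_jet_test tp) (sqi_jet_test tp).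
congr EFin; rewrite /H2_norm2.
have z (f : E -> R) : \int[mu]_(x in Om) ((f x - f x) ^+ 2) = 0.
  by under eq_Rintegral do rewrite subrr expr0n; rewrite Rintegral_cst// mul0r.
transitivity (0 + \sum_(i < d) (0 : R) + \sum_(i < d) \sum_(j < d) (0 : R)).
  congr (_ + _ + _); first exact: (z phi).
    by apply: eq_bigr => i _; exact: (z (partial i phi)).
  by apply: eq_bigr => i _; apply: eq_bigr => j _; exact: (z (partial j (partial i phi))).
by rewrite big1_eq big1 ?addr0// => i _; rewrite big1_eq.
Qed.

Lemma H20_approx U (eps : R) : 0 < eps -> H20 Om U ->
  exists2 phi, test_function Om phi & H2_norm2 (jet_sub U (jet_of phi)) < eps.
Proof.
move=> e0 [HU [phi [tphi cv]]]; have sU := H2_sqi_jet HU.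
move/fine_cvgP : cv => [_ /cvgrPdist_lt/(_ _ e0)].
move=> [N _ /(_ N (leqnn N))] /= H; exists (phi N) => //.
move: H; rewrite sqnorm_H2E; last exact: sqi_jet_sub sU (sqi_jet_test (tphi N)).
by rewrite sub0r normrN /= => /(le_lt_trans (ler_norm _)).
Qed.

Lemma torsional_rigidity_le (sigma TB : R) : 0 <= sigma -> 0 <= TB ->
  (forall phi, test_function Om phi ->
    2 * \int[mu]_(x in Om) phi x
    - \int[mu]_(x in Om) ((\sum_i partial i (partial i phi) x) ^+ 2)
    - sigma * \int[mu]_(x in Om) gsq phi x <= TB) ->
  torsional_rigidity Om sigma <= TB.
Proof.
move=> s0 TB0 H; rewrite /torsional_rigidity /torsion_function.
(* In the branch without a torsion function [xget] returns zero, and [0 <= TB] concludes. *)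
case: xgetP => [w _ [W [WE HW wW]]|_]; last by rewrite Rintegral_cst// mul0r.
have sW : sqi_jet W by case: HW => /H2_sqi_jet.
rewrite -WE; apply/ler_addgt0Pr => eps e0.
have c0 : 0 < d%:R + sigma + 1 by rewrite ltr_wpDl// addr_ge0.
have [phi tp Hp] := H20_approx (divr_gt0 e0 c0) HW.
have sp := sqi_jet_test tp; have sD := sqi_jet_sub sW sp.
have E1 := wW _ HW; have E2 := wW _ (H20_test tp).
have E3 := plate_form_sub sigma sW sp; have E4 := plate_form_le s0 sD.
have E5 : plate_form sigma (jet_of phi) (jet_of phi) =
   \int[mu]_(x in Om) ((\sum_i partial i (partial i phi) x) ^+ 2)
    + sigma * \int[mu]_(x in Om) gsq phi x.
  by [].
have E6 := H _ tp.
have E7 : (d%:R + sigma) * H2_norm2 (jet_sub W (jet_of phi)) <= eps.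
  apply: (@le_trans _ _ ((d%:R + sigma + 1) * (eps / (d%:R + sigma + 1)))).
    apply: (@le_trans _ _ ((d%:R + sigma + 1) * H2_norm2 (jet_sub W (jet_of phi)))).
      by rewrite ler_wpM2r ?H2_norm2_ge0// lerDl.
    by rewrite ler_wpM2l ?(ltW c0)// ltW.
  by rewrite mulrC divfK// gt_eqF.
rewrite -/(plate_form sigma W W) in E1; rewrite -/(plate_form sigma W (jet_of phi)) in E2.
move: E1 E2 E3 E4 E5 E6 E7 => /=.
move: (plate_form _ _ _) (plate_form _ _ _) (plate_form _ _ _) (plate_form _ _ _) => a1 a2 a3 a4.
move: (_ * H2_norm2 _) (\int[mu]_(x in Om) W x) (\int[mu]_(x in Om) phi x) => a5 a6 a7.
move: (\int[mu]_(x in Om) _) (sigma * _) => a8 a9.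
by move=> *; lra.
Qed.

(** The sign [s], with [s ^+ 2 = 1], states both halves of an absolute value bound at once. *)
Lemma L2_amgm f g (s k : R) : sqi f -> sqi g -> s ^+ 2 = 1 -> 0 < k ->
  s * \int[mu]_(x in Om) (f x * g x) <=
  k * \int[mu]_(x in Om) (f x * f x) + k^-1 * \int[mu]_(x in Om) (g x * g x).
Proof.
move=> sf sg s1 k0; rewrite -!RintegralZl//; try exact: sqi_mul.
rewrite -RintegralD//; try by apply: L1_scale; exact: sqi_mul.
apply: le_Rintegral => //.
- by apply: L1_scale; exact: sqi_mul.
- by apply: L1_add; apply: L1_scale; exact: sqi_mul.
move=> x _; move: (f x) (g x) => a b.
have h1 : 0 <= k^-1 * (k * a - s * b) ^+ 2 by rewrite mulr_ge0 ?sqr_ge0 ?invr_ge0// ltW.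
have h2 : 0 <= k^-1 * (k * a + s * b) ^+ 2 by rewrite mulr_ge0 ?sqr_ge0 ?invr_ge0// ltW.
have E1 : k^-1 * (k * a - s * b) ^+ 2 = k * (a * a) + s ^+ 2 * (k^-1 * (b * b)) - 2 * (s * (a * b)).
  by field; rewrite gt_eqF.
have E2 : k^-1 * (k * a + s * b) ^+ 2 = k * (a * a) + s ^+ 2 * (k^-1 * (b * b)) + 2 * (s * (a * b)).
  by field; rewrite gt_eqF.
move: h1 h2; rewrite E1 E2 s1 mul1r; lra.
Qed.

Lemma plate_form_amgm sigma U W (s k : R) : 0 <= sigma -> sqi_jet U -> sqi_jet W ->
  s ^+ 2 = 1 -> 0 < k ->
  s * plate_form sigma U W <= k * plate_form sigma U U + k^-1 * plate_form sigma W W.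
Proof.
move=> s0 sU sW s1 k0; have := L2_amgm (sqi_laplacian sU) (sqi_laplacian sW) s1 k0.
have H (Z1 Z2 : @jet2 R d) : sqi_jet Z1 -> sqi_jet Z2 -> \int[mu]_(x in Om) (\sum_i grad Z1 i x * grad Z2 i x) =
    \sum_i \int[mu]_(x in Om) (grad Z1 i x * grad Z2 i x).
  by move=> [_ a2 _] [_ b2 _]; rewrite Rint_sum// => i; exact: sqi_mul.
rewrite /plate_form !H//.
have : s * (\sum_i \int[mu]_(x in Om) (grad U i x * grad W i x)) <=
   k * (\sum_i \int[mu]_(x in Om) (grad U i x * grad U i x)) +
   k^-1 * (\sum_i \int[mu]_(x in Om) (grad W i x * grad W i x)).
  rewrite !mulr_sumr -big_split /=; apply: ler_sum => i _.
  by case: sU sW => _ a2 _ [_ b2 _]; exact: L2_amgm.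
move=> /(ler_wpM2l s0) h1 h2.
by move: h1; rewrite !mulrDr !(mulrCA _ sigma); lra.
Qed.

Lemma weak_arith (s P I A b v k a n : R) : s * P <= k * A + k^-1 * a ->
  - s * I <= k * v + k^-1 * n -> k^-1 * a <= b * k -> k^-1 * n <= k ->
  s * (P - I) <= k * (A + b + (v + 1)).
Proof. by rewrite mulrBr !mulrDr mulr1 mulNr [k * b]mulrC; lra. Qed.

(** Density: approximating [U] by a test function with squared distance below [k ^+ 2] changes both
    sides by a multiple of [k], uniformly in [k] and for both signs. *)
Lemma weak_equation_H20 sigma W : 0 <= sigma -> sqi_jet W ->
  (forall phi, test_function Om phi ->
    plate_form sigma W (jet_of phi) = \int[mu]_(x in Om) phi x) ->
  forall U, H20 Om U -> plate_form sigma W U = \int[mu]_(x in Om) U x.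
Proof.
move=> s0 sW HW U HU; have sU : sqi_jet U by case: HU => /H2_sqi_jet.
pose A := plate_form sigma W W; pose C := A + (d%:R + sigma) + (V + 1).
have A0 : 0 <= A.
  rewrite /A /plate_form addr_ge0 ?mulr_ge0//; apply: Rintegral_ge0 => x _.
    by rewrite -expr2 sqr_ge0.
  by apply: sumr_ge0 => i _; rewrite -expr2 sqr_ge0.
have V0 : 0 <= V by exact: fine_ge0.
have C0 : 0 < C.
  have dn : 0 <= d%:R :> R := ler0n _ _.
  by rewrite /C; lra.
have key (s k : R) : s ^+ 2 = 1 -> 0 < k ->
    s * (plate_form sigma W U - \int[mu]_(x in Om) U x) <= k * C.
  move=> s1 k0; have [phi tp Hp] := H20_approx (exprn_gt0 2 k0) HU.
  have sp := sqi_jet_test tp; have sD := sqi_jet_sub sU sp.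
  have [h1 _ _] := H2_norm2_terms sD.
  have E1 := plate_form_subr sigma sW sU sp; rewrite HW// in E1.
  have E2 : \int[mu]_(x in Om) jet_sub U (jet_of phi) x =
     \int[mu]_(x in Om) U x - \int[mu]_(x in Om) phi x.
    have sU0 : sqi U by case: sU.
    have sp0 : sqi phi by case: sp.
    by rewrite -RintegralB//; exact: sqi_L1.
  have -> : plate_form sigma W U - \int[mu]_(x in Om) U x =
     plate_form sigma W (jet_sub U (jet_of phi)) - \int[mu]_(x in Om) jet_sub U (jet_of phi) x.
    by rewrite E1 E2; ring.
  set D := jet_sub U (jet_of phi) in h1 sD Hp *.
  have h2 := plate_form_amgm s0 sW sD s1 k0.
  have s1' : (- s) ^+ 2 = 1 by rewrite sqrrN.
  have s1D : sqi D by case: sD.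
  have h3 := L2_amgm (bm_sqi (bm_cst _ (1 : R))) s1D s1' k0.
  have h4 := plate_form_le s0 sD.
  have E3 : \int[mu]_(x in Om) (1 * D x) = \int[mu]_(x in Om) D x.
    by apply: eq_Rintegral => x _; rewrite mul1r.
  have E4 : \int[mu]_(x in Om) ((1 : R) * 1) = V.
    by rewrite Rintegral_cst// mulr1 mul1r.
  have E5 : \int[mu]_(x in Om) (D x * D x) = \int[mu]_(x in Om) (D x ^+ 2) by [].
  have N0 := H2_norm2_ge0 D.
  have h5 : k^-1 * H2_norm2 D <= k.
    by rewrite mulrC ler_pdivrMr// -expr2 ltW.
  have h6 : k^-1 * plate_form sigma D D <= (d%:R + sigma) * k.
    apply: (@le_trans _ _ ((d%:R + sigma) * (k^-1 * H2_norm2 D))).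
      by rewrite mulrCA ler_pM2l ?invr_gt0.
    by rewrite ler_wpM2l// addr_ge0.
  have h7 : k^-1 * \int[mu]_(x in Om) (D x ^+ 2) <= k.
    by apply: le_trans h5; rewrite ler_pM2l ?invr_gt0.
  move: h3; rewrite E3 E4 E5 => h3.
  exact: weak_arith h2 h3 h6 h7.
have le0 (s : R) : s ^+ 2 = 1 -> s * (plate_form sigma W U - \int[mu]_(x in Om) U x) <= 0.
  move=> s1; apply/ler_addgt0Pr => eps e0; rewrite add0r.
  by have := key s _ s1 (divr_gt0 e0 C0); rewrite divfK// gt_eqF.
apply/eqP; rewrite -subr_eq0 eq_le; apply/andP; split.
  by have := le0 1 (expr1n _ _); rewrite mul1r.
by have := le0 (-1); rewrite sqrrN expr1n mulN1r oppr_le0; apply.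
Qed.

(** Two solutions have the same integral: test the equation of each with the other and use the
    symmetry of the form. Hence the representative picked by [xget] is immaterial. *)
Lemma torsional_rigidityE sigma W : 0 <= sigma -> H20 Om W ->
  (forall phi, test_function Om phi ->
    plate_form sigma W (jet_of phi) = \int[mu]_(x in Om) phi x) ->
  torsional_rigidity Om sigma = \int[mu]_(x in Om) W x.
Proof.
move=> s0 HW wW; have sW : sqi_jet W by case: HW => /H2_sqi_jet.
have eW := weak_equation_H20 s0 sW wW.
rewrite /torsional_rigidity /torsion_function.
case: xgetP => [w _ [W' [<- HW' eW']]|/(_ (jfun W)) []]; last by exists W.
by rewrite -(eW _ HW') plate_formC; exact: eW' _ HW.
Qed.

End sobolev.

(** * The radial profile *)

Section smooth_line.
Context {R : realType}.
Implicit Types (f g h : R -> R).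

(** Differentiability of order [n] with the derivatives as explicit witnesses; closure under
    products and compositions is then an induction on [n], with all functions generalised. *)
Fixpoint n_smooth n h := if n is n'.+1 then exists2 h', has_deriv h h' & n_smooth n' h' else True.
Definition smooth1 h := forall n, n_smooth n h.

Lemma n_smoothS n h : n_smooth n.+1 h -> n_smooth n h.
Proof. by elim: n h => // n IH h [h' hh' H]; exists h' => //; exact: IH. Qed.

Lemma has_deriv_cst (k : R) : has_deriv (fun=> k) (fun=> 0).
Proof. by move=> x; exact: is_derive_cst. Qed.

Lemma has_deriv_add f g f' g' : has_deriv f f' -> has_deriv g g' ->
  has_deriv (fun x => f x + g x) (fun x => f' x + g' x).
Proof. by move=> df dg x; exact: is_deriveD. Qed.

Lemma has_deriv_mul f g f' g' : has_deriv f f' -> has_deriv g g' ->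
  has_deriv (fun x => f x * g x) (fun x => f x * g' x + g x * f' x).
Proof. by move=> df dg x; exact: is_deriveM. Qed.

Lemma has_deriv_scale (k : R) f f' : has_deriv f f' ->
  has_deriv (fun x => k * f x) (fun x => k * f' x).
Proof. by move=> df x; exact: is_deriveZ. Qed.

Lemma has_deriv_id : has_deriv (fun x : R => x) (fun=> 1).
Proof. by move=> x; exact: is_derive_id. Qed.

Lemma has_deriv_shift (k : R) f f' : has_deriv f f' -> has_deriv (fun x => f x + k) f'.
Proof. by move=> df x; have := has_deriv_add df (has_deriv_cst k) x; rewrite addr0. Qed.

Lemma eq_has_deriv f g f' g' : f =1 g -> f' =1 g' -> has_deriv f f' -> has_deriv g g'.
Proof. by move=> /funext -> /funext ->. Qed.

Lemma n_smooth_cst n (k : R) : n_smooth n (fun=> k).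
Proof. by elim: n k => // n IH k; exists (fun=> 0) => //; exact: has_deriv_cst. Qed.

Lemma n_smooth_add n f g : n_smooth n f -> n_smooth n g -> n_smooth n (fun x => f x + g x).
Proof.
elim: n f g => // n IH f g [f' df sf] [g' dg sg].
by exists (fun x => f' x + g' x); [exact: has_deriv_add|exact: IH].
Qed.

Lemma n_smooth_mul n f g : n_smooth n f -> n_smooth n g -> n_smooth n (fun x => f x * g x).
Proof.
elim: n f g => // n IH f g sf sg; move: (n_smoothS sf) (n_smoothS sg) => sf0 sg0.
case: sf sg => [f' df sf] [g' dg sg].
exists (fun x => f x * g' x + g x * f' x); first exact: has_deriv_mul.
by apply: n_smooth_add; exact: IH.
Qed.

Lemma n_smooth_comp n f g : n_smooth n f -> n_smooth n g -> n_smooth n (fun x => f (g x)).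
Proof.
elim: n f g => // n IH f g sf sg; move: (n_smoothS sg) => sg0.
case: sf sg => [f' df sf] [g' dg sg].
exists (fun x => f' (g x) * g' x); first exact: has_deriv_compose.
by apply: n_smooth_mul => //; exact: IH.
Qed.

Lemma smooth1_cst k : smooth1 (fun=> k). Proof. by move=> n; exact: n_smooth_cst. Qed.
Lemma smooth1_add f g : smooth1 f -> smooth1 g -> smooth1 (fun x => f x + g x).
Proof. by move=> sf sg n; exact: n_smooth_add. Qed.
Lemma smooth1_mul f g : smooth1 f -> smooth1 g -> smooth1 (fun x => f x * g x).
Proof. by move=> sf sg n; exact: n_smooth_mul. Qed.
Lemma smooth1_comp f g : smooth1 f -> smooth1 g -> smooth1 (fun x => f (g x)).
Proof. by move=> sf sg n; exact: n_smooth_comp. Qed.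
Lemma smooth1_id : smooth1 (fun x => x).
Proof. by case=> // n; exists (fun=> 1); [exact: has_deriv_id|exact: n_smooth_cst]. Qed.
Lemma smooth1_scale k f : smooth1 f -> smooth1 (fun x => k * f x).
Proof. by move=> sf; apply: smooth1_mul => //; exact: smooth1_cst. Qed.
Lemma smooth1_sub f g : smooth1 f -> smooth1 g -> smooth1 (fun x => f x - g x).
Proof.
move=> sf sg; rewrite (_ : (fun _ => _) = fun x => f x + -1 * g x); last first.
  by apply/funext => x; rewrite mulN1r.
by apply: smooth1_add => //; exact: smooth1_scale.
Qed.

(* Derivatives of [exp (- 1 / t)] stay in the span of these functions. *)
Definition flat k (t : R) : R := if 0 < t then t^-1 ^+ k * expR (- t^-1) else 0.

Lemma flat_le0 k t : t <= 0 -> flat k t = 0.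
Proof. by rewrite /flat ltNge => ->. Qed.

(** Compare [expR t^-1] with the term of order [k.+2] of its series. The quadratic bound gives the
    zero derivative at the origin. *)
Lemma flat_bound k t : `|flat k t| <= k.+2`!%:R * t ^+ 2.
Proof.
rewrite /flat; case: ltP => t0; last by rewrite normr0 mulr_ge0 ?sqr_ge0.
have X0 : 0 < t^-1 by rewrite invr_gt0.
rewrite ger0_norm ?mulr_ge0 ?expR_ge0 ?exprn_ge0 ?(ltW X0)//.
have := expR_ge1Dxn k.+1 (ltW X0); move: (expR_gt0 t^-1); rewrite expRN => e0 H.
have F0 : 0 < k.+2`!%:R :> R by rewrite ltr0n fact_gt0.
have H1 : t^-1 ^+ k.+2 <= k.+2`!%:R * expR t^-1.
  rewrite -ler_pdivrMl// mulrC; apply: le_trans H.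
  by rewrite lerDr.
rewrite ler_pdivrMr// (_ : t^-1 ^+ k = t^-1 ^+ k.+2 * t ^+ 2).
  by rewrite [leRHS]mulrAC ler_wpM2r ?sqr_ge0.
by rewrite -addn2 exprD -mulrA -exprMn mulVf ?gt_eqF// expr1n mulr1.
Qed.

Lemma flat_deriv k : has_deriv (flat k) (fun t => - k%:R * flat k.+1 t + flat k.+2 t).
Proof.
move=> t; have [t0|t0|t0] := ltgtP t 0.
- rewrite !flat_le0 ?(ltW t0)// mulr0 addr0.
  have dz : is_derive t (1 : R) (fun=> 0 : R) 0 by exact: is_derive_cst.
  apply: (near_eq_is_derive _ dz).
  near=> y; rewrite flat_le0// ltW//; near: y.
  exact: lt_nbhsl.
- have X0 : 0 < t^-1 by rewrite invr_gt0.
  have dV : is_derive t (1 : R) (fun t : R => t^-1) (- t ^- 2 * 1).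
    have t1 : t != 0 by rewrite gt_eqF.
    have := @is_deriveV R id t 1 1 t1 (is_derive_id _ _).
    by rewrite /GRing.scale/=.
  have dX : is_derive t (1 : R) (fun t : R => t^-1 ^+ k) (k%:R * t^-1 ^+ k.-1 * (- t ^- 2 * 1)).
    have := @is_deriveX _ _ (fun t : R => t^-1) k t 1 _ dV.
    by rewrite exprfctE.
  have dE : is_derive t (1 : R) (fun t : R => expR (- t^-1)) (expR (- t^-1) * (- (- t ^- 2 * 1))).
    exact: (@is_derive1_comp R expR (fun t => - t^-1) t _ _ (is_derive_expR _) (is_deriveN dV)).
  have := is_deriveM dX dE; rewrite /flat t0 => H.
  have E : - k%:R * (t^-1 ^+ k.+1 * expR (- t^-1)) + t^-1 ^+ k.+2 * expR (- t^-1) =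
    t^-1 ^+ k *: (expR (- t^-1) * (- (- t ^- 2 * 1))) + expR (- t^-1) *: (k%:R * t^-1 ^+ k.-1 * (- t ^- 2 * 1)).
    rewrite /GRing.scale/= -!exprVn; case: k {dX H} => [|k]/=; first by rewrite mulr0n; ring.
    by rewrite !exprS; ring.
  rewrite E; apply: (near_eq_is_derive _ H).
  near=> y; rewrite ifT//; near: y; exact: lt_nbhsr.
- rewrite t0 !flat_le0// mulr0 addr0.
  have E : (fun h : R => h^-1 *: ((flat k \o shift (0 : R)) (h *: (1 : R)) - flat k 0)) @ 0^' --> (0 : R).
    apply/cvgr0Pnorm_le => e e0.
    have F0 : 0 < k.+2`!%:R :> R by rewrite ltr0n fact_gt0.
    near=> h; have h0 : h != 0 by near: h; exact: nbhs_dnbhs_neq.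
    rewrite /= [h *: (1 : R)]mulr1 addr0 (@flat_le0 k 0 (lexx 0)) subr0 normrM normfV.
    rewrite mulrC ler_pdivrMr ?normr_gt0//; apply: (le_trans (flat_bound _ _)).
    rewrite -real_normK ?num_real// expr2 mulrA ler_wpM2r//.
    rewrite mulrC -ler_pdivlMr//; near: h; apply: dnbhs0_le; exact: divr_gt0.
  apply: DeriveDef; first by apply/cvg_ex; exists 0.
  exact: cvg_lim.
Unshelve. all: end_near. Qed.

Lemma smooth1_flat k : smooth1 (flat k).
Proof.
move=> n; elim: n k => // n IH k.
exists (fun t => - k%:R * flat k.+1 t + flat k.+2 t); first exact: flat_deriv.
by apply: n_smooth_add => //; apply: n_smooth_mul => //; exact: n_smooth_cst.
Qed.

Lemma cont_seg_bounded (a b : R) f : continuous f ->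
  exists2 M : R, 0 <= M & forall t, a <= t <= b -> `|f t| <= M.
Proof.
move=> cf; have /compact_bounded[N [_ HN]] : compact (f @` `[a, b]%classic).
  by apply: continuous_compact; [exact: continuous_subspaceT|exact: segment_compact].
exists (`|N| + 1) => // t tab; apply: HN; first by rewrite ltr_pwDr// ler_norm.
by exists t => //=; rewrite in_itv.
Qed.

Lemma mean_value_bound f f' (a b K : R) : has_deriv f f' -> a <= b ->
  (forall x, a <= x <= b -> `|f' x| <= K) -> `|f b - f a| <= K * (b - a).
Proof.
move=> df; rewrite le_eqVlt => /predU1P[->|ab] fK; first by rewrite !subrr normr0 mulr0.
have [x xab ->] := MVT ab (fun z _ => df z) (continuous_subspaceT (has_deriv_cont df)).
rewrite normrM [`|b - a|]ger0_norm ?subr_ge0 ?(ltW ab)//.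
rewrite ler_wpM2r ?subr_ge0 ?(ltW ab)//; apply: fK.
by move: xab; rewrite in_itv/= => /andP[/ltW -> /ltW ->].
Qed.

(** [flat] is used twice: [g = c - flat 0] equals [c] for [t <= 0] and is nonpositive for [t >= 1],
    so [1 - flat 0 (g t) / flat 0 c] is 0 on the left and 1 on the right. Two derivatives are
    exposed because the Hessian of the truncated function is estimated. *)
Lemma cutoff_exists : exists chi chi1 chi2 : R -> R, exists2 M : R, 0 <= M &
  [/\ smooth1 chi, has_deriv chi chi1, has_deriv chi1 chi2,
      forall t, t <= 0 -> chi t = 0 &
      (forall t, 1 <= t -> [/\ chi t = 1, chi1 t = 0 & chi2 t = 0]) /\
      (forall t, [/\ `|chi t| <= M, `|chi1 t| <= M & `|chi2 t| <= M])].
Proof.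
pose c := flat 0 1.
have c0 : 0 < c by rewrite /c /flat ltr01 mulr_gt0 ?expR_gt0// exprn_gt0// invr_gt0.
have ec : 0 < flat 0 c by rewrite /flat c0 mulr_gt0 ?expR_gt0// exprn_gt0// invr_gt0.
pose g t := c - flat 0 t.
pose f2 k (t : R) := - k%:R * flat k.+1 t + flat k.+2 t.
pose k0 := - (flat 0 c)^-1.
pose chi t := 1 + k0 * flat 0 (g t).
pose g1 t := -1 * f2 0 t.
have dg : has_deriv g g1.
  move=> t; rewrite /g1 mulN1r -[- _]add0r; apply: is_deriveB; exact: flat_deriv.
pose chi1 t := 0 + k0 * (f2 0 (g t) * g1 t).
pose f3 t := - 0 * f2 1 t + f2 2 t.
have df2 : has_deriv (f2 0) f3.
  move=> t; apply: is_deriveD; last exact: flat_deriv.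
  by apply: is_deriveZ; exact: flat_deriv.
pose g2 t := -1 * f3 t.
have dg1 : has_deriv g1 g2 by exact: has_deriv_scale.
pose chi2 t := 0 + k0 * (f2 0 (g t) * g2 t + g1 t * (f3 (g t) * g1 t)).
have d1 : has_deriv chi chi1.
  apply: has_deriv_add; first exact: has_deriv_cst.
  by apply: has_deriv_scale; exact: (has_deriv_compose (@flat_deriv 0)).
have d2 : has_deriv chi1 chi2.
  apply: has_deriv_add; first exact: has_deriv_cst.
  apply: has_deriv_scale; apply: has_deriv_mul => //.
  exact: has_deriv_compose df2 dg.
have sg : smooth1 g by apply: smooth1_sub; [exact: smooth1_cst|exact: smooth1_flat].
have schi : smooth1 chi.
  apply: smooth1_add; first exact: smooth1_cst.
  by apply: smooth1_scale; apply: smooth1_comp => //; exact: smooth1_flat.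
have gm t : 1 <= t -> g t <= 0.
  move=> t1; have t0 : 0 < t := lt_le_trans ltr01 t1.
  by rewrite subr_le0 /c /flat ltr01 t0 !expr0 !mul1r ler_expR lerN2 lef_pV2 ?posrE.
have cf2 k : continuous (f2 k).
  apply: cont_add; last exact: has_deriv_cont (@flat_deriv _).
  by apply: cont_mul; [exact: cont_cst|exact: has_deriv_cont (@flat_deriv _)].
have cf3 : continuous f3.
  by apply: cont_add => //; apply: cont_mul => //; exact: cont_cst.
have cg := has_deriv_cont dg; have cg1 := has_deriv_cont dg1.
have cg2 : continuous g2 by apply: cont_mul => //; exact: cont_cst.
have cchi2 : continuous chi2.
  apply: cont_add; first exact: cont_cst.
  apply: cont_mul; first exact: cont_cst.
  apply: cont_add; apply: cont_mul => //; first exact: (cont_comp (cf2 0) cg).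
  by apply: cont_mul => //; exact: (cont_comp cf3 cg).
have [M0 p0 H0] := cont_seg_bounded 0 1 (has_deriv_cont d1).
have [M1 p1 H1] := cont_seg_bounded 0 1 (has_deriv_cont d2).
have [M2 p2 H2] := cont_seg_bounded 0 1 cchi2.
have chi0 t : t <= 0 -> [/\ chi t = 0, chi1 t = 0 & chi2 t = 0].
  move=> t0; have f0 k : flat k t = 0 by exact: flat_le0.
  have f20 k : f2 k t = 0 by rewrite /f2 !f0 mulr0 addr0.
  have f30 : f3 t = 0 by rewrite /f3 !f20 mulr0 addr0.
  split; first by rewrite /chi /g f0 subr0 mulNr mulVf ?subrr// gt_eqF.
    by rewrite /chi1 /g1 f20 !mulr0 addr0.
  by rewrite /chi2 /g2 /g1 f20 f30 !(mulr0, mul0r, addr0).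
have chi1E t : 1 <= t -> [/\ chi t = 1, chi1 t = 0 & chi2 t = 0].
  move=> t1; have f0 k : flat k (g t) = 0 by rewrite flat_le0// gm.
  by rewrite /chi /chi1 /chi2 /f3 /f2 !f0 !(mulr0, mul0r, addr0, add0r).
have MM : 0 <= M0 + M1 + M2 by rewrite !addr_ge0.
exists chi, chi1, chi2; exists (M0 + M1 + M2 + 1); first by rewrite addr_ge0.
split => //; first by move=> t /chi0[].
split => // t.
have [t0|/ltW t0] := leP t 0; first by have [-> -> ->] := chi0 _ t0; rewrite !normr0 addr_ge0.
have [/ltW t1|t1] := ltP t 1; last first.
  by have [-> -> ->] := chi1E _ t1; rewrite !normr0 normr1 addr_ge0 ?lerDr.
have t01 : 0 <= t <= 1 by rewrite t0.
have := H0 _ t01; have := H1 _ t01; have := H2 _ t01.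
move: `|chi t| `|chi1 t| `|chi2 t| => x0 x1 x2 h0 h1 h2.
by split; lra.
Qed.

End smooth_line.

(** * Power series with factorially decaying coefficients *)

Section entire_series.
Context {R : realType}.
Implicit Types (c : R^nat) (x z : R).

Definition factorial_decay (C a : R) c := forall n, `|c n| <= C * a ^+ n / n`!%:R.
Definition psum c x : R := limn (pseries c x).

Lemma factorial_decay_cvg C a c x : 0 <= a -> factorial_decay C a c ->
  series (fun n => c n * x ^+ n) @ \oo --> psum c x.
Proof.
move=> a0 H; suff : cvgn (pseries c x) by [].
have key n : `|c n * x ^+ n| <= C * exp_coeff (a * `|x|) n.
  rewrite normrM normrX /exp_coeff /= exprMn.
  rewrite (_ : C * _ = C * a ^+ n / n`!%:R * `|x| ^+ n); last by ring.
  by rewrite ler_wpM2r ?exprn_ge0.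
apply: normed_cvg; apply: (@series_le_cvg _ _ (fun n => C * exp_coeff (a * `|x|) n)) => [n|n|n|].
- exact: normr_ge0.
- exact: le_trans (normr_ge0 (c n * x ^+ n)) (key n).
- exact: key.
- by apply: is_cvg_seriesZ; exact: is_cvg_series_exp_coeff.
Qed.

Lemma factorial_decay_diffs C a c : 0 <= a -> factorial_decay C a c ->
  factorial_decay (C * a) a (pseries_diffs c).
Proof.
move=> a0 H n; rewrite /pseries_diffs normrM ger0_norm//.
apply: (@le_trans _ _ (n.+1%:R * (C * a ^+ n.+1 / n.+1`!%:R))); first by rewrite ler_wpM2l.
rewrite factS natrM exprS le_eqVlt; apply/orP; left; apply/eqP; field.
by rewrite nat1r !pnatr_eq0 -lt0n fact_gt0.
Qed.

Lemma psum_deriv C a c : 0 <= a -> factorial_decay C a c ->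
  has_deriv (psum c) (psum (pseries_diffs c)).
Proof.
move=> a0 H x; have H1 := factorial_decay_diffs a0 H; have H2 := factorial_decay_diffs a0 H1.
apply: (@pseries_snd_diffs _ _ (`|x| + 1)).
- by apply/cvg_ex; exists (psum c (`|x| + 1)); exact: factorial_decay_cvg H.
- by apply/cvg_ex; exists (psum (pseries_diffs c) (`|x| + 1)); exact: factorial_decay_cvg H1.
- apply/cvg_ex; exists (psum (pseries_diffs (pseries_diffs c)) (`|x| + 1)).
  exact: factorial_decay_cvg H2.
- by rewrite [ltRHS]ger0_norm ?addr_ge0// ltrDl.
Qed.

Lemma psum_smooth C a c : 0 <= a -> factorial_decay C a c -> smooth1 (psum c).
Proof.
move=> a0 H n; elim: n C c H => // n IH C c H.
exists (psum (pseries_diffs c)); first exact: psum_deriv H.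
exact: IH (factorial_decay_diffs a0 H).
Qed.

Lemma psum_ge0 C a c x : 0 <= a -> factorial_decay C a c -> (forall n, 0 <= c n) -> 0 <= x ->
  0 <= psum c x.
Proof.
move=> a0 H c0 x0; apply: limr_ge.
  by apply/cvg_ex; exists (psum c x); exact: factorial_decay_cvg H.
by apply: nearW => n; apply: sumr_ge0 => i _; rewrite mulr_ge0 ?exprn_ge0.
Qed.

End entire_series.

(** * The radial plate equation in the variable [z = |x|^2] *)

Section radial_ode.
Context {R : realType} (d : nat) (sigma : R).
Hypotheses (d0 : (0 < d)%N) (sigma0 : 0 <= sigma).

(* Coefficients of the entire solution [N] of [4 z N'' + (4 + 2 d) N' = 1 + sigma N],
   [N 0 = 0]; the left-hand side is the derivative, in [z = |x|^2],
   of the Laplacian of a radial function whose derivative in [z] is [N]. *)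
Fixpoint ode_coef (n : nat) : R :=
  if n is k.+1 then (sigma * ode_coef k + (k == 0)%:R) / (k.+1%:R * (4 * k%:R + 2 * d%:R + 4))
  else 0.

Local Notation N := (psum ode_coef).
Local Notation N1 := (psum (pseries_diffs ode_coef)).
Local Notation N2 := (psum (pseries_diffs (pseries_diffs ode_coef))).

Let den_gt0 k : 0 < 4 * k%:R + 2 * d%:R + 4 :> R.
Proof. by rewrite ltr_wpDl// addr_ge0// mulr_ge0. Qed.

Lemma ode_coef_ge0 n : 0 <= ode_coef n.
Proof.
case: n => // n; elim: n => [|n IH] /=; apply: divr_ge0.
- by rewrite addr_ge0 ?mulr_ge0.
- by rewrite mulr_ge0// ltW.
- by rewrite addr_ge0// mulr_ge0.
- by rewrite mulr_ge0// ltW.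
Qed.

Lemma ode_coef_decay : factorial_decay 1 (1 + sigma) ode_coef.
Proof.
move=> n; rewrite ger0_norm ?ode_coef_ge0// mul1r.
elim: n => [|n IH]; first by rewrite expr0 divr1.
have F0 k : 0 < k`!%:R :> R by rewrite ltr0n fact_gt0.
have S0 : 0 <= 1 + sigma by rewrite addr_ge0.
rewrite /= factS natrM ler_pdivrMr ?mulr_gt0//.
rewrite [leRHS](_ : _ = (1 + sigma) * ((1 + sigma) ^+ n / n`!%:R) * (4 * n%:R + 2 * d%:R + 4)); last first.
  by rewrite exprS; field; rewrite nat1r !pnatr_eq0 -lt0n fact_gt0.
have h1 : sigma * ode_coef n + (n == 0)%:R <= (1 + sigma) * ((1 + sigma) ^+ n / n`!%:R).
  rewrite mulrDl mul1r addrC lerD//; last by rewrite ler_wpM2l.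
  case: n {IH} => [|n] /=; first by rewrite expr0 divr1.
  by rewrite divr_ge0 ?exprn_ge0 ?(ltW (F0 _)).
apply: (le_trans h1); rewrite ler_peMr//.
  by rewrite mulr_ge0// divr_ge0 ?exprn_ge0 ?(ltW (F0 _)).
rewrite -[leLHS]add0r lerD ?addr_ge0 ?mulr_ge0//.
by rewrite -[1]/(1%:R) ler_nat.
Qed.

Let a0 : 0 <= 1 + sigma. Proof. by rewrite addr_ge0. Qed.

Lemma ode_N z : 4 * z * N2 z + (4 + 2 * d%:R) * N1 z = 1 + sigma * N z.
Proof.
have H0 := ode_coef_decay; have H1 := factorial_decay_diffs a0 H0.
have H2 := factorial_decay_diffs a0 H1.
have c0 := @factorial_decay_cvg _ _ _ _ z a0 H0; have c1 := @factorial_decay_cvg _ _ _ _ z a0 H1.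
have c2 := @factorial_decay_cvg _ _ _ _ z a0 H2.
(* The factor [z] in front of [N2] raises the degree by one, so the partial sums of [N1] and [N] are
   taken one index further; the identity then holds exactly for partial sums. *)
move: c1; rewrite -(cvg_shiftS (series _)) => c1.
move: c0; rewrite -(cvg_shiftS (series _)) => c0.
have L : (fun n => 4 * z * series (fun i => pseries_diffs (pseries_diffs ode_coef) i * z ^+ i) n
   + (4 + 2 * d%:R) * series (fun i => pseries_diffs ode_coef i * z ^+ i) n.+1) @ \oo
   --> 4 * z * N2 z + (4 + 2 * d%:R) * N1 z.
  by apply: cvgD; apply: cvgMr.
have L' : (fun n => 1 + sigma * series (fun i => ode_coef i * z ^+ i) n.+1) @ \oo --> 1 + sigma * N z.
  by apply: cvgD; [exact: cvg_cst|exact: cvgMr].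
apply: (cvg_unique (@Rhausdorff R) L).
rewrite (_ : (fun n => _) = (fun n => 1 + sigma * series (fun i => ode_coef i * z ^+ i) n.+1))//.
apply/funext => n; rewrite /series /=; elim: n => [|n IH].
  rewrite !big_nat1 big_geq// /pseries_diffs /= !expr0 !mulr0 !mul0r !mulr0 add0r !mulr1.
  by rewrite addr0 !add0r; field; rewrite gt_eqF// ltr_wpDl// mulr_ge0.
rewrite big_nat_recr//= mulrDr [\sum_(0 <= i < n.+2) _]big_nat_recr//= mulrDr.
rewrite [in RHS]big_nat_recr//= [sigma * (_ + _)]mulrDr [RHS]addrA -IH.
rewrite addrACA; congr (_ + _).
rewrite /pseries_diffs /= addr0.
have := den_gt0 n.+1; have -> : n.+1%:R = n%:R + 1 :> R by rewrite natr1.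
have -> : n.+2%:R = n%:R + 2 :> R by rewrite -addn2 natrD.
move=> dn.
set q := ((sigma * ode_coef n + (n == 0)%:R) / _).
have n2 : n%:R + 2 != 0 :> R by rewrite gt_eqF// ltr_wpDl.
by rewrite exprS; field; rewrite n2 gt_eqF.
Qed.

(** [profile_ode] is the plate equation for [W (|x|^2)], integrated once by regularity at the
    origin; [profile_bdry] and [profile_bdry1] are the clamped boundary conditions. The last two
    fields are what makes [m (x ^+ 2)] an admissible weight. *)
Record radial_profile (r : R) (W m m1 m2 : R -> R) : Prop := RadialProfile {
  profile_smooth : smooth1 W;
  profile_deriv : has_deriv W (fun z => - (2 * d%:R)^-1 * m z);
  profile_deriv1 : has_deriv m m1;
  profile_deriv2 : has_deriv m1 m2;
  profile_cont2 : continuous m2;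
  profile_bdry : W (r ^+ 2) = 0;
  profile_bdry1 : m (r ^+ 2) = 0;
  profile_ode : forall z, 4 * z * m2 z + (4 + 2 * d%:R) * m1 z = sigma * m z - 1;
  profile_itv : forall z, 0 <= z <= r ^+ 2 -> 0 <= m z <= m 0;
  profile_tension : forall z, 0 <= z <= r ^+ 2 -> 0 <= 1 - sigma * m z <= 1 }.

(** Take [m = (A - N) / K] with [A = N (r ^+ 2)] and [K = 1 + sigma * A]. The coefficients of [N]
    are nonnegative, so [N] is nonnegative and nondecreasing on the half-line; hence the sign and
    monotonicity of [m], and [1 - sigma * m = (1 + sigma * N) / K] lies in [[0, 1]]. *)
Lemma radial_profile_exists (r : R) : exists W m m1 m2, radial_profile r W m m1 m2.
Proof.
have H0 := ode_coef_decay; have H1 := factorial_decay_diffs a0 H0.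
have H2 := factorial_decay_diffs a0 H1.
have dN := psum_deriv a0 H0; have dN1 := psum_deriv a0 H1.
have cN2 := has_deriv_cont (psum_deriv a0 H2).
have diffs0 c : (forall n, 0 <= c n) -> forall n, 0 <= pseries_diffs c n :> R.
  by move=> c0 n; rewrite mulr_ge0.
have N1_ge0 z : 0 <= z -> 0 <= N1 z.
  by apply: (psum_ge0 a0 H1); exact/diffs0/ode_coef_ge0.
have N_ge0 z : 0 <= z -> 0 <= N z by apply: (psum_ge0 a0 H0); exact: ode_coef_ge0.
have N_mono y z : 0 <= y -> y <= z -> N y <= N z.
  move=> y0 yz; apply: (FTC_ge0_le dN yz) => x /andP[yx _]; apply: N1_ge0.
  exact: le_trans yx.
set A := N (r ^+ 2); pose K := 1 + sigma * A.
have A0 : 0 <= A by apply: N_ge0; exact: sqr_ge0.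
have K0 : 0 < K by rewrite ltr_wpDr// mulr_ge0.
pose k := - K^-1.
pose m z := k * (N z + - A); pose m1 z := k * N1 z; pose m2 z := k * N2 z.
have dm : has_deriv m m1.
  by apply: has_deriv_scale; exact: has_deriv_shift.
have dm1 : has_deriv m1 m2 by exact: has_deriv_scale.
have [P dP] := primitive_exists (has_deriv_cont dm).
have sm : smooth1 m.
  apply: smooth1_scale; apply: smooth1_add; first exact: psum_smooth H0.
  exact: smooth1_cst.
pose h := - (2 * d%:R)^-1 : R.
exists (fun z => h * (P z + - P (r ^+ 2))), m, m1, m2; split => //.
- case=> // n; exists (fun z => h * m z); last first.
    by apply: n_smooth_mul; [exact: n_smooth_cst|exact: sm].
  by apply: has_deriv_scale; exact: has_deriv_shift.
- by apply: has_deriv_scale; exact: has_deriv_shift.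
- by apply: cont_mul => //; exact: cont_cst.
- by rewrite subrr mulr0.
- by rewrite /m subrr mulr0.
- move=> z; have := ode_N z; rewrite /m /m1 /m2 => E.
  rewrite (_ : _ + _ = k * (4 * z * N2 z + (4 + 2 * d%:R) * N1 z)); last by ring.
  by rewrite E /k /K; field; rewrite gt_eqF.
- move=> z /andP[z0 zr]; rewrite /m /k !mulNr -!mulrN !opprB.
  rewrite mulr_ge0 ?invr_ge0 ?(ltW K0) ?subr_ge0 ?N_mono//=.
  by rewrite ler_pM2l ?invr_gt0// lerD2l lerN2 N_mono.
- move=> z /andP[z0 zr]; have h1 := N_mono z _ z0 zr; have h2 := N_ge0 z z0.
  have -> : 1 - sigma * m z = (1 + sigma * N z) / K.
    by rewrite /m /k /K; field; rewrite gt_eqF.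
  rewrite divr_ge0 ?(ltW K0) ?addr_ge0 ?mulr_ge0//= ler_pdivrMr// mul1r lerD2l.
  by rewrite ler_wpM2l.
Qed.

Section profile_identities.
Context (r : R) (W m m1 m2 : R -> R).
Hypotheses (r0 : 0 < r) (prof : radial_profile r W m m1 m2).
Local Notation leb := (@lebesgue_measure R).

Let dp : 0 < d%:R :> R. Proof. by rewrite ltr0n. Qed.
Let cm := has_deriv_cont (profile_deriv1 prof).
Let cm1 := has_deriv_cont (profile_deriv2 prof).
Let cX : continuous (fun x : R => x). Proof. by move=> z; exact: cvg_id. Qed.
Let csq : continuous (fun x : R => x ^+ 2). Proof. exact: cont_exp. Qed.
Let dsq : has_deriv (fun x : R => x ^+ 2) (fun x => 2 * x).
Proof.
by apply: eq_has_deriv (@has_deriv_monomial R 1 1) => x; rewrite mul1r.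
Qed.

(** In the radius variable, [R0 ^+ d.+1] is the integrating factor of [profile_ode]. *)
Lemma profile_flux : has_deriv (fun R0 => - (2 / d%:R) * (R0 ^+ d.+2 * m1 (R0 ^+ 2)))
  (fun R0 => (1 - sigma * m (R0 ^+ 2)) * R0 ^+ d.+1 / d%:R).
Proof.
have d1 : has_deriv (fun x : R => x ^+ d.+2) (fun x => d.+2%:R * x ^+ d.+1).
  by apply: eq_has_deriv (@has_deriv_monomial R 1 d.+1) => x; rewrite mul1r.
have := has_deriv_scale (- (2 / d%:R)) (has_deriv_mul d1 (has_deriv_compose (profile_deriv2 prof) dsq)).
rewrite [X in has_deriv _ X](_ : _ = (fun R0 => (1 - sigma * m (R0 ^+ 2)) * R0 ^+ d.+1 / d%:R))//.
apply/funext => x; have := profile_ode prof (x ^+ 2).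
rewrite -[1 - _]opprB => <-; rewrite -!natr1 !exprS; field; rewrite gt_eqF//.
Qed.

(** The Laplacian [4 z W'' + 2 d W'] of the ball's torsion function, rewritten with
    [W' = - m / (2 d)]. *)
Definition profile_lap z := - (2 / d%:R) * (z * m1 z) - m z.

Lemma profile_lap_deriv : has_deriv profile_lap (fun z => (1 - sigma * m z) / (2 * d%:R)).
Proof.
have := has_deriv_add (has_deriv_scale (- (2 / d%:R)) (has_deriv_mul (@has_deriv_id R) (profile_deriv2 prof)))
  (has_deriv_scale (-1) (profile_deriv1 prof)).
rewrite [X in has_deriv X](_ : _ = profile_lap); last first.
  by apply/funext => z; rewrite /profile_lap mulN1r.
rewrite [X in has_deriv _ X](_ : _ = (fun z => (1 - sigma * m z) / (2 * d%:R)))//.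
apply/funext => z; have := profile_ode prof z.
rewrite -[1 - _]opprB => <-; field; rewrite gt_eqF//.
Qed.

(** The equality case of [covariance_le]. Split at [p]: below it the integrand is a multiple of the
    derivative of [A], above it a combination of the derivatives of [profile_lap] and [A]. Since
    [A x = x ^+ d * (profile_lap + m)] at [x ^+ 2], the boundary terms cancel by [m (r ^+ 2) = 0]
    and leave [m] at [p ^+ 2]. *)
Lemma ball_profile_identity (p : R) : 0 < p <= r ->
  d%:R^-1 * \int[leb]_(x in `[0, r])
    ((1 - sigma * m (x ^+ 2)) * (p ^+ d / Num.max x p ^+ d - p ^+ d / r ^+ d) * x ^+ d.+1)
  = p ^+ d * m (p ^+ 2).
Proof.
move=> /andP[p0 pr]; pose a x := 1 - sigma * m (x ^+ 2).
pose A x := - (2 / d%:R) * (x ^+ d.+2 * m1 (x ^+ 2)).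
have ca : continuous a.
  apply: cont_sub; first exact: cont_cst.
  by apply: cont_mul; [exact: cont_cst|exact: (cont_comp cm csq)].
have cmx : continuous (fun x : R => Num.max x p ^+ d).
  by apply: cont_exp; apply: cont_max => //; exact: cont_cst.
have mxp x : 0 < Num.max x p by rewrite lt_max p0 orbT.
pose F x := a x * (p ^+ d / Num.max x p ^+ d - p ^+ d / r ^+ d) * x ^+ d.+1.
have cF : continuous F.
  apply: cont_mul; last exact: cont_exp.
  apply: cont_mul => //; apply: cont_sub; last exact: cont_cst.
  apply: cont_mul; first exact: cont_cst.
  move=> x; apply: (@continuous_comp _ _ _ (fun x => Num.max x p ^+ d) (fun y : R => y^-1)).
    exact: cmx.
  by apply: inv_continuous; rewrite gt_eqF// exprn_gt0.
have [P dP] := primitive_exists cF.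
have -> : \int[leb]_(x in `[0, r]) F x = (P r - P p) + (P p - P 0).
  by rewrite (FTC (ltW r0) dP cF); ring.
have dA : has_deriv A (fun x => a x * x ^+ d.+1 / d%:R) := profile_flux.
have dY : has_deriv (fun x => profile_lap (x ^+ 2)) (fun x => a x * x / d%:R).
  have := has_deriv_compose profile_lap_deriv dsq.
  rewrite [X in has_deriv _ X -> _](_ : _ = (fun x => a x * x / d%:R))//.
  by apply/funext => x; rewrite /a; field; rewrite gt_eqF.
have AY x : A x = x ^+ d * (profile_lap (x ^+ 2) + m (x ^+ 2)).
  have Ex : x ^+ d.+2 = x ^+ d * x ^+ 2 by rewrite -exprD addn2.
  by rewrite /A /profile_lap Ex; ring.
pose kr := p ^+ d / r ^+ d.
have cA : continuous (fun x => (1 - kr) * (a x * x ^+ d.+1 / d%:R)).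
  apply: cont_mul; first exact: cont_cst.
  by apply: cont_mul; [apply: cont_mul => //; exact: cont_exp|exact: cont_cst].
have cA' : continuous (fun x => p ^+ d * (a x * x / d%:R) - kr * (a x * x ^+ d.+1 / d%:R)).
  apply: cont_sub; apply: cont_mul; try exact: cont_cst.
    by apply: cont_mul; [exact: cont_mul|exact: cont_cst].
  by apply: cont_mul; [apply: cont_mul => //; exact: cont_exp|exact: cont_cst].
have h1 : d%:R^-1 * (P p - P 0) = (1 - kr) * A p.
  have A00 : A 0 = 0 by rewrite /A expr0n/= mul0r mulr0.
  have := FTC (ltW p0) (has_deriv_scale (1 - kr) dA) cA; rewrite A00 mulr0 subr0 => <-.
  rewrite -(FTC (ltW p0) dP cF) -RintegralZl//; last exact: cont_int_seg.
  apply: eq_Rintegral => x; rewrite inE /= in_itv /= => /andP[_ xp].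
  by rewrite /F (max_r xp) divff ?gt_eqF ?exprn_gt0// -/kr; ring.
have h2 : d%:R^-1 * (P r - P p) =
    (p ^+ d * profile_lap (r ^+ 2) - kr * A r) - (p ^+ d * profile_lap (p ^+ 2) - kr * A p).
  have dAY : has_deriv (fun x => p ^+ d * profile_lap (x ^+ 2) - kr * A x)
      (fun x => p ^+ d * (a x * x / d%:R) - kr * (a x * x ^+ d.+1 / d%:R)).
    move=> x; apply: is_deriveB; first exact: (has_deriv_scale _ dY).
    exact: (has_deriv_scale _ dA).
  rewrite -(FTC pr dAY cA') -(FTC pr dP cF) -RintegralZl//; last exact: cont_int_seg.
  apply: eq_Rintegral => x; rewrite inE /= in_itv /= => /andP[px _].
  rewrite /F (max_l px) -/kr exprS; field.
  by rewrite gt_eqF//= expf_neq0// gt_eqF// (lt_le_trans p0).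
rewrite mulrDr h1 h2 !AY (profile_bdry1 prof) addr0 /kr; field.
by rewrite gt_eqF// exprn_gt0.
Qed.

Lemma profile_int (rho : R) : 0 <= rho <= r ->
  \int[leb]_(x in `[rho, r]) (m (x ^+ 2) * x / d%:R) = W (rho ^+ 2).
Proof.
move=> /andP[_ rr]; have dW : has_deriv (fun x => - 1 * W (x ^+ 2)) (fun x => m (x ^+ 2) * x / d%:R).
  have := has_deriv_scale (-1) (has_deriv_compose (profile_deriv prof) dsq).
  rewrite [X in has_deriv _ X -> _](_ : _ = (fun x => m (x ^+ 2) * x / d%:R))//.
  by apply/funext => x; field; rewrite gt_eqF.
have cW : continuous (fun x : R => m (x ^+ 2) * x / d%:R).
  by apply: cont_mul; [apply: cont_mul => //; exact: (cont_comp cm csq)|exact: cont_cst].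
by rewrite (FTC rr dW cW) (profile_bdry prof) mulr0 sub0r mulN1r opprK.
Qed.

End profile_identities.

End radial_ode.

(** * Radial functions *)

Section smooth_space.
Context {R : realType} (d : nat).
Local Notation E := 'rV[R]_d.
Implicit Types (f g : E -> R).

Fixpoint n_smooth_rV n f := if n is n'.+1 then
  (forall x, differentiable f x) /\ forall i, n_smooth_rV n' (partial i f) else True.

Lemma n_smooth_rVS n f : n_smooth_rV n.+1 f -> n_smooth_rV n f.
Proof. by elim: n f => // n IH f [df sf]; split => // i; exact: IH. Qed.

Lemma smoothP f : (forall n, n_smooth_rV n f) -> smooth f.
Proof.
(* [foldr] applies the last index of [s] first, hence the induction from the right. *)
move=> sf s; elim/last_ind: s f sf => [|s i IH] f sf x; first by case: (sf 1%N).
by rewrite foldr_rcons; apply: IH => n; have [_ H] := sf n.+1; exact: H.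
Qed.

Lemma n_smooth_rV_cst n (k : R) : n_smooth_rV n (fun=> k).
Proof.
elim: n k => // n IH k; split => [x|i]; first exact: differentiable_const.
by rewrite (_ : partial i _ = fun=> 0)//; apply/funext => x; exact: partial_cst.
Qed.

Lemma n_smooth_rV_add n f g : n_smooth_rV n f -> n_smooth_rV n g ->
  n_smooth_rV n (fun x => f x + g x).
Proof.
elim: n f g => // n IH f g [df sf] [dg sg]; split => [x|i]; first exact: differentiable_add.
rewrite (_ : partial i _ = fun x => partial i f x + partial i g x); first exact: (IH _ _ (sf i) (sg i)).
by apply/funext => x; exact: partial_add.
Qed.

Lemma n_smooth_rV_mul n f g : n_smooth_rV n f -> n_smooth_rV n g ->
  n_smooth_rV n (fun x => f x * g x).
Proof.
elim: n f g => // n IH f g sf sg; have sf0 := n_smooth_rVS sf; have sg0 := n_smooth_rVS sg.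
case: sf sg => [df sf] [dg sg]; split => [x|i]; first exact: differentiable_mul.
rewrite (_ : partial i _ = fun x => f x * partial i g x + g x * partial i f x).
  by apply: n_smooth_rV_add; [exact: (IH _ _ sf0 (sg i))|exact: (IH _ _ sg0 (sf i))].
by apply/funext => x; exact: partial_mul.
Qed.

Lemma partial_chain (h h' : R -> R) f i x : has_deriv h h' -> differentiable f x ->
  partial i (fun x => h (f x)) x = h' (f x) * partial i f x.
Proof.
move=> dh df; rewrite partial_comp//; last by exact: ex_derive.
by rewrite derive1E (@derive_val _ _ _ _ _ _ _ (dh (f x))).
Qed.

Lemma differentiable_chain (h h' : R -> R) f x : has_deriv h h' -> differentiable f x ->
  differentiable (fun x => h (f x)) x.
Proof. by move=> dh df; apply: differentiable_comp1 => //; exact: ex_derive. Qed.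

Lemma n_smooth_rV_comp n (h : R -> R) f : n_smooth n h -> n_smooth_rV n f ->
  n_smooth_rV n (fun x => h (f x)).
Proof.
elim: n h f => // n IH h f [h' dh sh] sf; have sf0 := n_smooth_rVS sf.
case: sf => [df sf]; split => [x|i]; first exact: differentiable_chain dh _.
rewrite (_ : partial i _ = fun x => h' (f x) * partial i f x).
  exact: (n_smooth_rV_mul (IH _ _ sh sf0) (sf i)).
by apply/funext => x; exact: partial_chain dh _.
Qed.

Lemma partial_coord i j x : partial i (fun x : E => x 0 j) x = (i == j)%:R.
Proof.
have E0 : (fun h : R => h^-1 *: (((fun x : E => x 0 j) \o shift x) (h *: delta_mx 0 i) - x 0 j)) @ 0^'
    --> ((i == j)%:R : R).
  have : (fun h : R => (i == j)%:R : R) @ (0 : R)^' --> ((i == j)%:R : R) by exact: cvg_cst.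
  apply: cvg_trans; apply: near_eq_cvg; near=> h.
  have h0 : h != 0 by near: h; exact: nbhs_dnbhs_neq.
  by rewrite /= !mxE eqxx /= addrK /GRing.scale/= [j == i]eq_sym mulKf.
by rewrite /partial /derive; exact: cvg_lim E0.
Unshelve. all: end_near. Qed.

Lemma n_smooth_rV_coord n j : n_smooth_rV n (fun x : E => x 0 j).
Proof.
case: n => // n; split => [x|i]; first exact: differentiable_coord.
rewrite (_ : partial i _ = fun=> (i == j)%:R); first exact: n_smooth_rV_cst.
by apply/funext => x; exact: partial_coord.
Qed.

Section radial.
Variable c : E.
Definition sqdist (x : E) : R := \sum_i (x 0 i - c 0 i) ^+ 2.

Let dcoord j x : differentiable (fun x : E => x 0 j + - c 0 j) x.
Proof. by apply: differentiable_add; [exact: differentiable_coord|exact: differentiable_const]. Qed.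

Let pcoord i j x : partial i (fun x : E => x 0 j + - c 0 j) x = (i == j)%:R.
Proof.
by rewrite partial_add ?partial_coord ?partial_cst ?addr0//; exact: differentiable_coord.
Qed.

Lemma sqdist_smooth n : n_smooth_rV n sqdist.
Proof.
rewrite /sqdist; elim: (index_enum _) => [|i s IH].
  by under eq_fun do rewrite big_nil; exact: n_smooth_rV_cst.
under eq_fun do rewrite big_cons; apply: n_smooth_rV_add => //.
have H : n_smooth_rV n (fun x : E => x 0 i - c 0 i).
  by apply: n_smooth_rV_add; [exact: n_smooth_rV_coord|exact: n_smooth_rV_cst].
exact: (n_smooth_rV_mul H H).
Qed.

Lemma sqdist_diff x : differentiable sqdist x. Proof. by case: (sqdist_smooth 1). Qed.

Lemma partial_sqdist i x : partial i sqdist x = 2 * (x 0 i - c 0 i).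
Proof.
have H (s : seq 'I_d) : (forall y, differentiable (fun x : E => \sum_(j <- s) (x 0 j - c 0 j) ^+ 2) y) /\
    partial i (fun x : E => \sum_(j <- s) (x 0 j - c 0 j) ^+ 2) x =
    \sum_(j <- s) 2 * (x 0 j - c 0 j) * (i == j)%:R.
  elim: s => [|j s [IH1 IH2]].
    rewrite big_nil; split.
      by under eq_fun do rewrite big_nil; move=> y; exact: differentiable_const.
    by under eq_fun do rewrite big_nil; exact: partial_cst.
  have dj y : differentiable (fun x : E => (x 0 j - c 0 j) ^+ 2) y.
    by apply: (@differentiable_mul R d (fun x : E => x 0 j + - c 0 j) (fun x : E => x 0 j + - c 0 j)); exact: dcoord.
  rewrite big_cons; under eq_fun do rewrite big_cons; split.
    by move=> y; exact: differentiable_add.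
  rewrite partial_add// IH2; congr (_ + _).
  rewrite (@partial_mul R d i (fun x : E => x 0 j + - c 0 j) (fun x : E => x 0 j + - c 0 j)) ?pcoord//.
  by ring.
rewrite (H _).2 (bigD1 i)//= eqxx mulr1 big1 ?addr0// => j ji.
by rewrite eq_sym (negbTE ji) mulr0.
Qed.

Section radial_function.
Variables (G G1 G2 : R -> R).
Hypotheses (dG : has_deriv G G1) (dG1 : has_deriv G1 G2).

Lemma partial_radial i x : partial i (fun x => G (sqdist x)) x = G1 (sqdist x) * (2 * (x 0 i - c 0 i)).
Proof. by rewrite (partial_chain _ dG) ?partial_sqdist//; exact: sqdist_diff. Qed.

Lemma partial2_radial i j x : partial j (partial i (fun x => G (sqdist x))) x =
  G2 (sqdist x) * (4 * (x 0 i - c 0 i) * (x 0 j - c 0 j)) + G1 (sqdist x) * (2 * (j == i)%:R).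
Proof.
have -> : partial i (fun x => G (sqdist x)) = fun x => G1 (sqdist x) * (2 * (x 0 i + - c 0 i)).
  by apply/funext => y; exact: partial_radial.
rewrite partial_mul; last 2 first.
- by apply: (differentiable_chain dG1); exact: sqdist_diff.
- by apply: differentiable_scale; exact: dcoord.
rewrite partial_scale ?pcoord; last exact: dcoord.
rewrite (partial_chain _ dG1) ?partial_sqdist; last exact: sqdist_diff.
by ring.
Qed.

Lemma laplacian_radial x : laplacian (jet_of (fun x => G (sqdist x))) x =
  4 * sqdist x * G2 (sqdist x) + 2 * d%:R * G1 (sqdist x).
Proof.
rewrite /laplacian /=; under eq_bigr do rewrite partial2_radial eqxx.
rewrite big_split /= sumr_const card_ord; congr (_ + _); last by rewrite -mulr_natr; ring.
rewrite [in RHS]/sqdist mulrAC -mulrA mulr_sumr mulr_sumr; apply: eq_bigr => i _.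
by rewrite /sqdist; ring.
Qed.

End radial_function.

Lemma radial_smooth (G : R -> R) : smooth1 G -> smooth (fun x => G (sqdist x)).
Proof.
by move=> sG; apply: smoothP => n; apply: n_smooth_rV_comp; [exact: sG|exact: sqdist_smooth].
Qed.

Lemma sqdist_ge0 x : 0 <= sqdist x.
Proof. by apply: sumr_ge0 => i _; exact: sqr_ge0. Qed.

Lemma sqdist_cont : continuous sqdist. Proof. exact: continuous_sqdist. Qed.

Lemma coord_sq_le i (x : E) : (x 0 i - c 0 i) ^+ 2 <= sqdist x.
Proof. by rewrite /sqdist (bigD1 i)//= lerDl; apply: sumr_ge0 => j _; exact: sqr_ge0. Qed.

Lemma compact_closed_ball (k : R) : compact [set x | sqdist x <= k].
Proof.
(* As [N >= 1], a coordinate difference larger than [N] has a square larger than [N], hence than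
   [k]; this avoids a square root. *)
pose N := `|k| + 1.
have cB : compact [set x : E | forall i, `[c 0 i - N, c 0 i + N]%classic (x 0 i)].
  by apply: (@rV_compact _ _ (fun i => `[c 0 i - N, c 0 i + N]%classic)) => i; exact: segment_compact.
apply: subclosed_compact cB _.
  have cl : closed [set y : R | y <= k] by exact: closed_le.
  by have /continuous_closedP H := sqdist_cont; exact: (H _ cl).
move=> x /= xk i; rewrite in_itv/= -ler_distl.
have := le_trans (coord_sq_le i x) xk; rewrite -real_normK ?num_real// => H.
rewrite leNgt; apply/negP => h.
have N1 : 1 <= N by rewrite lerDr.
have : N < `|x 0 i - c 0 i| ^+ 2.
  rewrite expr2; apply: (lt_le_trans h); rewrite ler_peMl// (le_trans N1)// ltW//.
have kN : k <= N by rewrite (le_trans (ler_norm _))// lerDl.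
by move/(fun h => lt_le_trans h H)/(fun h => lt_le_trans h kN); rewrite ltxx.
Qed.

Lemma cont_bounded_ball (f : E -> R) (rho : R) : continuous f ->
  exists2 M : R, 0 <= M & forall x, euclidean_ball c rho x -> `|f x| <= M.
Proof.
move=> cf; have /compact_bounded[N [_ HN]] : compact (f @` [set x | sqdist x <= rho ^+ 2]).
  by apply: continuous_compact; [exact: continuous_subspaceT|exact: compact_closed_ball].
exists (`|N| + 1) => // x; rewrite euclidean_ballE => -[_ xr].
by apply: HN; [rewrite ltr_pwDr// ler_norm|exists x => //=; exact: ltW].
Qed.

Lemma cont_sqi_ball (f : E -> R) (rho : R) : continuous f ->
  square_integrable (euclidean_ball c rho) f.
Proof.
move=> cf; have [M M0 HM] := cont_bounded_ball rho cf.
have mB : measurable (euclidean_ball c rho) := measurable_euclidean_ball c rho.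
have fB := lebesgue_euclidean_ball_lty c rho.
have mf : measurable_fun (euclidean_ball c rho) f.
  by apply: (@measurable_funS _ _ _ _ setT) => //; exact: continuous_measurable_rV.
apply: L1_sqi => //; apply: measurable_bounded_integrable => //.
  exact: measurable_funX.
exists (M ^+ 2); split; first exact: num_real.
move=> y My x Bx /=; apply: le_trans (ltW My).
by rewrite normrX lerXn2r ?nnegrE// HM.
Qed.

End radial.
End smooth_space.

(** * The torsion function of a ball *)

Section plate_on_ball.
Context {R : realType} (d : nat).
Local Notation E := 'rV[R]_d.
Local Notation mu := (lebesgue_rV d).
Local Notation leb := (@lebesgue_measure R).
Local Notation om := (@unit_ball_volume R d).
Context (c : E) (r sigma : R) (W m m1 m2 : R -> R).
Hypotheses (d0 : (0 < d)%N) (r0 : 0 < r) (sigma0 : 0 <= sigma).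
Hypothesis prof : radial_profile d sigma r W m m1 m2.
Local Notation B := (euclidean_ball c r).
Local Notation sq := (sqdist c).
Local Notation w := (fun x => W (sq x)).

Let dp : 0 < d%:R :> R. Proof. by rewrite ltr0n. Qed.
Let mB : measurable B := measurable_euclidean_ball c r.
Let fB : (mu B < +oo)%E := lebesgue_euclidean_ball_lty c r.
Let om0 : 0 < om. Proof. exact: unit_ball_volume_gt0. Qed.
Let W1 z := - (2 * d%:R)^-1 * m z.
Let W2 z := - (2 * d%:R)^-1 * m1 z.
Let dW : has_deriv W W1 := profile_deriv prof.
Let dW1 : has_deriv W1 W2. Proof. exact: has_deriv_scale (profile_deriv1 prof). Qed.

Lemma ball_sqdist rho x : euclidean_ball c rho x -> 0 < rho /\ sq x < rho ^+ 2.
Proof. by rewrite euclidean_ballE. Qed.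

Lemma fine_ball (rho : R) : 0 <= rho -> fine (mu (euclidean_ball c rho)) = om * rho ^+ d.
Proof. by move=> h; rewrite lebesgue_euclidean_ball. Qed.

Lemma radial_test_function (G : R -> R) (k : R) : smooth1 G -> k < r ^+ 2 ->
  (forall z, k <= z -> G z = 0) -> test_function B (fun x => G (sq x)).
Proof.
move=> sG kr G0; have sub : closure [set x | G (sq x) != 0] `<=` [set x | sq x <= k].
  have cl : closed [set x | sq x <= k] by apply: compact_rV_closed; exact: compact_closed_ball.
  rewrite [X in _ `<=` X](closure_id _).1//; apply: closure_subset => x /= /eqP Gx.
  by rewrite leNgt; apply/negP => /ltW /G0.
split; first exact: radial_smooth.
- apply: subclosed_compact sub; [exact: closed_closure|exact: compact_closed_ball].
- by move=> x /sub /= xk; rewrite euclidean_ballE; split => //; exact: le_lt_trans kr.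
Qed.

Lemma smooth_H2 (f : E -> R) : smooth f -> H2 B (jet_of f).
Proof.
move=> sf; have cs s : continuous (foldr (@partial R d) f s).
  by move=> x; apply: differentiable_continuous; exact: sf.
have wp s i : weak_partial B i (foldr (@partial R d) f s) (partial i (foldr (@partial R d) f s)).
  move=> phi tphi; apply: Int_by_parts => //; first exact: test_function_C1c.
  by move=> j; exact: (cs (j :: s)).
split => [|i|i j] /=; first exact: cont_sqi_ball (cs [::]).
  by split; [exact: cont_sqi_ball (cs [:: i])|exact: (wp [::])].
by split; [exact: cont_sqi_ball (cs [:: j; i])|exact: (wp [:: i])].
Qed.

Lemma Int_shell (f : E -> R) (M rho : R) : 0 <= rho <= r -> square_integrable B f ->
  (forall x, B x -> `|f x| <= M) -> (forall x, sq x < rho ^+ 2 -> f x = 0) ->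
  \int[mu]_(x in B) (f x ^+ 2) <= M ^+ 2 * (om * r ^+ d - om * rho ^+ d).
Proof.
move=> /andP[rho0 rr] sf fM f0; set A := euclidean_ball c rho.
have mA : measurable A := measurable_euclidean_ball c rho.
have AB : A `<=` B.
  move=> x /ball_sqdist[h1 h2]; rewrite euclidean_ballE; split => //.
  by apply: (lt_le_trans h2); rewrite lerXn2r ?nnegrE ?(ltW r0).
have b1 : bm (\1_A : E -> R).
  split; first exact: measurable_indic.
  by exists 1 => x; rewrite indicE; case: (_ \in _); rewrite ?normr1 ?normr0.
have -> : om * r ^+ d - om * rho ^+ d = \int[mu]_(x in B) (1 - \1_A x).
  rewrite (Int_sub mB fB) ?Rintegral_cst//; last exact: bm_cst.
  rewrite mul1r fine_ball ?(ltW r0)//; congr (_ - _).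
  transitivity (\int[mu]_(x in A) \1_A x).
    transitivity (\int[mu]_(x in A) (1 : R)).
      by rewrite Rintegral_cst// mul1r fine_ball.
    by apply: eq_Rintegral => x xA; rewrite indicE xA.
  apply/esym/eq_Int_support => x H; rewrite indicE memNset// => Ax.
  by apply: H; split => //; exact: AB.
have b2 : bm (fun x => 1 - (\1_A : E -> R) x) by bm_tac.
rewrite -(Int_scale mB fB)//; apply: le_Rintegral => //.
- exact: sqi_sq sf.
- by apply: (bm_integrable mB fB); exact: bm_scale.
move=> x Bx; rewrite indicE; have [xA|xA] := boolP (x \in A).
  by rewrite f0 ?expr0n ?subrr ?mulr0//; case: (ball_sqdist (set_mem xA)).
by rewrite subr0 mulr1 -real_normK ?num_real// lerXn2r ?nnegrE ?fM// (le_trans _ (fM _ Bx)).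
Qed.

(** The volume of the shell tends to zero with its width while [M] stays fixed, so the truncation
    error only has to be bounded pointwise, not small. *)
Lemma H2_norm2_shell (U : @jet2 R d) (M rho : R) : 0 <= rho <= r -> sqi_jet B U ->
  (forall x, B x -> [/\ `|U x| <= M, forall i, `|grad U i x| <= M & forall i j, `|hess U i j x| <= M]) ->
  (forall x, sq x < rho ^+ 2 -> [/\ U x = 0, forall i, grad U i x = 0 & forall i j, hess U i j x = 0]) ->
  H2_norm2 B U <= (1 + d%:R + d%:R * d%:R) * (M ^+ 2 * (om * r ^+ d - om * rho ^+ d)).
Proof.
move=> rr [s1 s2 s3] UM U0; rewrite /H2_norm2 !mulrDl mul1r; apply: lerD; first apply: lerD.
- by apply: Int_shell => // x => [/UM[]|/U0[]].
- apply: (@le_trans _ _ (\sum_(i < d) (M ^+ 2 * (om * r ^+ d - om * rho ^+ d)))).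
    apply: ler_sum => i _; apply: Int_shell => // x.
      by move=> /UM[_ h _]; exact: h.
    by move=> /U0[_ h _]; exact: h.
  by rewrite sumr_const card_ord mulr_natl.
- apply: (@le_trans _ _ (\sum_(i < d) \sum_(j < d) (M ^+ 2 * (om * r ^+ d - om * rho ^+ d)))).
    apply: ler_sum => i _; apply: ler_sum => j _; apply: Int_shell => // x.
      by move=> /UM[_ _ h]; exact: h.
    by move=> /U0[_ _ h]; exact: h.
  by rewrite sumr_const card_ord sumr_const card_ord -mulrnA -natrM mulr_natl.
Qed.

(** [x] is the distance to the boundary in squared radius; [a0], [a1], [a2] are [W] and its
    derivatives, of sizes [x ^+ 2], [x] and 1, and [k0], [k1], [k2] those of the cutoff. Each factor
    [s^-1] is absorbed by a factor [x], as [y = x / s <= 2]. The 9 is [4 + 2 + 2 + 1], from the four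
    terms of the second derivative. *)
Lemma cutoff_error_bound (M2 M S s x a0 a1 a2 k0 k1 k2 : R) :
  0 <= M2 -> 0 <= M -> 0 < s -> 2 * s <= S -> 0 <= x <= 2 * s ->
  `|a0| <= M2 * x ^+ 2 -> `|a1| <= M2 * x -> `|a2| <= M2 ->
  `|k0| <= M -> `|k1| <= M -> `|k2| <= M ->
  let C := M2 * (1 + 9 * M) * (1 + S + S ^+ 2) in
  [/\ `|a0 - a0 * k0| <= C,
      `|a1 - (a0 * (k1 * - s^-1) + k0 * a1)| <= C &
      `|a2 - ((a0 * (- s^-1 * (k2 * - s^-1)) + k1 * - s^-1 * a1) + (k0 * a2 + a1 * (k1 * - s^-1)))| <= C].
Proof.
move=> M20 M0 s0 sS /andP[x0 xs] A0 A1 A2 K0 K1 K2 C.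
pose y := x / s; have xE : x = y * s by rewrite /y divfK// gt_eqF.
have y0 : 0 <= y by rewrite divr_ge0// ltW.
have y2 : y <= 2 by rewrite ler_pdivrMr.
have S0 : 0 <= S by apply: le_trans sS; rewrite mulr_ge0// ltW.
have xS : x <= S := le_trans xs sS.
have x2S : x ^+ 2 <= S ^+ 2 by rewrite lerXn2r// nnegrE.
have yx : x * y <= 2 * S by rewrite [2 * S]mulrC ler_pM.
have yy : y ^+ 2 <= 4 by rewrite (_ : 4 = 2 ^+ 2 :> R) ?lerXn2r// ?nnegrE//; ring.
have e0 : `|a0 * k0| <= M2 * x ^+ 2 * M by rewrite normrM ler_pM.
have e1 : `|a0 * (k1 * - s^-1)| <= M2 * (x * y) * M.
  rewrite (_ : M2 * (x * y) * M = M2 * x ^+ 2 * (M * s^-1)); last by rewrite /y; field; rewrite gt_eqF.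
  rewrite normrM normrM normrN [`|s^-1|]ger0_norm ?invr_ge0 ?(ltW s0)//.
  by rewrite ler_pM ?mulr_ge0 ?invr_ge0 ?(ltW s0)// ler_wpM2r ?invr_ge0 ?(ltW s0).
have e2 : `|k0 * a1| <= M * (M2 * x) by rewrite normrM ler_pM.
have e3 : `|a0 * (- s^-1 * (k2 * - s^-1))| <= M2 * y ^+ 2 * M.
  rewrite (_ : M2 * y ^+ 2 * M = M2 * x ^+ 2 * (s^-1 * (M * s^-1))); last by rewrite /y; field; rewrite gt_eqF.
  rewrite !normrM !normrN [`|s^-1|]ger0_norm ?invr_ge0 ?(ltW s0)//.
  rewrite ler_pM ?mulr_ge0 ?invr_ge0 ?(ltW s0)//.
  by rewrite ler_wpM2l ?invr_ge0 ?(ltW s0)// ler_wpM2r ?invr_ge0 ?(ltW s0).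
have e4 : `|k1 * - s^-1 * a1| <= M * (M2 * y).
  rewrite (_ : M * (M2 * y) = M * s^-1 * (M2 * x)); last by rewrite /y; ring.
  rewrite !normrM normrN [`|s^-1|]ger0_norm ?invr_ge0 ?(ltW s0)//.
  by rewrite ler_pM ?mulr_ge0 ?invr_ge0 ?(ltW s0)// ler_wpM2r ?invr_ge0 ?(ltW s0).
have e5 : `|k0 * a2| <= M * M2 by rewrite normrM ler_pM.
have MM : 0 <= M2 * M by rewrite mulr_ge0.
have e6 : `|a1 * (k1 * - s^-1)| <= M * (M2 * y) by rewrite mulrC.
have CE : C = M2 * (1 + S + S ^+ 2) + 9 * (M2 * M * (1 + S + S ^+ 2)) by rewrite /C; ring.
have S2 : 0 <= S ^+ 2 by rewrite sqr_ge0.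
have p1 := mulr_ge0 M20 S0; have p2 := mulr_ge0 M20 S2.
have p3 := mulr_ge0 MM S0; have p4 := mulr_ge0 MM S2.
have q1 := ler_wpM2l M20 xS; have q2 := ler_wpM2l M20 x2S.
have q3 := ler_wpM2l MM xS; have q4 := ler_wpM2l MM x2S.
have q5 := ler_wpM2l MM yx; have q6 := ler_wpM2l MM yy; have q7 := ler_wpM2l MM y2.
have r0' : M2 * x ^+ 2 * M = M2 * M * x ^+ 2 by ring.
have r1 : M2 * (x * y) * M = M2 * M * (x * y) by ring.
have r2 : M * (M2 * x) = M2 * M * x by ring.
have r3 : M2 * y ^+ 2 * M = M2 * M * y ^+ 2 by ring.
have r4 : M * (M2 * y) = M2 * M * y by ring.
have r5 : M * M2 = M2 * M by ring.
rewrite r0' in e0; rewrite r1 in e1; rewrite r2 in e2; rewrite r3 in e3.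
rewrite r4 in e4 e6; rewrite r5 in e5.
rewrite CE !mulrDr !mulr1; split.
- apply: (le_trans (ler_normB _ _)); apply: (le_trans (lerD A0 e0)); lra.
- apply: (le_trans (ler_normB _ _)); apply: (le_trans (lerD A1 (ler_normD _ _))).
  apply: (le_trans (lerD (lexx _) (lerD e1 e2))); lra.
- apply: (le_trans (ler_normB _ _)).
  apply: (le_trans (lerD A2 (ler_normD _ _))).
  apply: (le_trans (lerD (lexx _) (lerD (ler_normD _ _) (ler_normD _ _)))).
  apply: (le_trans (lerD (lexx _) (lerD (lerD e3 e4) (lerD e5 e6)))); lra.
Qed.

Lemma smooth_w : smooth w. Proof. exact: radial_smooth (profile_smooth prof). Qed.

(* [W] vanishes to second order at the boundary, which compensates the factors
   [1/s] and [1/s^2] produced by differentiating a cutoff at distance [s]. *)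
Lemma cutoff_approximation : exists2 K : R, 0 <= K & forall rho, 0 <= rho < r ->
  exists2 phi, test_function B phi &
    H2_norm2 B (jet_sub (jet_of w) (jet_of phi)) <= K * (om * r ^+ d - om * rho ^+ d).
Proof.
have [chi [chi1 [chi2 [Mc Mc0 [schi dchi dchi1 chi0 [chiE chiM]]]]]] := @cutoff_exists R.
have cW2 : continuous W2.
  by apply: cont_mul; [exact: cont_cst|exact: has_deriv_cont (profile_deriv2 prof)].
have [M2 M20 HM2] := cont_seg_bounded 0 (r ^+ 2) cW2.
have W1r : W1 (r ^+ 2) = 0 by rewrite /W1 (profile_bdry1 prof) mulr0.
have bW1 z : 0 <= z <= r ^+ 2 -> `|W1 z| <= M2 * (r ^+ 2 - z).
  move=> /andP[z0 zr]; have := mean_value_bound dW1 zr.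
  rewrite W1r sub0r normrN; apply => x /andP[zx xr]; apply: HM2.
  by rewrite xr (le_trans z0).
have bW z : 0 <= z <= r ^+ 2 -> `|W z| <= M2 * (r ^+ 2 - z) ^+ 2.
  move=> /andP[z0 zr]; have := mean_value_bound (K := M2 * (r ^+ 2 - z)) dW zr.
  rewrite (profile_bdry prof) sub0r normrN -mulrA -expr2; apply => x /andP[zx xr].
  apply: (le_trans (bW1 x _)); first by rewrite xr (le_trans z0).
  by rewrite ler_wpM2l// lerD2l lerN2.
pose C := M2 * (1 + 9 * Mc) * (1 + r ^+ 2 + (r ^+ 2) ^+ 2).
have C0 : 0 <= C by rewrite /C; nneg.
(* Chain rule through the squared distance: [2 * r] bounds its first derivatives, and
   [4 * r ^+ 2 + 2] accounts for the two terms of a second derivative. *)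
pose M := C * (1 + 2 * r + 4 * r ^+ 2 + 2).
exists ((1 + d%:R + d%:R * d%:R) * M ^+ 2).
  by rewrite mulr_ge0 ?sqr_ge0// !addr_ge0 ?mulr_ge0.
move=> rho /andP[rho0 rr]; pose s := (r ^+ 2 - rho ^+ 2) / 2.
have rr2 : rho ^+ 2 < r ^+ 2 by rewrite ltrXn2r// nnegrE ltW.
have s0 : 0 < s by rewrite divr_gt0// subr_gt0.
have sE : 2 * s = r ^+ 2 - rho ^+ 2 by rewrite /s; field.
have sS : 2 * s <= r ^+ 2 by rewrite sE lerBlDr lerDl sqr_ge0.
(* [T z] is [(r ^+ 2 - z) / s - 1]: it is 0 at depth [s] below the boundary and 1 at depth [2 * s],
   which is the radius [rho]. So the cutoff vanishes near the boundary and is 1 on the inner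
   ball. *)
pose T z := - s^-1 * z + (s^-1 * r ^+ 2 - 1).
have dT : has_deriv T (fun=> - s^-1).
  apply: has_deriv_shift; apply: eq_has_deriv (has_deriv_scale (- s^-1) (@has_deriv_id R)) => //.
  by move=> z; rewrite mulr1.
have sT : smooth1 T.
  by apply: smooth1_add; [apply: smooth1_scale; exact: smooth1_id|exact: smooth1_cst].
pose G z := W z * chi (T z).
pose G1 z := W z * (chi1 (T z) * - s^-1) + chi (T z) * W1 z.
pose G2 z := (W z * (- s^-1 * (chi2 (T z) * - s^-1)) + chi1 (T z) * - s^-1 * W1 z)
   + (chi (T z) * W2 z + W1 z * (chi1 (T z) * - s^-1)).
have dcT := has_deriv_compose dchi dT; have dcT1 := has_deriv_compose dchi1 dT.
have dG : has_deriv G G1 by exact: has_deriv_mul.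
have dG1 : has_deriv G1 G2.
  apply: has_deriv_add; last exact: has_deriv_mul.
  apply: has_deriv_mul => //.
  have := has_deriv_mul dcT1 (has_deriv_cst (- s^-1)).
  by apply: eq_has_deriv => z //; rewrite mulr0 add0r.
have sG : smooth1 G.
  by apply: smooth1_mul; [exact: profile_smooth prof|exact: smooth1_comp].
have TE z : T z = (r ^+ 2 - z) / s - 1 by rewrite /T; ring.
have tG : test_function B (fun x => G (sq x)).
  apply: (radial_test_function (k := r ^+ 2 - s)) => // [|z zr].
    by rewrite ltrBlDr ltrDl.
  rewrite /G chi0 ?mulr0// TE subr_le0 ler_pdivrMr// mul1r; lra.
exists (fun x => G (sq x)) => //; rewrite -mulrA.
have sw := H2_sqi_jet (smooth_H2 smooth_w).
apply: H2_norm2_shell; first by rewrite rho0 ltW.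
- exact: sqi_jet_sub sw (sqi_jet_test mB fB tG).
- move=> x Bx; have [_ xr] := ball_sqdist Bx.
  have z0 := sqdist_ge0 c x; have zr := ltW xr.
  have xi i : `|x 0 i - c 0 i| <= r := euclidean_ball_bounded Bx i.
  have [e0 e1 e2] : [/\ `|W (sq x) - G (sq x)| <= C, `|W1 (sq x) - G1 (sq x)| <= C &
      `|W2 (sq x) - G2 (sq x)| <= C].
    have [h|/ltW h] := leP (sq x) (rho ^+ 2).
      have T1 : 1 <= T (sq x).
        by rewrite TE lerBrDl ler_pdivlMr// (_ : 1 + 1 = 2)// sE lerD2l lerN2.
      have [k0 k1 k2] := chiE _ T1.
      rewrite /G /G1 /G2 k0 k1 k2 !(mul0r, mulr0, mulr1, mul1r, add0r, addr0) !subrr normr0.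
      by split.
    have [k0 k1 k2] := chiM (T (sq x)).
    have zz : 0 <= sq x <= r ^+ 2 by rewrite z0.
    apply: (cutoff_error_bound (x := r ^+ 2 - sq x)) => //.
    - by rewrite subr_ge0 zr sE lerD2l lerN2.
    - exact: bW.
    - exact: bW1.
    - exact: HM2.
  have r4 : 0 <= 4 * r ^+ 2 by rewrite mulr_ge0 ?sqr_ge0.
  have r2 : 0 <= 2 * r by rewrite mulr_ge0// ltW.
  have M1 k : 0 <= k <= 1 + 2 * r + 4 * r ^+ 2 + 2 -> C * k <= M.
    by move=> /andP[_ k1]; rewrite ler_wpM2l.
  have g1 i : `|2 * (x 0 i - c 0 i)| <= 2 * r by rewrite normrM ger0_norm// ler_wpM2l.
  split => [|i|i j] /=.
  - apply: (le_trans e0); rewrite -[C]mulr1; apply: M1; lra.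
  - rewrite (partial_radial _ dW) (partial_radial _ dG) -mulrBl normrM.
    apply: (@le_trans _ _ (C * (2 * r))); first by rewrite ler_pM.
    apply: M1; lra.
  - rewrite (partial2_radial _ dW dW1) (partial2_radial _ dG dG1).
    set a := 4 * _ * _; set b := 2 * _%:R.
    rewrite (_ : _ - _ = (W2 (sq x) - G2 (sq x)) * a + (W1 (sq x) - G1 (sq x)) * b); last by ring.
    have ha : `|a| <= 4 * r ^+ 2.
      rewrite /a !normrM [`|4|]ger0_norm// expr2 mulrA ler_pM// ?mulr_ge0//.
      by rewrite ler_wpM2l.
    have hb : `|b| <= 2 by rewrite /b; case: (j == i); rewrite ?mulr1 ?mulr0 ?normr0 ?ger0_norm.
    clearbody a b; apply: (le_trans (ler_normD _ _)); rewrite !normrM.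
    apply: (@le_trans _ _ (C * (4 * r ^+ 2) + C * 2)); first by rewrite lerD// ler_pM.
    rewrite -mulrDr; apply: M1; lra.
- move=> x xr.
  have T1 : 1 < T (sq x).
    by rewrite TE ltrBrDl ltr_pdivlMr// (_ : 1 + 1 = 2)// sE ltrD2l ltrN2.
  have [k0 k1 k2] := chiE _ (ltW T1).
  have E0 : G (sq x) = W (sq x) by rewrite /G k0 mulr1.
  have E1 : G1 (sq x) = W1 (sq x) by rewrite /G1 k0 k1 mul0r mulr0 add0r mul1r.
  have E2 : G2 (sq x) = W2 (sq x).
    by rewrite /G2 k0 k1 k2 !(mul0r, mulr0, add0r, addr0, mul1r).
  split => [|i|i j] /=; first by rewrite E0 subrr.
    by rewrite (partial_radial _ dW) (partial_radial _ dG) E1 subrr.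
  by rewrite (partial2_radial _ dW dW1) (partial2_radial _ dG dG1) E1 E2 subrr.
Qed.

Lemma ball_H20 : H20 B (jet_of w).
Proof.
split; first exact: smooth_H2 smooth_w.
have [K K0 HK] := cutoff_approximation.
pose rho (n : nat) : R := r * (1 - harmonic n).
have h01 n : 0 < (harmonic n : R) <= 1 by rewrite invr_gt0 ltr0n/= invf_le1 ?ler1n.
have rhoI n : 0 <= rho n < r.
  have /andP[h0 h1] := h01 n; rewrite /rho mulr_ge0 ?(ltW r0) ?subr_ge0//=.
  by rewrite gtr_pMr// ltrBlDr ltrDl.
have /choice[phi Hphi] : forall n, exists phi, test_function B phi /\
    H2_norm2 B (jet_sub (jet_of w) (jet_of phi)) <= K * (om * r ^+ d - om * rho n ^+ d).
  by move=> n; have [phi h1 h2] := HK _ (rhoI n); exists phi.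
exists phi; split; first by move=> n; case: (Hphi n).
have sw := H2_sqi_jet (smooth_H2 smooth_w).
rewrite (_ : (fun n => _) = fun n => (H2_norm2 B (jet_sub (jet_of w) (jet_of (phi n))))%:E); last first.
  apply/funext => n; rewrite sqnorm_H2E//.
  exact: sqi_jet_sub sw (sqi_jet_test mB fB (Hphi n).1).
apply: cvg_EFin; first exact: nearW.
have U : (fun n => K * (om * r ^+ d - om * rho n ^+ d)) @ \oo --> (0 : R).
  pose F (h : R) := K * (om * r ^+ d - om * (r * (1 - h)) ^+ d).
  have cF : continuous F.
    apply: cont_mul; first exact: cont_cst.
    apply: cont_sub; first exact: cont_cst.
    apply: cont_mul; first exact: cont_cst.
    apply: cont_exp; apply: cont_mul; first exact: cont_cst.
    by apply: cont_sub; [exact: cont_cst|move=> z; exact: cvg_id].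
  have F0 : F 0 = 0 by rewrite /F subr0 mulr1 subrr mulr0.
  rewrite -F0; apply: (@cvg_comp _ _ _ (fun n => harmonic n) F); first exact: cvg_harmonic.
  exact: cF.
apply: (squeeze_cvgr _ (cvg_cst 0) U); apply: nearW => n.
by rewrite H2_norm2_ge0 (Hphi n).2.
Qed.

Local Notation Y := (profile_lap d m m1).

Let lap_w x : laplacian (jet_of w) x = Y (sq x).
Proof.
rewrite (laplacian_radial c dW dW1) /W1 /W2 /profile_lap.
by field; rewrite gt_eqF.
Qed.

Let dY : has_deriv Y (fun z => (1 - sigma * m z) / (2 * d%:R)).
Proof. exact: (profile_lap_deriv d0 prof). Qed.
Let dY1 : has_deriv (fun z => (1 - sigma * m z) / (2 * d%:R)) (fun z => - (sigma / (2 * d%:R)) * m1 z).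
Proof.
have := has_deriv_shift (2 * d%:R)^-1 (has_deriv_scale (- (sigma / (2 * d%:R))) (profile_deriv1 prof)).
by apply: eq_has_deriv => z //; field; rewrite gt_eqF.
Qed.

Let lap_y x : \sum_i partial i (partial i (fun x => Y (sq x))) x = 1 + sigma * Y (sq x).
Proof.
rewrite -/(laplacian (jet_of (fun x => Y (sq x))) x) (laplacian_radial c dY dY1) /profile_lap.
by field; rewrite gt_eqF.
Qed.

(** The Laplacian [y] of [w] satisfies [Lap y = 1 + sigma * y]. Moving both derivatives off [phi] in
    the first term, and one derivative from [phi] to [w] in the second, produces opposite terms
    [sigma * y]. The boundary never enters, as [phi] has compact support. *)
Lemma ball_weak_equation phi : test_function B phi ->
  plate_form B sigma (jet_of w) (jet_of phi) = \int[mu]_(x in B) phi x.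
Proof.
move=> tphi; have Cphi := test_function_C1c tphi; have Cd := test_function_partial_C1c tphi.
have bmt (v : E -> R) (p : E -> R) : continuous v -> C1c B p -> bm (fun x => v x * p x).
  move=> cv Cp; have cp := C1c_cont Cp; case: (Cp) => _ _ [K cK [_ p0]].
  by apply: (cont_supp_bm cK); [exact: cont_mul|move=> x /p0 ->; rewrite mulr0].
have bmt' (v : E -> R) (p : E -> R) i : continuous v -> C1c B p -> bm (fun x => v x * partial i p x).
  move=> cv Cp; case: (Cp) => _ cdp [K cK [_ p0]]; have p0' := partial_supp i cK p0.
  by apply: (cont_supp_bm cK); [exact: cont_mul|move=> x /p0' ->; rewrite mulr0].
have csq := @sqdist_cont R d c.
pose y x := Y (sq x); pose Y1 z := (1 - sigma * m z) / (2 * d%:R).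
have dy x : differentiable y x by apply: (differentiable_chain dY); exact: sqdist_diff.
have py i : partial i y = fun x => Y1 (sq x) * (2 * (x 0 i + - c 0 i)).
  by apply/funext => x; rewrite /y (partial_radial _ dY).
have cxi i : continuous (fun x : E => 2 * (x 0 i + - c 0 i)).
  apply: cont_mul; first exact: cont_cst.
  by apply: cont_add; [exact: continuous_coord|exact: cont_cst].
have cy : continuous y by exact: differentiable_cont.
have cpy i : continuous (partial i y).
  rewrite py; apply: cont_mul => //; exact: (cont_comp (has_deriv_cont dY1) csq).
have dpy i x : differentiable (partial i y) x.
  rewrite py; apply: differentiable_mul.
    by apply: (differentiable_chain dY1); exact: sqdist_diff.
  apply: differentiable_scale; apply: differentiable_add; first exact: differentiable_coord.
  exact: differentiable_const.
have cm1 : continuous (fun z => - (sigma / (2 * d%:R)) * m1 z).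
  by apply: cont_mul; [exact: cont_cst|exact: has_deriv_cont (profile_deriv2 prof)].
have cppy i j : continuous (partial j (partial i y)).
  rewrite (_ : partial j _ = fun x => - (sigma / (2 * d%:R)) * m1 (sq x) *
    (4 * (x 0 i - c 0 i) * (x 0 j - c 0 j)) + Y1 (sq x) * (2 * (j == i)%:R)); last first.
    by apply/funext => x; rewrite /y (partial2_radial _ dY dY1).
  have cx k : continuous (fun x : E => x 0 k - c 0 k).
    by apply: cont_sub; [exact: continuous_coord|exact: cont_cst].
  apply: cont_add; apply: cont_mul.
  - exact: (cont_comp cm1 csq).
  - by apply: cont_mul => //; apply: cont_mul => //; exact: cont_cst.
  - exact: (cont_comp (has_deriv_cont dY1) csq).
  - exact: cont_cst.
have sw := smooth_w.
have dw x : differentiable w x by exact: (sw [::]).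
have cpw i : continuous (partial i w) by move=> x; apply: differentiable_continuous; exact: (sw [:: i]).
have dpw i x : differentiable (partial i w) x by exact: (sw [:: i]).
have cppw i j : continuous (partial j (partial i w)).
  by move=> x; apply: differentiable_continuous; exact: (sw [:: j; i]).
have H1 : \int[mu]_(x in B) (laplacian (jet_of w) x * laplacian (jet_of phi) x) =
    \int[mu]_(x in B) ((1 + sigma * y x) * phi x).
  transitivity (\int[mu]_(x in B) (\sum_i y x * partial i (partial i phi) x)).
    by apply: eq_Rintegral => x _; rewrite lap_w; exact: mulr_sumr.
  rewrite (Int_sum mB fB); last by move=> i; exact: bmt'.
  transitivity (\sum_i \int[mu]_(x in B) (partial i (partial i y) x * phi x)).
    apply: eq_bigr => i _; rewrite (Int_by_parts i mB fB (Cd i) dy cpy).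
    by rewrite (Int_by_parts i mB fB Cphi (dpy i) (cppy i)) opprK.
  rewrite -(Int_sum mB fB); last by move=> i; exact: bmt.
  by apply: eq_Rintegral => x _; rewrite -mulr_suml lap_y.
have H2 : \int[mu]_(x in B) (\sum_i grad (jet_of w) i x * grad (jet_of phi) i x) =
    - \int[mu]_(x in B) (y x * phi x).
  rewrite /= (Int_sum mB fB); last by move=> i; exact: bmt'.
  transitivity (- \sum_i \int[mu]_(x in B) (partial i (partial i w) x * phi x)).
    by rewrite -sumrN; apply: eq_bigr => i _; rewrite (Int_by_parts i mB fB Cphi (dpw i) (cppw i)).
  congr (- _); rewrite -(Int_sum mB fB); last by move=> i; exact: bmt.
  by apply: eq_Rintegral => x _; rewrite -mulr_suml -/(laplacian (jet_of w) x) lap_w.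
rewrite /plate_form H1 H2 mulrN.
have byp := bmt _ _ cy Cphi; have bp := C1c_bm Cphi.
rewrite -(Int_scale mB fB)// -(Int_sub mB fB); last 2 first.
- apply: bmt => //; apply: cont_add; first exact: cont_cst.
  by apply: cont_mul => //; exact: cont_cst.
- exact: bm_scale.
by apply: eq_Rintegral => x _; ring.
Qed.

(* Layer cake: [W(|x|^2)] is the integral of [m(t^2) t / d] over [|x| < t < r]. *)
Lemma ball_integral :
  \int[mu]_(x in B) W (sq x) = om / d%:R * \int[leb]_(x in `[0, r]) (m (x ^+ 2) * x ^+ d.+1).
Proof.
pose S := `[0, r]%classic : set (measurableTypeR R).
have mS : measurable S by exact: measurable_seg.
have fS : (leb S < +oo)%E by exact: leb_seg_lty.
(* Clamping [t] to [[0, r]] leaves the integrand unchanged where it is used and makes it bounded on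
   the whole line, as [bm] requires. *)
pose k0 (t : R) := let t' := Num.min (Num.max t 0) r in m (t' ^+ 2) * t' / d%:R.
have cX : continuous (fun x : R => x) by move=> z; exact: cvg_id.
have ccl : continuous (fun t : R => Num.min (Num.max t 0) r).
  by apply: cont_min; [apply: cont_max => //|]; exact: cont_cst.
have ck0 : continuous k0.
  apply: cont_mul; last exact: cont_cst.
  apply: cont_mul => //; apply: (cont_comp (has_deriv_cont (profile_deriv1 prof))).
  exact: cont_exp.
have bk0 : bm (k0 : measurableTypeR R -> R).
  have cq : continuous (fun x : R => m (x ^+ 2) * x / d%:R).
    apply: cont_mul; last exact: cont_cst.
    by apply: cont_mul => //; apply: (cont_comp (has_deriv_cont (profile_deriv1 prof))); exact: cont_exp.
  have [M M0 HM] := cont_seg_bounded 0 r cq.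
  apply: (bm_cont_bounded ck0 (M := M)) => x; apply: HM.
  by rewrite le_min le_max lexx orbT (ltW r0) ge_min lexx orbT.
have k0E t : 0 <= t <= r -> k0 t = m (t ^+ 2) * t / d%:R.
  by move=> /andP[t0 tr]; rewrite /k0 (max_l t0) (min_l tr).
pose A : set (measurableTypeR R * E) := [set z | sq z.2 < z.1 ^+ 2].
have mA : measurable A.
  apply: measurable_predP; apply: measurable_fun_ltr.
    by apply: (measurableT_comp (continuous_measurable_rV (@sqdist_cont R d c))).
  by apply: measurable_funX.
pose F (z : measurableTypeR R * E) : R := \1_S z.1 * k0 z.1 * \1_A z.
have bF : bm F.
  have b1 : bm (\1_A : measurableTypeR R * E -> R).
    split; first exact: measurable_indic.
    by exists 1 => x; rewrite indicE; case: (_ \in _); rewrite ?normr1 ?normr0.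
  have b2 : bm (fun z : measurableTypeR R * E => k0 z.1).
    by case: bk0 => mk [M HM]; split; [exact: (measurableT_comp mk)|exists M].
  have b3 : bm (fun z : measurableTypeR R * E => (\1_S z.1 : R)).
    split.
      have mi : measurable_fun setT (\1_S : measurableTypeR R -> R) by exact: measurable_indic.
      exact: (measurableT_comp mi).
    by exists 1 => x; rewrite indicE; case: (_ \in _); rewrite ?normr1 ?normr0.
  by rewrite /F; bm_tac.
have := bm_fubini mS mB fS fB bF.
have -> : \int[leb]_(t in S) \int[mu]_(x in B) F (t, x) =
    om / d%:R * \int[leb]_(x in `[0, r]) (m (x ^+ 2) * x ^+ d.+1).
  have cq : continuous (fun x : R => m (x ^+ 2) * x ^+ d.+1).
    by apply: cont_mul; [apply: (cont_comp (has_deriv_cont (profile_deriv1 prof))); exact: cont_exp|exact: cont_exp].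
  rewrite -RintegralZl//; last exact: cont_int_seg.
  apply: eq_Rintegral => t tS; have := tS; rewrite inE /S /= in_itv /= => /andP[t0 tr].
  transitivity (\int[mu]_(x in euclidean_ball c t) (k0 t)).
    transitivity (\int[mu]_(x in euclidean_ball c t) F (t, x)).
      apply: eq_Int_support => x H; rewrite /F [\1_A _]indicE memNset ?mulr0// => Ax.
      have tp : 0 < t.
        rewrite lt_neqAle t0 andbT; apply/eqP => t00; move: Ax.
        by rewrite /A /= -t00 expr0n ltNge sqdist_ge0.
      apply: H; rewrite !euclidean_ballE; split; split => //.
      by apply: (lt_le_trans Ax); rewrite /= lerXn2r// nnegrE ltW.
    apply: eq_Rintegral => x; rewrite inE => /ball_sqdist[_ xt].
    by rewrite /F !indicE tS mem_set// mul1r mulr1.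
  rewrite Rintegral_cst; last exact: measurable_euclidean_ball.
  by rewrite fine_ball// k0E ?t0// [t ^+ d.+1]exprS; ring.
move=> ->; apply: eq_Rintegral => x; rewrite inE => /ball_sqdist[_ xr].
pose rho := Num.sqrt (sq x); have rho0 : 0 <= rho := sqrtr_ge0 _.
have rhoE : rho ^+ 2 = sq x by rewrite sqr_sqrtr// sqdist_ge0.
have rr : rho <= r.
  by rewrite leNgt; apply/negP => h; move: xr; rewrite -rhoE ltNge lerXn2r// ?nnegrE ?(ltW r0) ?(ltW h).
rewrite -[in LHS]rhoE -(profile_int d0 prof (rho := rho)) ?rho0//.
rewrite -(@Rintegral_itv_obnd_cbnd _ rho (BRight r)); last first.
  apply: integrableS (cont_int_seg rho r _) => //; first by apply: subset_itvr; rewrite bnd_simp.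
  apply: cont_mul; last exact: cont_cst.
  by apply: cont_mul => //; apply: (cont_comp (has_deriv_cont (profile_deriv1 prof))); exact: cont_exp.
transitivity (\int[leb]_(t in `]rho, r]) F (t, x)).
  apply: eq_Rintegral => t; rewrite inE /= in_itv /= => /andP[rt tr].
  have t0 : 0 <= t := le_trans rho0 (ltW rt).
  rewrite /F /= !indicE !mem_set; first by rewrite mul1r mulr1 k0E// t0.
    by rewrite /A /= -rhoE ltrXn2r// nnegrE.
  by rewrite /S /= in_itv/= t0.
apply: eq_Int_support => t H; rewrite /F.
have [tS|tS] := boolP (t \in S); last by rewrite [\1_S _]indicE /= (negbTE tS) !mul0r.
rewrite [\1_A _]indicE memNset ?mulr0// => At; apply: H; split; last exact: set_mem.
have := set_mem tS; rewrite /S /= !in_itv /= => /andP[t0 ->]; rewrite andbT.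
rewrite ltNge; apply/negP => h; move: At; rewrite /A /= -rhoE ltNge lerXn2r// ?nnegrE//.
Qed.

Lemma ball_rigidity : torsional_rigidity B sigma =
  om / d%:R * \int[leb]_(x in `[0, r]) (m (x ^+ 2) * x ^+ d.+1).
Proof.
rewrite -ball_integral; apply: (torsional_rigidityE mB fB sigma0 ball_H20).
exact: ball_weak_equation.
Qed.

End plate_on_ball.

Theorem theorem2 (R : realType) (d : nat) (Omega : set 'rV[R]_d) (tau : R)
    (c : 'rV[R]_d) (r : R) :
  (0 < d)%N ->
  open Omega ->
  (lebesgue_rV d Omega < +oo)%E ->
  0 <= tau ->
  lebesgue_rV d (euclidean_ball c r) = lebesgue_rV d Omega ->
  torsional_rigidity Omega tau <= torsional_rigidity (euclidean_ball c r) tau.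
Proof.
move=> d0 oOm fOm tau0 EV.
have mOm : measurable Omega by exact: open_measurable_rV.
(* The ball is empty here, so [Omega] is a null set and the integral of every test function
   vanishes. *)
have [rle|r0] := leP r 0.
  have B0 : euclidean_ball c r = set0.
    by rewrite euclidean_ballE -subset0 => x [/(le_lt_trans rle)]; rewrite ltxx.
  have V0 : lebesgue_rV d Omega = 0%E by rewrite -EV B0 measure0.
  have -> : torsional_rigidity (euclidean_ball c r) tau = 0.
    by rewrite /torsional_rigidity B0 Rintegral_set0.
  apply: torsional_rigidity_le => // phi tphi.
  have bp := C1c_bm (test_function_C1c tphi); have [M M0 HM] := bm_bound bp.
  have : `|\int[lebesgue_rV d]_(x in Omega) phi x| <= M * fine (lebesgue_rV d Omega).
    exact: (Int_bound mOm fOm bp (fun x _ => HM x)).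
  rewrite V0 mulr0 normr_le0 => /eqP ->.
  rewrite mulr0 sub0r -opprD oppr_le0 addr_ge0 ?mulr_ge0//.
    by apply: Rintegral_ge0 => x _; exact: sqr_ge0.
  by apply: Rintegral_ge0 => x _; exact: gsq_ge0.
have om0 := @unit_ball_volume_gt0 R d.
have Vr : fine (lebesgue_rV d Omega) = unit_ball_volume d * r ^+ d.
  by rewrite -EV lebesgue_euclidean_ball// ltW.
have Er : radius d (fine (lebesgue_rV d Omega)) = r by rewrite Vr radius_ball// ltW.
have V_gt0 : 0 < fine (lebesgue_rV d Omega) by rewrite Vr mulr_gt0// exprn_gt0.
have [W [m [m1 [m2 prof]]]] := @radial_profile_exists R d tau tau0 r.
rewrite (ball_rigidity c d0 r0 tau0 prof).
have sq_itv x : 0 <= x <= r -> 0 <= x ^+ 2 <= r ^+ 2.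
  by move=> /andP[x0 xr]; rewrite sqr_ge0 lerXn2r// nnegrE ltW.
have cq : continuous (fun x : R => m (x ^+ 2)).
  apply: (cont_comp (has_deriv_cont (profile_deriv1 prof))).
  by apply: cont_exp => z; exact: cvg_id.
have qM x : 0 <= x <= r -> 0 <= m (x ^+ 2) <= m 0.
  by move=> /sq_itv /(profile_itv prof).
have q1 x : 0 <= x <= r -> 0 <= 1 - tau * m (x ^+ 2) <= 1.
  by move=> /sq_itv /(profile_tension prof).
apply: torsional_rigidity_le => //.
  rewrite mulr_ge0 ?divr_ge0 ?(ltW om0)//; apply: Rintegral_ge0 => x.
  by rewrite /= in_itv/= => xr; have /andP[q0 _] := qM _ xr; case/andP: xr => x0 _; rewrite mulr_ge0// exprn_ge0.
move=> phi tphi; have := @plate_bound R d Omega d0 mOm fOm tau (m 0) (fun x => m (x ^+ 2)) tau0 cq V_gt0.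
rewrite Er; move/(_ qM q1); apply; last 2 first.
- exact: test_function_C1c.
- by move=> i; exact: test_function_partial_C1c.
move=> p pr; rewrite -mulrA (ball_profile_identity d0 r0 prof pr) mulrA; ring.
Qed.
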